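(* Consider the embedded (unfitted) ''Aubin-Robin method'' with shifted boundary polynomial correction for the full Robin problem $-\nabla^2u+\alpha u=f$ in $\Omega$, $u+\varepsilon\,\partial_n u=u_{RD}+\varepsilon q_{RN}$ on $\Gamma$: find $u\in\mathcal V$ such that for all $v\in\mathcal V$ $$ \mathcal I_{\overline\Omega}(u)-(\partial_{\bar n}u(\overline{\boldsymbol x}),v)_{\overline\Gamma}-(f,v)_{\overline\Omega} +\frac{\gamma}{\gamma+\varepsilon}\,\mathcal A_{\overline\Gamma}(u(\boldsymbol x)-u_{RD}) +\frac{\gamma\,\varepsilon}{\gamma+\varepsilon}\,\mathcal A_{\overline\Gamma}(\partial_nu(\boldsymbol x)-q_{RN})=0 . $$ This method is asymptotic preserving both in the Dirichlet limit $\varepsilon\to0$ and in the Neumann limit $\varepsilon^{-1}\to0$. In particular: (i) In the limit $\varepsilon\ll1$, the discrete modes $u_m\in\mathcal V$ of the formal expansion $u=\sum_{m\ge0}\varepsilon^m u_m$ satisfy, for every $m\ge0$ and all $v\in\mathcal V$, the variational problems $$ \mathcal I_{\overline\Omega}(u_m)-(\partial_{\bar n}u_m(\overline{\boldsymbol x}),v)_{\overline\Gamma}-(f_m,v)_{\overline\Omega}+\mathcal A_{\overline\Gamma}(u_m(\boldsymbol x)-u_{D,m})=\overline{\mathcal E}_m , $$ and these problems are coercive. Here $u_{D,0}=u_{RD}$, $u_{D,1}=q_{RN}-\partial_nu_0(\boldsymbol x)$, $u_{D,m}=-\partial_nu_{m-1}(\boldsymbol x)$ for $m>1$; $f_0=f$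 and $f_m=0$ for $m\ge1$; $\overline{\mathcal E}_0=0$ and $$ \overline{\mathcal E}_m=-\sum_{\ell=0}^{m-1}(-\gamma)^{-(m-\ell)}\,\mathcal A_{\overline\Gamma}(u_\ell(\boldsymbol x)-u_{D,\ell}),\qquad m\ge1 . $$ (ii) In the limit $\varepsilon^{-1}\ll1$, the discrete modes $u_m\in\mathcal V$ of the formal expansion $u=\sum_{m\ge0}\varepsilon^{-m}u_m$ satisfy, for every $m\ge0$ and all $v\in\mathcal V$, $$ \mathcal I_{\overline\Omega}(u_m)-(\partial_{\bar n}u_m(\overline{\boldsymbol x}),v)_{\overline\Gamma}-(f_m,v)_{\overline\Omega}+\mathcal A_{\overline\Gamma}\big(\gamma(\nabla u_m(\boldsymbol x)\cdot\boldsymbol n-q_{N,m})\big)=\overline{\mathcal E}_m , $$ with $q_{N,0}=q_{RN}$, $q_{N,1}=u_{RD}-u_0(\boldsymbol x)$, $q_{N,m}=-u_{m-1}(\boldsymbol x)$ for $m>1$; $f_0=f$ and $f_m=0$ for $m\ge1$; $\overline{\mathcal E}_0=0$ and $$ \overline{\mathcal E}_m=\sum_{\ell=0}^{m-1}(-\gamma)^{m+1-\ell}\,\mathcal A_{\overline\Gamma}(\nabla u_\ell(\boldsymbol x)\cdot\boldsymbol n-q_{N,\ell}),\qquad m\ge1 . $$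
   Context: Geometry. $\Omega\subset\mathbb R^2$ is a bounded domain with smooth (''true'') boundary $\Gamma$ and outward unit normal $\boldsymbol n$. A triangular mesh which does not conform to $\Gamma$ is given; $\overline\Omega$ (the surrogate domain) is a union of mesh triangles and $\overline\Gamma=\partial\overline\Omega$, made of mesh edges, has outward unit normal $\overline{\boldsymbol n}$. A map $\mathcal M:\overline\Gamma\to\Gamma$, $\overline{\boldsymbol x}\mapsto\boldsymbol x=\mathcal M(\overline{\boldsymbol x})$, is given. $\mathcal V$ is the space of continuous functions on $\overline\Omega$ that are polynomials of degree at most $P$ on each triangle. $\alpha\ge0$ and $\gamma>0$ are constants ($\gamma^{-1}$ is the penalty parameter). $(g,k)_A=\int_A gk$. Evaluation on boundaries. In integrals over $\overline\Gamma$ with integration point $\overline{\boldsymbol x}$: $w(\overline{\boldsymbol x})$ (or just $w$) is the trace of $w\in\mathcal V$; $\partial_{\bar n}w(\overline{\boldsymbol x})=\nabla w(\overline{\boldsymbol x})\cdot\overline{\boldsymbol n}$ is computed in the mesh element adjacent to the edge containing $\overline{\boldsymbol x}$; $w(\boldsymbol x)$ and $\partial_nw(\boldsymbol x)=\nabla w(\boldsymbol x)\cdot\boldsymbol n(\boldsymbol x)$ are obtained by evaluating, at $\boldsymbol x=\mathcal M(\overline{\boldsymbol x})$, the polynomial representing $w$ in that adjacent element (extended as a polynomial to $\mathbb R^2$). The data $u_{RD},q_{RN}$, given on $\Gamma$, are evaluated at $\boldsymbol x=\mathcal M(\overline{\boldsymbol x})$. Operators (functionals of the test function $v$): $\mathcal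 I_{\overline\Omega}(u)=(\nabla u,\nabla v)_{\overline\Omega}+\alpha(u,v)_{\overline\Omega}$; $\ \mathcal A_{\overline\Gamma}(w)=\big(w,\ v(\boldsymbol x)/\gamma\big)_{\overline\Gamma}$. Discrete modes are obtained by formally inserting the expansion into the method, expanding in powers of $\varepsilon$ (resp. $\varepsilon^{-1}$), and equating equal powers (formal power series; no convergence is claimed). Continuous modes. For smooth data the exact solution has the formal expansions: Dirichlet limit $u=\sum_m\varepsilon^mu_m$ with $-\nabla^2u_0+\alpha u_0=f$, $u_0=u_{RD}$ on $\Gamma$; $-\nabla^2u_m+\alpha u_m=0$ for $m\ge1$ with $u_1=q_{RN}-\partial_nu_0$ and $u_m=-\partial_nu_{m-1}$ ($m>1$) on $\Gamma$. Neumann limit $u=\sum_m\varepsilon^{-m}u_m$ with $-\nabla^2u_0+\alpha u_0=f$, $\partial_nu_0=q_{RN}$ on $\Gamma$; $-\nabla^2u_m+\alpha u_m=0$ for $m\ge1$ with $\partial_nu_1=u_{RD}-u_0$ and $\partial_nu_m=-u_{m-1}$ ($m>1$) on $\Gamma$. Asymptotic preserving means that the discrete asymptotics are consistent with the continuous ones at all orders: the variational problem for the $m$-th discrete mode is satisfied for all $v\in\mathcal V$ when the discrete modes are replaced by the exact continuous modes (smooth, and, together with $f$, extended smoothly to $\overline\Omega$ where it leaves $\Omega$, so that their differential equations still hold there). Coercive means: the bilinear form in $(u_m,v)$ on the left-hand side, with $u_{D,m}$ treated as known data, i.e. $a(u,v)=\mathcal I_{\overline\Omega}(u)-(\partial_{\bar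 n}u(\overline{\boldsymbol x}),v)_{\overline\Gamma}+\mathcal A_{\overline\Gamma}(u(\boldsymbol x))$, satisfies $a(w,w)\ge c\|w\|_{H^1(\overline\Omega)}^2$ for all $w\in\mathcal V$ with some $c>0$.
   Formalization: Coercivity in (i) fails for large gamma or a map M far from the identity; it is claimed only for gamma at most some gamma_0 > 0 and |M(x̄) − x̄| at most some delta_0 > 0 on the surrogate boundary, with thresholds depending only on the mesh and P. *)

(* Defs.v *)
From HB Require Import structures.
From mathcomp Require Import all_boot all_order all_algebra.
From mathcomp Require Import all_classical all_reals all_analysis.

Set Implicit Arguments.
Unset Strict Implicit.
Unset Printing Implicit Defensive.

Import Order.TTheory GRing.Theory Num.Theory.
Import numFieldNormedType.Exports.

Local Open Scope classical_set_scope.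
Local Open Scope ring_scope.

(* The plane is [R * R]; its library norm is the max norm, so the Euclidean
   length is introduced separately as [enorm]. *)
Section Plane.
Variable R : realType.
Implicit Types (p q : R * R) (h : R * R -> R) (A W : set (R * R)).

Definition dot p q : R := p.1 * q.1 + p.2 * q.2.

Definition enorm p : R := Num.sqrt (dot p p).

Definition d1 h : R * R -> R := fun p => 'D_(1, 0) h p.
Definition d2 h : R * R -> R := fun p => 'D_(0, 1) h p.

Definition grad h p : R * R := (d1 h p, d2 h p).

Definition laplacian h p : R := d1 (d1 h) p + d2 (d2 h) p.

Fixpoint smooth_upto (k : nat) W h : Prop :=
  match k with
  | 0 => forall p, W p -> {for p, continuous h}
  | k'.+1 => [/\ forall p, W p -> differentiable h p,
                 smooth_upto k' W (d1 h) & smooth_upto k' W (d2 h)]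
  end.

(* C^oo; only used on open sets [W]. *)
Definition smooth_on W h : Prop := forall k, smooth_upto k W h.

Definition frontier A : set (R * R) := closure A `\` interior A.

(* Near each of its points the frontier is the regular zero set of a smooth
   [rho] that is negative exactly inside [Omega], so [grad rho] points
   outwards.  Values of [n] off the frontier are irrelevant. *)
Definition smooth_bounded_domain (Omega : set (R * R)) (n : R * R -> R * R) :
    Prop :=
  [/\ [/\ open Omega, connected Omega & Omega !=set0],
      bounded_set Omega &
      forall p, frontier Omega p ->
        exists U (rho : R * R -> R),
        [/\ open U, U p, smooth_on U rho,
            (forall q, U q -> grad rho q != 0) /\
            (forall q, U q -> (Omega q <-> rho q < 0)) &
            forall q, U q -> frontier Omega q ->
              n q = (enorm (grad rho q))^-1 *: grad rho q]].

(* [s] is a bivariate polynomial, with (s`_i)`_j the coefficient of y^i x^j. *)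
Definition peval (s : {poly {poly R}}) p : R := (s.[p.2%:P]).[p.1].

Definition degree_le (P : nat) (s : {poly {poly R}}) : Prop :=
  forall i j, (s`_i)`_j != 0 -> (i + j <= P)%N.

Definition simplex (a : 'I_3 -> R * R) : set (R * R) :=
  [set p | exists2 l : 'I_3 -> R,
     (forall i, 0 <= l i) /\ \sum_i l i = 1 & p = \sum_i l i *: a i].

(* Edge [i] joins vertices [i] and [i + 1] (modulo 3); the opposite vertex
   is [i + 2]. *)
Definition edge_pt (a : 'I_3 -> R * R) (i : 'I_3) (t : R) : R * R :=
  a i + t *: (a (i + 1) - a i).

Definition edge (a : 'I_3 -> R * R) (i : 'I_3) : set (R * R) :=
  edge_pt a i @` `[0, 1].

Definition rot_edge (a : 'I_3 -> R * R) (i : 'I_3) : R * R :=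
  ((a (i + 1) - a i).2, - (a (i + 1) - a i).1).

(* The unit normal to edge [i] pointing away from the opposite vertex. *)
Definition edge_normal (a : 'I_3 -> R * R) (i : 'I_3) : R * R :=
  (- Num.sg (dot (a (i + 2%:R) - a i) (rot_edge a i))
     / enorm (rot_edge a i)) *: rot_edge a i.

End Plane.

(* A conforming triangulation of a part of the plane; [active] selects the
   triangles whose union is the surrogate domain. *)
Record mesh (R : realType) := Mesh {
  elt : finType;
  vtx : elt -> 'I_3 -> R * R;
  active : {set elt};
  mesh_nondegenerate : forall K,
    dot (vtx K 2%:R - vtx K 0) (rot_edge (vtx K) 0) != 0;
  mesh_conforming : forall K L, K != L ->
    [\/ simplex (vtx K) `&` simplex (vtx L) = set0,
        exists i j, vtx K i = vtx L j /\
          simplex (vtx K) `&` simplex (vtx L) = [set vtx K i] |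
        exists i j, edge (vtx K) i = edge (vtx L) j /\
          simplex (vtx K) `&` simplex (vtx L) = edge (vtx K) i]
}.

Section Discretization.
Variables (R : realType) (T : mesh R).
Implicit Types (K : elt T) (i : 'I_3).

Definition surrogate : set (R * R) :=
  [set p | exists2 K, K \in active T & simplex (vtx K) p].

Definition Gbar : set (R * R) := frontier surrogate.

Definition bedge K i : bool := `[< edge (vtx K) i `<=` Gbar >].

(* A broken function has one globally defined branch per triangle: for
   elements of V this is the polynomial of the triangle, extended to the whole
   plane; a smooth function [h] is the constant family [fun=> h]. *)
Definition broken := elt T -> R * R -> R.

Implicit Types (g h u v w : broken).

Definition inV (P : nat) w : Prop :=
  (forall K, K \in active T ->
     exists2 s : {poly {poly R}}, degree_le P s & w K = peval s) /\
  (exists2 h : R * R -> R, {within surrogate, continuous h} &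
     forall K, K \in active T -> forall p, simplex (vtx K) p -> h p = w K p).

Definition intO g : R :=
  \sum_(K in active T)
    \int[(@lebesgue_measure R \x @lebesgue_measure R)%E]_(p in simplex (vtx K))
      g K p.

(* Boundary integrands depend on the adjacent triangle, on the edge and on the
   integration point; each boundary edge is parametrized affinely. *)
Definition intG (g : elt T -> 'I_3 -> R * R -> R) : R :=
  \sum_(K in active T) \sum_(i < 3 | bedge K i)
    enorm (vtx K (i + 1) - vtx K i) *
    \int[@lebesgue_measure R]_(t in `[0, 1]) g K i (edge_pt (vtx K) i t).

Definition domain_integrable (f : R * R -> R) : Prop :=
  forall K, K \in active T ->
    (@lebesgue_measure R \x @lebesgue_measure R)%E.-integrable
      (simplex (vtx K)) (EFin \o f).

Definition bdry_integrable (k : R * R -> R) : Prop :=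
  forall K i, K \in active T -> bedge K i ->
    (@lebesgue_measure R).-integrable `[0, 1]
      (EFin \o (fun t => k (edge_pt (vtx K) i t))).

Definition ipO g h : R := intO (fun K p => g K p * h K p).

Definition ip_grad g h : R := intO (fun K p => dot (grad (g K) p) (grad (h K) p)).

Definition opI (alpha : R) u v : R := ip_grad u v + alpha * ipO u v.

Definition flux u v : R :=
  intG (fun K i p => dot (grad (u K) p) (edge_normal (vtx K) i) * v K p).

(* [w K p] is the value of the argument at the integration point [p], seen
   from [K]; only the test function is shifted here. *)
Definition opA (gamma : R) (M : R * R -> R * R) (w v : broken) : R :=
  intG (fun K _ p => w K p * (v K (M p) / gamma)).

Definition eval_at (M : R * R -> R * R) u : broken := fun K p => u K (M p).

Definition normal_deriv (n : R * R -> R * R) (h : R * R -> R) (x : R * R) : R :=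
  dot (grad h x) (n x).

Definition H1normsq w : R := ipO w w + ip_grad w w.

Definition coercive_form (P : nat) (alpha gamma : R) (M : R * R -> R * R) :
    Prop :=
  exists2 c : R, 0 < c & forall w, inV P w ->
    c * H1normsq w <= opI alpha w w - flux w w + opA gamma M (eval_at M w) w.

End Discretization.

Section Modes.
Variables (R : realType) (T : mesh R) (P : nat).
Variables (Omega : set (R * R)) (n M : R * R -> R * R) (alpha gamma : R).
Variables (f uRD qRN : R * R -> R).

(* The formal series with constant term [h] and no other term. *)
Definition const_series (h : R * R -> R) (m : nat) : R * R -> R :=
  if m is 0 then h else fun=> 0.

Definition fps_mul (a b : nat -> R) (m : nat) : R :=
  \sum_(k < m.+1) a k * b (m - k)%N.

(* [c] is the power series expansion of the rational function num / den;
   it is unique as soon as den`_0 != 0. *)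
Definition fps_quotient (num den : {poly R}) (c : nat -> R) : Prop :=
  forall m, fps_mul (fun k => den`_k) c m = num`_m.

(* The m-th coefficient of the left-hand side of the method,
     I(u) - (d_nbar u, v) - (f, v) + c1 A(u(x) - uRD) + c2 A(d_n u(x) - qRN),
   when [u] is a formal power series with coefficients [u m] and c1, c2 are
   formal power series in the same indeterminate. *)
Definition method_coef (c1 c2 : nat -> R) (u : nat -> broken T) (v : broken T)
    (m : nat) : R :=
  opI alpha (u m) v - flux (u m) v - ipO (fun=> const_series f m) v
  + fps_mul c1 (fun k => opA gamma M (eval_at M
      (fun K x => u k K x - const_series uRD k x)) v) m
  + fps_mul c2 (fun k => opA gamma M (eval_at M
      (fun K x => normal_deriv n (u k K) x - const_series qRN k x)) v) m.

Definition formal_modes (num1 num2 den : {poly R}) (u : nat -> broken T) :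
    Prop :=
  (forall m, inV P (u m)) /\
  (exists c1 c2, [/\ fps_quotient num1 den c1, fps_quotient num2 den c2 &
     forall v, inV P v -> forall m, method_coef c1 c2 u v m = 0]).

(* 'X is eps; weights gamma / (gamma + eps) and gamma eps / (gamma + eps). *)
Definition dirichlet_modes : (nat -> broken T) -> Prop :=
  formal_modes gamma%:P (gamma *: 'X) (gamma%:P + 'X).

(* 'X is eta = eps^-1; the same weights are gamma eta / (1 + gamma eta) and
   gamma / (1 + gamma eta). *)
Definition neumann_modes : (nat -> broken T) -> Prop :=
  formal_modes (gamma *: 'X) gamma%:P (1 + gamma *: 'X).

(* Boundary data of the m-th mode, at points of the true boundary, for modes
   given there by the branches [u]. *)
Definition uD (u : nat -> R * R -> R) (m : nat) (x : R * R) : R :=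
  match m with
  | 0 => uRD x
  | 1 => qRN x - normal_deriv n (u 0) x
  | m'.+1 => - normal_deriv n (u m') x
  end.

Definition qN (u : nat -> R * R -> R) (m : nat) (x : R * R) : R :=
  match m with
  | 0 => qRN x
  | 1 => uRD x - u 0 x
  | m'.+1 => - u m' x
  end.

Definition dirichlet_defect (u : nat -> broken T) (m : nat) : broken T :=
  eval_at M (fun K x => u m K x - uD (u^~ K) m x).

Definition neumann_defect (u : nat -> broken T) (m : nat) : broken T :=
  eval_at M (fun K x => normal_deriv n (u m K) x - qN (u^~ K) m x).

Definition dirichlet_mode_problem (u : nat -> broken T) (m : nat)
    (v : broken T) : Prop :=
  opI alpha (u m) v - flux (u m) v - ipO (fun=> const_series f m) v
  + opA gamma M (dirichlet_defect u m) v
  = - \sum_(l < m) (- gamma) ^- (m - l) *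
      opA gamma M (dirichlet_defect u l) v.

Definition neumann_mode_problem (u : nat -> broken T) (m : nat)
    (v : broken T) : Prop :=
  opI alpha (u m) v - flux (u m) v - ipO (fun=> const_series f m) v
  + opA gamma M (fun K p => gamma * neumann_defect u m K p) v
  = \sum_(l < m) (- gamma) ^+ (m.+1 - l) *
      opA gamma M (neumann_defect u l) v.

(* Smoothness and differential equations of the continuous modes, extended to
   the part of the surrogate domain lying outside [Omega]. *)
Definition smooth_pde_modes (u : nat -> R * R -> R) : Prop :=
  (exists W, [/\ open W, closure Omega `|` surrogate T `<=` W &
     forall m, smooth_on W (u m)]) /\
  (forall m p, (Omega `|` surrogate T) p ->
     - laplacian (u m) p + alpha * u m p = const_series f m p).

Definition dirichlet_continuous_modes (u : nat -> R * R -> R) : Prop :=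
  smooth_pde_modes u /\
  (forall m x, frontier Omega x -> u m x = uD u m x).

Definition neumann_continuous_modes (u : nat -> R * R -> R) : Prop :=
  smooth_pde_modes u /\
  (forall m x, frontier Omega x -> normal_deriv n (u m) x = qN u m x).

Definition asymptotic_preserving_dirichlet : Prop :=
  forall u : nat -> R * R -> R, dirichlet_continuous_modes u ->
  forall m v, inV P v -> dirichlet_mode_problem (fun k _ => u k) m v.

Definition asymptotic_preserving_neumann : Prop :=
  forall u : nat -> R * R -> R, neumann_continuous_modes u ->
  forall m v, inV P v -> neumann_mode_problem (fun k _ => u k) m v.

End Modes.

(* Main.v *)
(* Testing the exact mode problems against v in V reduces, since their boundary
   defects vanish at the points M(p), to Green's formula on the surrogate
   domain.  On one triangle it follows from Fubini and the fundamental theorem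
   of calculus on horizontal and vertical slices; summing over triangles, the
   contributions of interior edges cancel because the mesh is conforming.

   For the discrete modes, both weights are geometric series in eps / gamma
   (resp. gamma / eps), and the second one is the first one shifted by one
   degree.  Hence the coefficient of order m is a combination of the defects of
   orders at most m, which is the stated problem.

   For coercivity, let G, F, B be the quadratic forms |grad w|^2, flux and
   |w|^2 on the surrogate boundary.  Since F vanishes with B, and G = B = 0
   forces w = 0, compactness of the unit sphere of coefficients gives k with
   G - F + k B positive definite; gamma0 = 1 / k, and delta0 is chosen so that
   replacing w by its shifted values in B is a small perturbation. *)
Require Import Defs.
From HB Require Import structures.
From mathcomp Require Import all_boot all_order all_algebra.
From mathcomp Require Import all_classical all_reals all_analysis.
From mathcomp Require Import measurable_realfun ring lra.
Set Implicit Arguments.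
Unset Strict Implicit.
Unset Printing Implicit Defensive.
Import Order.TTheory GRing.Theory Num.Theory.
Import numFieldNormedType.Exports.
Local Open Scope classical_set_scope.
Local Open Scope ring_scope.

(** * Borel measurability and integrability in the plane *)

(** The flux term has no sign and has to be dominated by the penalty, which is why coercivity is
    claimed for small [gamma] only. Trace and inverse inequalities are replaced by compactness in a
    finite-dimensional space of coefficients. The constants are therefore not explicit, but they
    depend only on the mesh and [P] and are available before [Omega], [M] and [alpha] are given.
    Definiteness comes from Green's formula with x^2/2 instead of a Poincare inequality, which
    treats all pieces of the surrogate domain at once, without following chains of triangles.
    Boundary edges are defined topologically, as edges contained in the frontier of the surrogate
    domain. Cancellation thus rests on a geometric fact: any other edge of an active triangle has
    exactly one active neighbour on its far side. The integral is additive only on integrable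
    functions, [M] is merely measurable and the data are merely integrable on the boundary. Hence
    the separate study of functions composed with [M]. *)

Section PlaneMeasure.
Variable R : realType.
Implicit Types (A D K U : set (R * R)) (f g : R * R -> R).

Notation mu := (@lebesgue_measure R).

(** Measurable sets of the plane are those of the product sigma-algebra. An open set is the union of
    the open rectangles with rational corners that it contains, and these are countably many. *)
Lemma open_measurable_plane U : open U -> measurable U.
Proof.
move=> oU.
pose B (s : rat * rat * (rat * rat)) : set (R * R) :=
  `]ratr s.1.1, ratr s.1.2[%classic `*` `]ratr s.2.1, ratr s.2.2[%classic.
pose F s := if `[< B s `<=` U >] then B s else set0.
have -> : U = \bigcup_s F s.
  apply/seteqP; split => [p Up|p [s _]]; last first.
    by rewrite /F; case: ifPn => // /asboolP sU /sU.
  have /nbhs_ballP[e /= e0 eU] : nbhs p U by exact: open_nbhs_nbhs.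
  have pick (x : R) : exists2 r : rat * rat, ratr r.1 < x < ratr r.2 &
      forall y, ratr r.1 < y < ratr r.2 -> ball x e y.
    have [r1] := @rat_in_itvoo _ (x - e) x (ltac:(lra)).
    have [r2] := @rat_in_itvoo _ x (x + e) (ltac:(lra)).
    rewrite !in_itv /= => /andP[h1 h2] /andP[h3 h4].
    exists (r1, r2) => /=; first by rewrite h4 h1.
    by move=> y /andP[h5 h6]; rewrite /ball /= ltr_norml; lra.
  have [r r1 r2] := pick p.1; have [s s1 s2] := pick p.2.
  exists (r, s) => //; rewrite /F asboolT.
    by split; rewrite /= in_itv.
  move=> q [] /=; rewrite !in_itv /= => q1 q2; apply: eU.
  by split; [exact: r2|exact: s2].
apply: countable_bigcupT_measurable => // s; rewrite /F; case: ifPn => // _.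
exact: measurableX.
Qed.

Lemma closed_measurable_plane A : closed A -> measurable A.
Proof.
move=> cA; rewrite -(setCK A); apply: measurableC.
by apply: open_measurable_plane; exact: closed_openC.
Qed.

(** The continuous function [g] may depend on the point: this suits the unit normal, known only
    through local formulas on the frontier. The preimage of an open interval is the trace on [D] of
    a union of open sets, so no countable cover has to be extracted. *)
Lemma locally_continuous_measurable D f : measurable D ->
  (forall p, D p -> exists2 g, {for p, continuous g} &
     \forall q \near p, D q -> f q = g q) ->
  measurable_fun D f.
Proof.
move=> mD cf; apply: (measurability _ (RGenOpens.measurableE R)).
move=> _ [_ [a [b ->] <-]].
pose V := \bigcup_(W in [set W : set (R * R) | open W /\
  D `&` W `<=` f @^-1` `]a, b[%classic]) W.
have -> : D `&` f @^-1` `]a, b[%classic = D `&` V.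
  apply/seteqP; split => [p [Dp fp]|p [Dp [W [oW Wf] Wp]]]; last first.
    by split=> //; apply: Wf.
  split=> //; have [g cg fg] := cf _ Dp.
  have gp : g p \in `]a, b[ by rewrite -(nbhs_singleton fg Dp).
  have : nbhs p [set q | (D q -> f q = g q) /\ g q \in `]a, b[].
    apply: filterI => //; apply: (cg [set y | y \in `]a, b[]).
    by apply: open_nbhs_nbhs; split=> //; exact: interval_open.
  rewrite nbhsE => -[W [oW Wp] WS]; exists W => //; split => // q [Dq Wq].
  by have [fgq gq] := WS q Wq; rewrite /= fgq.
apply: measurableI => //; apply: open_measurable_plane.
by apply: bigcup_open => W [].
Qed.

Lemma continuous_measurable_plane D f : measurable D ->
  (forall p, D p -> {for p, continuous f}) -> measurable_fun D f.
Proof.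
move=> mD cf; apply: locally_continuous_measurable => // p Dp.
exists f; first exact: (cf p Dp).
apply: (@filterE _ (nbhs p)) => q _; reflexivity.
Qed.

Lemma compact_plane_box K : closed K ->
  (exists m : R, forall p, K p -> `|p.1| <= m /\ `|p.2| <= m) -> compact K.
Proof.
move=> cK [m Km]; apply: (@subclosed_compact _ _ (`[- m, m]%classic `*` `[- m, m]%classic)) => //.
  by apply: compact_setX; exact: segment_compact.
by move=> p /Km[p1 p2]; split; rewrite /= in_itv /= -ler_norml.
Qed.

Lemma compact_plane_finite K : compact K ->
  exists2 m : R, 0 < m & forall p, K p -> `|p.1| <= m /\ `|p.2| <= m.
Proof.
move=> cK; have [m [_ Km]] := compact_bounded cK.
exists (`|m| + 1); first by rewrite ltr_wpDl.
move=> p /(Km (`|m| + 1) (ltr_pwDr ltr01 (ler_norm _))) /=.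
by rewrite prod_normE ge_max => /andP[].
Qed.

Lemma continuous_integrable_plane K f : compact K ->
  (forall p, K p -> {for p, continuous f}) ->
  (mu \x mu)%E.-integrable K (EFin \o f).
Proof.
move=> cK cf; have mK : measurable K.
  by apply: closed_measurable_plane; exact: compact_closed.
apply: measurable_bounded_integrable => //.
- have [m m0 Km] := compact_plane_finite cK.
  apply: (@le_lt_trans _ _ ((mu \x mu)%E (`[- m, m]%classic `*` `[- m, m]%classic))).
    apply: le_measure; rewrite ?inE //; first exact: measurableX.
    by move=> p /Km[p1 p2]; split; rewrite /= in_itv /= -ler_norml.
  rewrite product_measure1E//= !lebesgue_measure_itv /=.
  by case: ifP => _; rewrite ?mule0 // ?ltry // -EFinD -EFinM ltry.
- exact: continuous_measurable_plane.
- have : compact (f @` K).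
    apply: continuous_compact => //; apply: continuous_in_subspaceT => p.
    by rewrite inE => /cf.
  by move/compact_bounded => [m [mr Km]]; exists m; split => // x xm y Ky; apply: Km => //; exists y.
Qed.

End PlaneMeasure.

(** * Triangles and barycentric coordinates *)

Lemma ord3D11 (i : 'I_3) : i + 1 + 1 = i + 2%:R.
Proof. by rewrite -addrA. Qed.

Lemma ord3D12 (i : 'I_3) : i + 1 + 2%:R = i.
Proof. by rewrite -addrA (_ : 1 + 2%:R = 0) ?addr0//; exact/val_inj. Qed.

Lemma ord3D21 (i : 'I_3) : i + 2%:R + 1 = i.
Proof. by rewrite -addrA (_ : 2%:R + 1 = 0) ?addr0//; exact/val_inj. Qed.

Lemma ord3D22 (i : 'I_3) : i + 2%:R + 2%:R = i + 1.
Proof. by rewrite -addrA (_ : 2%:R + 2%:R = 1)//; exact/val_inj. Qed.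

(** Rewriting with these laws reduces every cyclic shift of [i] to [i], [i + 1] or [i + 2], after
    which [ring] sees three independent vertices. *)
Definition ord3D := (ord3D11, ord3D12, ord3D21, ord3D22).

Lemma ord3_cases (i j : 'I_3) : [\/ j = i, j = i + 1 | j = i + 2%:R].
Proof.
by case: i => -[|[|[|i]]] i3 //; case: j => -[|[|[|j]]] j3 //;
  do ?[by apply: Or31; exact/val_inj | by apply: Or32; exact/val_inj
      | by apply: Or33; exact/val_inj].
Qed.

Lemma ord3_ind (i : 'I_3) (Q : 'I_3 -> Prop) :
  Q i -> Q (i + 1) -> Q (i + 2%:R) -> forall j, Q j.
Proof. by move=> Q0 Q1 Q2 j; case: (ord3_cases i j) => ->. Qed.

Lemma sum_ord3 (V : nmodType) (i : 'I_3) (F : 'I_3 -> V) :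
  \sum_(j < 3) F j = F i + F (i + 1) + F (i + 2%:R).
Proof.
have E : \sum_(j < 3) F j = F 0 + F 1 + F 2%:R.
  by rewrite !big_ord_recl big_ord0 addr0 addrA; congr (F _ + F _ + F _);
    exact/val_inj.
rewrite E; case: i => -[|[|[|i]]] i3 //.
- by congr (F _ + F _ + F _); exact/val_inj.
- rewrite [RHS]addrC addrA; congr (F _ + F _ + F _); exact/val_inj.
- rewrite -[RHS]addrA [RHS]addrC; congr (F _ + F _ + F _); exact/val_inj.
Qed.

Section Triangle.
Variable R : realType.
Implicit Types (a b : 'I_3 -> R * R) (p q : R * R) (i j : 'I_3).

(* Twice the signed area. *)
Definition tri_det a : R := dot (a 2%:R - a 0) (rot_edge a 0).

(** A cyclic relabelling of the vertices preserves orientation, so a single determinant serves all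
    three edges. *)
Lemma tri_detE a i : tri_det a = dot (a (i + 2%:R) - a i) (rot_edge a i).
Proof.
have E j : dot (a (j + 1 + 2%:R) - a (j + 1)) (rot_edge a (j + 1)) =
           dot (a (j + 2%:R) - a j) (rot_edge a j).
  rewrite /dot /rot_edge /= !ord3D; ring.
rewrite /tri_det -[in LHS](add0r 2%:R).
have {E} E j : dot (a (j + 2%:R) - a j) (rot_edge a j) =
    dot (a (0 + 2%:R) - a 0) (rot_edge a 0).
  by case: (ord3_cases 0 j) => ->; rewrite -?(ord3D11 0) ?E ?E ?add0r.
by rewrite E.
Qed.

(** Signed distance to the edge opposite to vertex [i], which is edge [i + 1], scaled to be 1 at
    vertex [i]. Dividing by the signed determinant removes the dependence on orientation. *)
Definition bary a i p : R := dot (p - a (i + 1)) (rot_edge a (i + 1)) / tri_det a.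

Lemma sum_bary a p : tri_det a != 0 -> \sum_i bary a i p = 1.
Proof.
move=> a0; rewrite (sum_ord3 0); move: (0 : 'I_3) => i.
rewrite /bary -!mulrDl; apply: (mulIf a0); rewrite mulfVK// mul1r.
rewrite (tri_detE a i) /dot /rot_edge /= !ord3D; ring.
Qed.

Lemma sum_baryZ a p : tri_det a != 0 -> \sum_i bary a i p *: a i = p.
Proof.
move=> a0; rewrite (sum_ord3 0); move: (0 : 'I_3) => i.
apply: (scalerI a0); rewrite !scalerDr !scalerA /bary ![tri_det a * _]mulrC.
rewrite !mulfVK// (tri_detE a i) /dot /rot_edge /= !ord3D.
case: p (a i) (a (i + 1)) (a (i + 2%:R)) => [p1 p2] [x1 x2] [y1 y2] [z1 z2].
by congr pair; rewrite /= /GRing.scale /=; ring.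
Qed.

Lemma bary_comb a i (l : 'I_3 -> R) : tri_det a != 0 -> \sum_j l j = 1 ->
  bary a i (\sum_j l j *: a j) = l i.
Proof.
move=> a0; rewrite !(sum_ord3 i) => l1; rewrite /bary; apply: (mulIf a0).
rewrite mulfVK// (tri_detE a i) /dot /rot_edge /= !ord3D.
have -> : l (i + 2%:R) = 1 - l i - l (i + 1) by rewrite -l1; ring.
case: (a i) (a (i + 1)) (a (i + 2%:R)) => [x1 x2] [y1 y2] [z1 z2] /=.
by rewrite /GRing.scale /=; ring.
Qed.

Lemma simplexP a p : tri_det a != 0 ->
  simplex a p <-> forall i, 0 <= bary a i p.
Proof.
move=> a0; split => [[l [l0 l1] ->] i|b0]; first by rewrite bary_comb.
by exists (fun i => bary a i p); [rewrite sum_bary|rewrite sum_baryZ].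
Qed.

(** The barycentric coordinates of [edge_pt a i t]. *)
Definition edge_coef i (t : R) : 'I_3 -> R :=
  fun j => if j == i then 1 - t else if j == i + 1 then t else 0.

Lemma ord3_neq i : [/\ (i + 1 == i) = false, (i + 2%:R == i) = false
  & (i + 2%:R == i + 1) = false].
Proof. by case: i => -[|[|[|i]]] i3. Qed.

Lemma edge_coefE i t : [/\ edge_coef i t i = 1 - t, edge_coef i t (i + 1) = t
  & edge_coef i t (i + 2%:R) = 0].
Proof. by have [e1 e2 e3] := ord3_neq i; rewrite /edge_coef eqxx e1 e2 e3 eqxx. Qed.

Lemma sum_edge_coef i t : \sum_j edge_coef i t j = 1.
Proof. by have [e1 e2 e3] := edge_coefE i t; rewrite (sum_ord3 i) e1 e2 e3; ring. Qed.

Lemma edge_pt_comb a i t : edge_pt a i t = \sum_j edge_coef i t j *: a j.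
Proof.
have [e1 e2 e3] := edge_coefE i t; rewrite (sum_ord3 i) e1 e2 e3 /edge_pt.
by rewrite scale0r addr0 scalerBl scale1r scalerBr addrA addrAC.
Qed.

Lemma bary_edge a i t j : tri_det a != 0 ->
  bary a j (edge_pt a i t) = edge_coef i t j.
Proof. by move=> a0; rewrite edge_pt_comb bary_comb// sum_edge_coef. Qed.

Lemma edge_simplex a i : edge a i `<=` simplex a.
Proof.
move=> _ [t /= t01 <-]; rewrite edge_pt_comb; exists (edge_coef i t) => //.
have [e1 e2 e3] := edge_coefE i t; split; last exact: sum_edge_coef.
move: t01; rewrite in_itv /= => /andP[t0 t1].
by apply: (@ord3_ind i); rewrite ?e1 ?e2 ?e3// subr_ge0.
Qed.

Lemma edgeP a i p : tri_det a != 0 ->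
  edge a i p <-> simplex a p /\ bary a (i + 2%:R) p = 0.
Proof.
move=> a0; split.
  move=> e; split; first exact: (edge_simplex e).
  by move: e => [t _ <-]; rewrite bary_edge//; have [] := edge_coefE i t.
move=> [] /(simplexP _ a0) b0 b2; exists (bary a (i + 1) p).
  rewrite /= in_itv /= b0 /= -(sum_bary p a0) (sum_ord3 i) b2 addr0.
  by rewrite lerDr b0.
rewrite -[RHS](sum_baryZ p a0) edge_pt_comb; apply: eq_bigr => j _.
congr (_ *: _); move: j; have [e1 e2 e3] := edge_coefE i (bary a (i + 1) p).
apply: (@ord3_ind i); rewrite ?e1 ?e2 ?e3//.
by rewrite -(sum_bary p a0) (sum_ord3 i) b2; ring.
Qed.

End Triangle.

(** * Divergence theorem on a triangle *)

Section Segments.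
Variable R : realType.
Notation mu := (@lebesgue_measure R).
Implicit Types (G : R -> R) (F : R * R -> R).

Lemma continuous_within (T : topologicalType) (A : set T) (f : T -> R) :
  (forall x, A x -> {for x, continuous f}) -> {within A, continuous f}.
Proof. by move=> cf; apply: continuous_in_subspaceT => x; rewrite inE => /cf. Qed.

(** The unoriented form, with [Num.min], [Num.max] and an absolute value, applies to edges travelled
    upwards or downwards alike. Increasing and decreasing substitutions and the degenerate segment
    are separate cases. *)
Lemma Rintegral_segment_param G (u v : R) :
  (forall y, Num.min u v <= y <= Num.max u v -> {for y, continuous G}) ->
  \int[mu]_(y in `[Num.min u v, Num.max u v]) G y =
  `|v - u| * \int[mu]_(t in `[0, 1]) G (u + t * (v - u)).
Proof.
move=> cG; pose phi t : R := u + t * (v - u).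
have dphi t : is_derive t (1 : R) phi (v - u).
  rewrite /phi; apply: is_derive_eq; rewrite /GRing.scale /=; ring.
have phi' : phi^`()%classic = cst (v - u).
  by apply/funext => t; rewrite derive1E derive_val.
have cphi : continuous phi.
  by move=> t; apply: differentiable_continuous; apply/derivable1_diffP.
have LR : derivable_oo_LRcontinuous phi 0 1.
  split=> [t _|//|//]; first exact: ex_derive.
  - by apply: cvg_at_right_filter; exact: cphi.
  - by apply: cvg_at_left_filter; exact: cphi.
have p0 : phi 0 = u by rewrite /phi; ring.
have p1 : phi 1 = v by rewrite /phi; ring.
have cGphi : {within `[(0 : R), 1], continuous (G \o phi)}.
  apply: continuous_within => t; rewrite /= in_itv /= => /andP[t0 t1].
  apply: continuous_comp; first exact: cphi.
  by apply: cG; rewrite /phi; case: (leP u v) => uv; nra.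
have iG : mu.-integrable `[0, 1] (EFin \o (G \o phi)).
  by apply: continuous_compact_integrable => //; exact: segment_compact.
have [uv|uv] := leP u v; last first.
- rewrite ltr0_norm ?subr_lt0// -RintegralZl//.
  rewrite /Rintegral -{1}p0 -{1}p1 (integration_by_substitution_decreasing ler01)//.
  + rewrite phi'; congr fine; apply: eq_integral => t _ /=.
    by rewrite mulrC.
  + by move=> s t _ _ st; rewrite /phi; nra.
  + by rewrite phi' => t _; exact: cst_continuous.
  + by rewrite phi'; exact: is_cvg_cst.
  + by rewrite phi'; exact: is_cvg_cst.
  + apply: continuous_within => y; rewrite /= in_itv /= p0 p1 => y01.
    by apply: cG; rewrite (min_idPr (ltW uv)) (max_idPl (ltW uv)).
move: uv; rewrite le_eqVlt => /predU1P[<-|uv].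
  by rewrite subrr normr0 mul0r set_itv1 Rintegral_set1.
rewrite gtr0_norm ?subr_gt0// -RintegralZl//.
rewrite /Rintegral -{1}p0 -{1}p1 (integration_by_substitution_increasing ler01)//.
+ rewrite phi'; congr fine; apply: eq_integral => t _ /=.
  by rewrite mulrC.
+ by move=> s t _ _ st; rewrite /phi; nra.
+ by rewrite phi' => t _; exact: cst_continuous.
+ by rewrite phi'; exact: is_cvg_cst.
+ by rewrite phi'; exact: is_cvg_cst.
+ apply: continuous_within => y; rewrite /= in_itv /= p0 p1 => y01.
  by apply: cG; rewrite (min_idPl (ltW uv)) (max_idPr (ltW uv)).
Qed.

Lemma continuous_pair (T : topologicalType) (f g : T -> R) (t : T) :
  {for t, continuous f} -> {for t, continuous g} ->
  {for t, continuous (fun s => (f s, g s))}.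
Proof.
move=> cf cg A [[B C] /= [fB gC] BCA].
have fg : nbhs t [set s | B (f s) /\ C (g s)].
  by apply: filterI; [exact: (cf _ fB)|exact: (cg _ gC)].
by rewrite /fmap /=; apply: (filterS _ fg) => s [Bs Cs]; exact: BCA.
Qed.

Lemma continuous_slice F (x y : R) :
  {for (x, y), continuous F} -> {for x, continuous (fun z => F (z, y))}.
Proof.
move=> cF; apply: (@continuous_comp _ _ _ (fun z => (z, y)) F) => //.
by apply: continuous_pair; [exact: cvg_id|exact: cvg_cst].
Qed.

Lemma derivable_slice F (x y : R) : derivable F (x, y) (1, 0) ->
  is_derive x 1 (fun z => F (z, y)) (d1 F (x, y)).
Proof.
have E : (fun h : R => h^-1 *: ((F \o shift (x, y)) (h *: (1, 0)) - F (x, y))) =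
    (fun h : R => h^-1 *: (((fun z => F (z, y)) \o shift x) (h *: 1) - F (x, y))).
  apply/funext => h /=; congr (_ *: (F _ - _)).
  by apply: injective_projections => //=; rewrite [_ *: _]mulr0 add0r.
move=> dF; apply: DeriveDef; first by rewrite /derivable -E.
by rewrite /d1 /derive -E.
Qed.

Lemma FTC_slice F (y L M : R) : L < M ->
  (forall x, L <= x <= M -> {for (x, y), continuous F}) ->
  (forall x, L <= x <= M -> derivable F (x, y) (1, 0)) ->
  (forall x, L <= x <= M -> {for (x, y), continuous (d1 F)}) ->
  (\int[mu]_(x in `[L, M]) (d1 F (x, y))%:E = (F (M, y) - F (L, y))%:E)%E.
Proof.
move=> LM cF dF cdF; rewrite (@continuous_FTC2 _ _ (fun x => F (x, y)))//.
- apply: continuous_within => x; rewrite /= in_itv /= => /cdF.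
  exact: continuous_slice.
- split=> [x|//|//].
  + rewrite in_itv /= => /andP[/ltW Lx /ltW xM].
    by have [] := @derivable_slice F x y (dF _ _); rewrite ?Lx ?xM.
  + apply: cvg_at_right_filter; apply: (@continuous_slice F L y).
    by apply: cF; rewrite lexx ltW.
  + apply: cvg_at_left_filter; apply: (@continuous_slice F M y).
    by apply: cF; rewrite lexx ltW.
- move=> x; rewrite in_itv /= => /andP[/ltW Lx /ltW xM].
  rewrite derive1E; have [] := @derivable_slice F x y (dF _ _) => //.
  by rewrite Lx xM.
Qed.

End Segments.

(** * Horizontal slices of a triangle *)

Section Slices.
Variable R : realType.
Notation mu := (@lebesgue_measure R).
Implicit Types (a : 'I_3 -> R * R) (F : R * R -> R).

(* Abscissa at height [y] of the line through edge [i]; a junk value when the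
   edge is horizontal. *)
Definition edge_abs a (i : 'I_3) (y : R) : R :=
  (a i).1 + (y - (a i).2) / ((a (i + 1)).2 - (a i).2) * ((a (i + 1)).1 - (a i).1).

(** If vertex [k] is alone on its side of the line, the line crosses the two edges meeting at [k],
    those of index [k] and [k + 2]. Along the line the coordinates of the two other vertices are
    affine with roots at the crossings [L] and [M]. The sign of [L - M] tells which crossing is on
    the left. *)
Lemma slice_simplex a (k : 'I_3) (y : R) : tri_det a != 0 ->
  ((a k).2 - y) * ((a (k + 1)).2 - y) < 0 ->
  ((a k).2 - y) * ((a (k + 2%:R)).2 - y) < 0 ->
  let L := edge_abs a k y in let M := edge_abs a (k + 2%:R) y in
  [/\ Num.sg (L - M) = - Num.sg (tri_det a) * Num.sg ((a (k + 1)).2 - (a k).2),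
      Num.sg ((a k).2 - (a (k + 2%:R)).2) = - Num.sg ((a (k + 1)).2 - (a k).2) &
      forall x, simplex a (x, y) <-> Num.min L M <= x <= Num.max L M].
Proof.
move=> D0 hb hc L M.
set h := y - (a k).2; set B := (a (k + 1)).2 - (a k).2.
set C := (a (k + 2%:R)).2 - (a k).2; set D := tri_det a in D0 *.
have {hb hc} hBC : [/\ h < 0, B < h & C < h] \/ [/\ 0 < h, h < B & h < C].
  have [h0|h0] := leP ((a k).2) y; [right|left]; rewrite /h /B /C.
  - have b0 : 0 < (a (k + 1)).2 - y by rewrite ltNge; apply/negP => ?; nra.
    have c0 : 0 < (a (k + 2%:R)).2 - y by rewrite ltNge; apply/negP => ?; nra.
    by split; [nra|lra|lra].
  - have b0 : (a (k + 1)).2 - y < 0 by nra.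
    have c0 : (a (k + 2%:R)).2 - y < 0 by nra.
    by split; lra.
have B0 : B != 0 by apply/eqP => B0; case: hBC => -[]; rewrite B0; lra.
have C0 : C != 0 by apply/eqP => C0; case: hBC => -[]; rewrite C0; lra.
have C0' : (a k).2 - (a (k + 2%:R)).2 != 0 by rewrite -opprB oppr_eq0.
have l2E x : bary a (k + 2%:R) (x, y) = (x - L) * (B / D).
  rewrite /bary /dot /rot_edge /= !ord3D /L /edge_abs -/B -/D /=.
  by rewrite mulrA; congr (_ / _); rewrite -/B; field.
have l1E x : bary a (k + 1) (x, y) = (x - M) * (- C / D).
  rewrite /bary /dot /rot_edge /= !ord3D /M /edge_abs /C -/D /= !ord3D.
  by rewrite mulrA opprB; congr (_ / _); field.
have LM : L - M = - (h / (B * C)) * D.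
  rewrite /D (tri_detE a k) /L /M /edge_abs /dot /rot_edge /= !ord3D.
  rewrite -[(a k).2 - _]opprB -/B -/C -[y - (a (k + 2%:R)).2](_ : h - C = _); last by rewrite /h /C; ring.
  rewrite -/h; field.
  by rewrite B0 C0.
(* Relative to vertex [k], the ordinate is the barycentric mean of [B] and [C]. Since [h] lies
   strictly between 0 and both of them, nonnegative weights add up to at most 1, so the coordinate
   of [k] is nonnegative as well. *)
have sumE x : bary a (k + 1) (x, y) * B + bary a (k + 2%:R) (x, y) * C = h.
  rewrite l1E l2E; transitivity ((M - L) * (B * C / D)).
    by field.
  by rewrite -opprB LM; field; rewrite B0 C0 D0.
have bk x : bary a k (x, y) = 1 - bary a (k + 1) (x, y) - bary a (k + 2%:R) (x, y).
  by rewrite -(sum_bary (x, y) D0) (sum_ord3 k); ring.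
have simE x : simplex a (x, y) <-> 0 <= (x - M) * (- C / D) /\ 0 <= (x - L) * (B / D).
  rewrite -l1E -l2E simplexP//; split=> [b0|[b1 b2]]; first by split.
  apply: (@ord3_ind k) => //; rewrite bk; have := sumE x.
  move: b1 b2; set l1 := bary _ _ _; set l2 := bary _ _ _ => b1 b2.
  by case: hBC => -[h1 h2 h3] E; nra.
have hC : 0 < h / C.
  case: hBC => -[h1 h2 h3]; last by rewrite divr_gt0//; lra.
  by rewrite nmulr_rgt0// invr_lt0; lra.
have CB : 0 < C / B.
  case: hBC => -[h1 h2 h3]; last by rewrite divr_gt0//; lra.
  by rewrite nmulr_rgt0 ?invr_lt0; lra.
have sC : Num.sg C = Num.sg B.
  by rewrite -[C in LHS](divfK B0) sgrM (gtr0_sg CB) mul1r.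
have LM' : L - M = - (h / C) * (D / B) by rewrite LM; field; rewrite B0 C0.
split.
- by rewrite LM' sgrM sgrN (gtr0_sg hC) sgrM sgrV !mulN1r mulNr.
- by rewrite -opprB sgrN -/C sC.
move=> x; rewrite simE.
have -> : - C / D = - (C / B) * (B / D) by field; rewrite B0 D0.
have : B / D != 0 by rewrite mulf_neq0// invr_neq0.
rewrite neq_lt => /orP[t0|t0].
- have LM1 : 0 < L - M.
    by rewrite LM' mulNr -mulrN mulr_gt0// -(invf_div B) oppr_gt0 invr_lt0.
  have LM2 : M <= L by lra.
  rewrite (min_idPr LM2) (max_idPl LM2).
  have u0 : 0 < - (C / B) * (B / D) by nra.
  rewrite (nmulr_lge0 _ t0) (pmulr_lge0 _ u0).
  by rewrite subr_ge0 subr_le0; split=> [[-> ->]|/andP[-> ->]].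
- have LM1 : L - M < 0.
    by rewrite LM' mulNr oppr_lt0 mulr_gt0// -(invf_div B) invr_gt0.
  have LM2 : L <= M by lra.
  rewrite (min_idPl LM2) (max_idPr LM2).
  have u0 : - (C / B) * (B / D) < 0 by nra.
  rewrite (pmulr_lge0 _ t0) (nmulr_lge0 _ u0).
  by rewrite subr_ge0 subr_le0; split=> [[-> ->]|/andP[-> ->]].
Qed.

End Slices.

Section EdgeSlices.
Variable R : realType.
Notation mu := (@lebesgue_measure R).
Implicit Types (a : 'I_3 -> R * R) (F : R * R -> R).

(* Contribution of edge [i] to the difference [F(right end) - F(left end)] of
   the horizontal slice at height [y], extended by zero off the edge. *)
Definition edge_slice a F (i : 'I_3) : R -> R :=
  (fun y => - Num.sg (tri_det a) * Num.sg ((a (i + 1)).2 - (a i).2) *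
            F (edge_abs a i y, y))
  \_ `[Num.min (a i).2 (a (i + 1)).2, Num.max (a i).2 (a (i + 1)).2].

Lemma edge_absE a (i : 'I_3) (y : R) : (a (i + 1)).2 - (a i).2 != 0 ->
  (edge_abs a i y, y) = edge_pt a i ((y - (a i).2) / ((a (i + 1)).2 - (a i).2)).
Proof.
move=> D0; apply: injective_projections; rewrite /edge_abs /edge_pt //=.
by rewrite /GRing.scale /=; field.
Qed.

Lemma edge_abs_simplex a (i : 'I_3) (y : R) : (a (i + 1)).2 - (a i).2 != 0 ->
  Num.min (a i).2 (a (i + 1)).2 <= y <= Num.max (a i).2 (a (i + 1)).2 ->
  simplex a (edge_abs a i y, y).
Proof.
move=> D0 yI; rewrite edge_absE//; apply: (@edge_simplex _ a i).
eexists; last by reflexivity.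
move: D0; rewrite neq_lt /= in_itv /= => /orP[D0|D0].
  move: yI; rewrite min_r ?max_l; [|lra|lra] => /andP[y1 y2].
  rewrite ler_ndivlMr// mul0r ler_ndivrMr//; lra.
move: yI; rewrite min_l ?max_r; [|lra|lra] => /andP[y1 y2].
rewrite ler_pdivlMr// mul0r ler_pdivrMr//; lra.
Qed.

Lemma edge_slice_continuous a F (i : 'I_3) (y : R) :
  (forall p, simplex a p -> {for p, continuous F}) ->
  (a (i + 1)).2 - (a i).2 != 0 ->
  Num.min (a i).2 (a (i + 1)).2 <= y <= Num.max (a i).2 (a (i + 1)).2 ->
  {for y, continuous (fun y => F (edge_abs a i y, y))}.
Proof.
move=> cF D0 yI.
apply: (@continuous_comp _ _ _ (fun y => (edge_abs a i y, y)) F).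
  apply: continuous_pair; last exact: cvg_id.
  by rewrite /edge_abs; apply: differentiable_continuous.
by apply: cF; exact: edge_abs_simplex.
Qed.

Lemma edge_slice_integrable a F (i : 'I_3) :
  (forall p, simplex a p -> {for p, continuous F}) ->
  mu.-integrable setT (EFin \o edge_slice a F i).
Proof.
move=> cF; rewrite /edge_slice -restrict_EFin; apply/integrable_restrict => //.
rewrite setTI; have [D0|D0] := eqVneq ((a (i + 1)).2 - (a i).2) 0.
  rewrite (_ : EFin \o _ = cst 0%E); first exact: integrable0.
  by apply/funext => y /=; rewrite D0 sgr0 mulr0 mul0r.
apply: continuous_compact_integrable; first exact: segment_compact.
apply: continuous_within => y; rewrite /= in_itv /= => yI.
apply: cvgM; first exact: cvg_cst.
exact: (edge_slice_continuous cF D0 yI).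
Qed.

(** The sign in the slice and the length of the interval of heights combine into the signed height
    difference, the first component of the rotated edge. A horizontal edge contributes zero to both
    sides. *)
Lemma integral_edge_slice a F (i : 'I_3) :
  (forall p, simplex a p -> {for p, continuous F}) ->
  \int[mu]_y edge_slice a F i y =
  - Num.sg (tri_det a) * (rot_edge a i).1 *
    \int[mu]_(t in `[0, 1]) F (edge_pt a i t).
Proof.
move=> cF; rewrite -Rintegral_mkcond /rot_edge /=.
have [D0|D0] := eqVneq ((a (i + 1)).2 - (a i).2) 0.
  rewrite D0 mulr0 mul0r (_ : (fun y => _) = cst 0) ?Rintegral_cst ?mul0r//.
  by apply/funext => y; rewrite sgr0 mulr0 mul0r.
rewrite RintegralZl//; last first.
  apply: continuous_compact_integrable; first exact: segment_compact.
  apply: continuous_within => y; rewrite /= in_itv /= => yI.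
  exact: (edge_slice_continuous cF D0 yI).
rewrite Rintegral_segment_param => [|y yI]; last exact: edge_slice_continuous.
rewrite mulrA -[- _ * _ * _]mulrA mulr_sg_norm; congr (_ * _).
apply: eq_Rintegral => t _; rewrite edge_absE//; congr (F (edge_pt a i _)).
by field.
Qed.

(* A horizontal line avoiding the vertices either misses the triangle or cuts
   off exactly one vertex, hence crosses exactly the two edges meeting there. *)
Lemma alone_vertex a (y : R) : (forall i, (a i).2 != y) ->
  [\/ forall i, (a i).2 < y, forall i, y < (a i).2 |
      exists k, ((a k).2 - y) * ((a (k + 1)).2 - y) < 0 /\
                ((a k).2 - y) * ((a (k + 2%:R)).2 - y) < 0].
Proof.
move=> ay.
have lg i : (a i).2 < y \/ y < (a i).2 by apply/orP; rewrite -neq_lt.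
have [h0|h0] := lg 0; have [h1|h1] := lg (0 + 1); have [h2|h2] := lg (0 + 2%:R).
- by apply: Or31; apply: (@ord3_ind 0).
- by apply: Or33; exists (0 + 2%:R); rewrite !ord3D; split; nra.
- by apply: Or33; exists (0 + 1); rewrite !ord3D; split; nra.
- by apply: Or33; exists 0; split; nra.
- by apply: Or33; exists 0; split; nra.
- by apply: Or33; exists (0 + 1); rewrite !ord3D; split; nra.
- by apply: Or33; exists (0 + 2%:R); rewrite !ord3D; split; nra.
- by apply: Or32; apply: (@ord3_ind 0).
Qed.

(** All vertices being on the same side, a point of the triangle at height [y] would make the
    barycentric mean of their positive distances to the line vanish, hence all weights would be
    zero. *)
Lemma simplex_slice_out a (y : R) :
  (forall i, (a i).2 < y) \/ (forall i, y < (a i).2) ->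
  forall x, ~ simplex a (x, y).
Proof.
move=> H x [l [l0 l1]] /(congr1 snd) /=.
rewrite (sum_ord3 0) /= => E; move: l1; rewrite (sum_ord3 0) => l1.
pose g i := `|y - (a i).2|.
have g0 i : 0 < g i.
  by rewrite normr_gt0 subr_eq0; case: H => H; rewrite ?(gt_eqF (H i)) ?(lt_eqF (H i)).
have gE : \sum_i l i * g i = 0.
  have e2 : y = l 0 * (a 0).2 + l (0 + 1) * (a (0 + 1)).2 +
    l (0 + 2%:R) * (a (0 + 2%:R)).2 := E.
  rewrite (sum_ord3 0) /g; case: H => H.
    rewrite !gtr0_norm ?subr_gt0//.
    transitivity ((l 0 + l (0 + 1) + l (0 + 2%:R)) * y - y); last by rewrite l1; ring.
    by rewrite [X in _ = _ - X]e2; ring.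
  rewrite !ltr0_norm ?subr_lt0//.
  transitivity (y - (l 0 + l (0 + 1) + l (0 + 2%:R)) * y); last by rewrite l1; ring.
  by rewrite [X in _ = X - _]e2; ring.
have lg i : l i = 0.
  have : l i * g i == 0.
    rewrite eq_le mulr_ge0 ?(ltW (g0 i))// andbT -gE (bigD1 i)//= lerDl.
    by apply: sumr_ge0 => j _; rewrite mulr_ge0 ?(ltW (g0 j)).
  by rewrite mulf_eq0 (gt_eqF (g0 i)) orbF => /eqP.
by move: l1; rewrite !lg !addr0 => /eqP; rewrite eq_sym oner_eq0.
Qed.

End EdgeSlices.

Section SliceIntegrals.
Variable R : realType.
Notation mu := (@lebesgue_measure R).
Implicit Types (a : 'I_3 -> R * R) (F : R * R -> R).

(** The fundamental theorem of calculus gives the difference of [F] between the two crossings. The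
    signs found in [slice_simplex] turn it, whichever crossing is on the left, into the
    contributions of the two crossed edges; the third edge does not meet the line. *)
Lemma integral_slice a F (y : R) : tri_det a != 0 ->
  (forall p, simplex a p -> {for p, continuous F}) ->
  (forall p, simplex a p -> derivable F p (1, 0)) ->
  (forall p, simplex a p -> {for p, continuous (d1 F)}) ->
  (forall i, (a i).2 != y) ->
  (\int[mu]_x ((d1 F \_ (simplex a)) (x, y))%:E =
   (\sum_i edge_slice a F i y)%:E)%E.
Proof.
move=> D0 cF dF cdF ay.
have out i : ((a i).2 < y /\ (a (i + 1)).2 < y) \/
    (y < (a i).2 /\ y < (a (i + 1)).2) -> edge_slice a F i y = 0.
  move=> H; rewrite /edge_slice patchE ifN//; apply/negP; rewrite inE /= in_itv /=.
  by case: (leP (a i).2) => h1 /andP[]; lra.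
have ins i : ((a i).2 - y) * ((a (i + 1)).2 - y) < 0 -> edge_slice a F i y =
    - Num.sg (tri_det a) * Num.sg ((a (i + 1)).2 - (a i).2) * F (edge_abs a i y, y).
  move=> H; rewrite /edge_slice patchE ifT//; rewrite inE /= in_itv /=.
  by case: (leP (a i).2) => h1; nra.
have [H|H|[k [hb hc]]] := alone_vertex ay.
- rewrite big1 => [|i _]; last by apply: out; left.
  rewrite integral0_eq // => x _; rewrite patchE ifN//; apply/negP; rewrite inE.
  by apply: simplex_slice_out; left.
- rewrite big1 => [|i _]; last by apply: out; right.
  rewrite integral0_eq // => x _; rewrite patchE ifN//; apply/negP; rewrite inE.
  by apply: simplex_slice_out; right.
have [sLM s2 memb] := slice_simplex D0 hb hc.
rewrite (sum_ord3 k) (ins k)// (ins (k + 2%:R)); last by rewrite ord3D mulrC.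
rewrite (out (k + 1)); last first.
  rewrite ord3D; have := ay (k + 1); rewrite neq_lt => /orP[h|h]; [left|right];
    split=> //; nra.
rewrite addr0 ord3D s2 mulrN mulNr -sLM -mulrBr.
set L := edge_abs a k y in sLM memb *; set M := edge_abs a (k + 2%:R) y in sLM memb *.
have LM0 : L != M.
  rewrite -subr_eq0 -sgr_eq0 sLM mulf_neq0//; first by rewrite oppr_eq0 sgr_eq0.
  rewrite sgr_eq0 subr_eq0; apply/eqP => e; move: hb.
  by rewrite e -expr2 ltNge sqr_ge0.
have -> : (\int[mu]_x ((d1 F \_ (simplex a)) (x, y))%:E =
    \int[mu]_(x in `[Num.min L M, Num.max L M]) (d1 F (x, y))%:E)%E.
  rewrite [RHS]integral_mkcond; apply: eq_integral => x _; rewrite !patchE.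
  have -> : ((x, y) \in simplex a) = (x \in [set` `[Num.min L M, Num.max L M]]).
    by apply/idP/idP; rewrite !inE /= in_itv /= => /memb.
  by case: ifP.
have inS x : Num.min L M <= x <= Num.max L M -> simplex a (x, y) by move=> /memb.
move: LM0; rewrite neq_lt => /orP[LM|LM].
- rewrite (min_idPl (ltW LM)) (max_idPr (ltW LM)) in inS *.
  rewrite FTC_slice// => [|x /inS/cF|x /inS/dF|x /inS/cdF]//.
  by rewrite ltr0_sg ?subr_lt0// mulN1r opprB.
- rewrite (min_idPr (ltW LM)) (max_idPl (ltW LM)) in inS *.
  rewrite FTC_slice// => [|x /inS/cF|x /inS/dF|x /inS/cdF]//.
  by rewrite gtr0_sg ?subr_gt0// mul1r.
Qed.

Lemma continuous_fst_plane : continuous (fun p : R * R => p.1).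
Proof. by move=> p; exact: cvg_fst. Qed.

Lemma continuous_snd_plane : continuous (fun p : R * R => p.2).
Proof. by move=> p; exact: cvg_snd. Qed.

Lemma continuous_bary a (i : 'I_3) : continuous (bary a i).
Proof.
move=> p; apply: cvgM; last exact: cvg_cst.
apply: cvgD; (apply: cvgM; last exact: cvg_cst).
  by apply: cvgB; [exact: continuous_fst_plane|exact: cvg_cst].
by apply: cvgB; [exact: continuous_snd_plane|exact: cvg_cst].
Qed.

Lemma simplex_closed a : tri_det a != 0 -> closed (simplex a).
Proof.
move=> D0; have -> : simplex a = \bigcap_(i in setT) [set p | 0 <= bary a i p].
  apply/seteqP; split=> p; first by move=> /(simplexP _ D0) H i _; exact: H.
  by move=> H; apply/(simplexP _ D0) => i; exact: H.
apply: closed_bigI => i _.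
apply: (@preimage_closed _ _ (bary a i) [set x : R | 0 <= x]); last exact: closed_ge.
by move=> p _; exact: continuous_bary.
Qed.

Lemma simplex_compact a : tri_det a != 0 -> compact (simplex a).
Proof.
move=> D0; apply: compact_plane_box; first exact: simplex_closed.
exists (\sum_i (`|(a i).1| + `|(a i).2|)) => p [l [l0 l1] ->].
have l1' i : l i <= 1.
  by rewrite -l1 (bigD1 i)//= lerDl sumr_ge0.
rewrite !(sum_ord3 0) /=.
have B (x : R) i : `|l i *: x| <= `|x|.
  by rewrite normrZ (ger0_norm (l0 i)) ler_piMl.
split; (apply: le_trans (ler_normD _ _) _; rewrite lerD//; first
  (apply: le_trans (ler_normD _ _) _; rewrite lerD//));
  apply: le_trans (B _ _) _; by rewrite ?lerDl ?lerDr.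
Qed.

Lemma iterated_integral_dx a F : tri_det a != 0 ->
  (forall p, simplex a p -> {for p, continuous F}) ->
  (forall p, simplex a p -> derivable F p (1, 0)) ->
  (forall p, simplex a p -> {for p, continuous (d1 F)}) ->
  measurable_fun setT (fubini_G mu (EFin \o d1 F \_ (simplex a))) ->
  (\int[mu]_y \int[mu]_x ((d1 F \_ (simplex a)) (x, y))%:E)%E =
  (- Num.sg (tri_det a) *
   \sum_i (rot_edge a i).1 * \int[mu]_(t in `[0, 1]) F (edge_pt a i t))%:E.
Proof.
move=> D0 cF dF cdF mI.
have iS : mu.-integrable setT (fun y => \sum_(i < 3) (edge_slice a F i y)%:E)%E.
  by apply: integrable_sum => // i _; exact: edge_slice_integrable.
transitivity (\int[mu]_y (\sum_(i < 3) (edge_slice a F i y)%:E))%E.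
  apply: ae_eq_integral => //; first exact: measurable_int iS.
  (* The slice formula is known only at heights different from those of the vertices; the
     exceptional heights form a finite, hence null, set. *)
  exists (\bigcup_(i in [set: 'I_3]) [set (a i).2]); split.
  - by apply: fin_bigcup_measurable => // i _; exact: measurable_set1.
  - apply: countable_lebesgue_measure0; apply: finite_set_countable.
    exact: bigcup_finite.
  - move=> y /= H; apply: contrapT => yn; apply: H => _.
    rewrite integral_slice ?sumEFin// => i; apply/eqP => yE.
    by apply: yn; exists i.
rewrite integral_sum//; last by move=> i; exact: edge_slice_integrable.
rewrite mulr_sumr -sumEFin; apply: eq_bigr => i _.
rewrite mulrA -(integral_edge_slice i cF) /Rintegral fineK//.
exact/integrable_fin_num/edge_slice_integrable.
Qed.

End SliceIntegrals.

(** * Green's formula on one triangle *)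

Section GreenTriangle.
Variable R : realType.
Notation mu := (@lebesgue_measure R).
Notation mu2 := (mu \x mu)%E.
Implicit Types (a : 'I_3 -> R * R) (F u v h g : R * R -> R) (W : set (R * R)).

Lemma simplex_measurable a : tri_det a != 0 -> measurable (simplex a).
Proof. by move=> D0; apply: closed_measurable_plane; exact: simplex_closed. Qed.

Lemma integral_simplex_d1 a F : tri_det a != 0 ->
  (forall p, simplex a p -> {for p, continuous F}) ->
  (forall p, simplex a p -> derivable F p (1, 0)) ->
  (forall p, simplex a p -> {for p, continuous (d1 F)}) ->
  \int[mu2]_(p in simplex a) d1 F p = - Num.sg (tri_det a) *
   \sum_i (rot_edge a i).1 * \int[mu]_(t in `[0, 1]) F (edge_pt a i t).
Proof.
move=> D0 cF dF cdF; rewrite Rintegral_mkcond /Rintegral.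
have iF : mu2.-integrable setT (EFin \o d1 F \_ (simplex a)).
  rewrite -restrict_EFin; apply/integrable_restrict => //.
    exact: simplex_measurable.
  by rewrite setTI; apply: continuous_integrable_plane => //; exact: simplex_compact.
rewrite -(integral21_prod_meas1 iF) [X in fine X]iterated_integral_dx//.
exact: (measurable_fubini_G iF).
Qed.

Definition swap_pt (p : R * R) : R * R := (p.2, p.1).

Lemma swap_sum (l : 'I_3 -> R) a :
  \sum_i l i *: swap_pt (a i) = swap_pt (\sum_i l i *: a i).
Proof. by rewrite !(sum_ord3 0). Qed.

Lemma swap_simplex a p : simplex (swap_pt \o a) p <-> simplex a (swap_pt p).
Proof.
split=> -[l l01 E]; exists l => //.
  by rewrite E /= -swap_sum.
by rewrite swap_sum -E; case: p {E}.
Qed.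

Lemma swap_continuous F (p : R * R) :
  {for swap_pt p, continuous F} -> {for p, continuous (F \o swap_pt)}.
Proof.
move=> cF; apply: continuous_comp => //.
by apply: continuous_pair; [exact: continuous_snd_plane|exact: continuous_fst_plane].
Qed.

Lemma swap_quotient F p : (fun h : R => h^-1 *:
    (((F \o swap_pt) \o shift p) (h *: (1, 0)) - (F \o swap_pt) p)) =
  (fun h : R => h^-1 *: ((F \o shift (swap_pt p)) (h *: (0, 1)) - F (swap_pt p))).
Proof. by apply/funext => h. Qed.

Lemma swap_derivable F p :
  derivable F (swap_pt p) (0, 1) -> derivable (F \o swap_pt) p (1, 0).
Proof. by rewrite /derivable swap_quotient. Qed.

Lemma swap_d1 F : d1 (F \o swap_pt) = d2 F \o swap_pt.
Proof. by apply/funext => p; rewrite /d1 /derive swap_quotient. Qed.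

(** Vertical slices become horizontal after exchanging the axes. The exchange changes the sign of
    the determinant and also the sign relating the components of the rotated edge, so the formula
    keeps its shape. *)
Lemma integral_simplex_d2 a F : tri_det a != 0 ->
  (forall p, simplex a p -> {for p, continuous F}) ->
  (forall p, simplex a p -> derivable F p (0, 1)) ->
  (forall p, simplex a p -> {for p, continuous (d2 F)}) ->
  \int[mu2]_(p in simplex a) d2 F p = - Num.sg (tri_det a) *
   \sum_i (rot_edge a i).2 * \int[mu]_(t in `[0, 1]) F (edge_pt a i t).
Proof.
move=> D0 cF dF cdF; rewrite Rintegral_mkcond /Rintegral.
have iF : mu2.-integrable setT (EFin \o d2 F \_ (simplex a)).
  rewrite -restrict_EFin; apply/integrable_restrict => //.
    exact: simplex_measurable.
  by rewrite setTI; apply: continuous_integrable_plane => //; exact: simplex_compact.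
have D' : tri_det (swap_pt \o a) = - tri_det a.
  by rewrite /tri_det /dot /rot_edge /=; ring.
have E y x : (d2 F \_ (simplex a)) (y, x) =
    (d1 (F \o swap_pt) \_ (simplex (swap_pt \o a))) (x, y).
  rewrite !patchE.
  have -> : ((y, x) \in simplex a) = ((x, y) \in simplex (swap_pt \o a)).
    by have sw := swap_simplex a (x, y); apply/idP/idP; rewrite !inE => /sw.
  by rewrite swap_d1.
rewrite -(integral12_prod_meas1 iF).
rewrite /fubini_F.
under eq_integral do under eq_integral do rewrite /= E.
rewrite [X in fine X]iterated_integral_dx//; first last.
- apply: eq_measurable_fun (measurable_fubini_F iF) => y _.
  rewrite /fubini_F /fubini_G; apply: eq_integral => x _ /=; rewrite E.
  by [].
- move=> p /(swap_simplex a p) sp; rewrite swap_d1; exact: swap_continuous (cdF _ sp).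
- by move=> p /(swap_simplex a p) sp; apply/swap_derivable/dF.
- by move=> p /(swap_simplex a p) sp; exact: swap_continuous (cF _ sp).
- by rewrite D' oppr_eq0.
rewrite /= D' sgrN opprK mulNr -mulrN -sumrN; congr (_ * _).
apply: eq_bigr => i _; rewrite -mulNr; congr (_ * _).
by rewrite /rot_edge /= opprK.
Qed.

Lemma smooth_on_continuous W h p : smooth_on W h -> W p -> {for p, continuous h}.
Proof. by move=> sh; exact: (sh 0). Qed.

Lemma smooth_on_differentiable W h p : smooth_on W h -> W p -> differentiable h p.
Proof. by move=> sh; have [+ _ _] := sh 1; exact. Qed.

Lemma smooth_on_d1 W h : smooth_on W h -> smooth_on W (d1 h).
Proof. by move=> sh k; have [_ + _] := sh k.+1. Qed.

Lemma smooth_on_d2 W h : smooth_on W h -> smooth_on W (d2 h).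
Proof. by move=> sh k; have [_ _ +] := sh k.+1. Qed.

Lemma d1M g h p : differentiable g p -> differentiable h p ->
  d1 (g \* h) p = g p * d1 h p + h p * d1 g p.
Proof. by move=> dg dh; rewrite /d1 deriveM //; exact: diff_derivable. Qed.

Lemma d2M g h p : differentiable g p -> differentiable h p ->
  d2 (g \* h) p = g p * d2 h p + h p * d2 g p.
Proof. by move=> dg dh; rewrite /d2 deriveM //; exact: diff_derivable. Qed.

Lemma near_continuous f g p : {near p, f =1 g} ->
  {for p, continuous g} -> {for p, continuous f}.
Proof.
move=> fg cg; rewrite /prop_for /continuous_at (nbhs_singleton fg).
apply: cvg_trans cg; apply: near_eq_cvg.
by apply: filterS fg => q ->.
Qed.

Lemma enorm_rot a (i : 'I_3) : enorm (rot_edge a i) = enorm (a (i + 1) - a i).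
Proof. by rewrite /enorm /rot_edge /dot /=; congr Num.sqrt; ring. Qed.

Lemma enorm_edge_gt0 a (i : 'I_3) : tri_det a != 0 -> 0 < enorm (a (i + 1) - a i).
Proof.
rewrite (tri_detE a i) /enorm sqrtr_gt0 => D0.
set e := a (i + 1) - a i in D0 *; rewrite lt_neqAle addr_ge0 ?sqr_ge0// andbT.
apply: contra_neq D0 => /esym/eqP; rewrite paddr_eq0 ?sqr_ge0// !mulf_eq0 !orbb.
move=> /andP[/eqP e1 /eqP e2]; have -> : rot_edge a i = (e.2, - e.1) by [].
by rewrite e1 e2 /dot /= oppr0 !mulr0 addr0.
Qed.

(** Divergence theorem for the field v grad u. The rotated edge times [- Num.sg (tri_det a)] is the
    outward normal times the length of the edge, whatever the orientation of the vertices. *)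
Lemma green_simplex a W u v : tri_det a != 0 -> open W -> simplex a `<=` W ->
  smooth_on W u -> smooth_on W v ->
  \int[mu2]_(p in simplex a) (laplacian u p * v p + dot (grad u p) (grad v p)) =
  \sum_i enorm (a (i + 1) - a i) * \int[mu]_(t in `[0, 1])
     (dot (grad u (edge_pt a i t)) (edge_normal a i) * v (edge_pt a i t)).
Proof.
move=> D0 oW aW su sv; have cK := simplex_compact D0; have mK := simplex_measurable D0.
have su1 := smooth_on_d1 su; have su2 := smooth_on_d2 su.
have sv1 := smooth_on_d1 sv; have sv2 := smooth_on_d2 sv.
have su11 := smooth_on_d1 su1; have su22 := smooth_on_d2 su2.
have nW p : W p -> \forall q \near p, W q by move=> Wp; exact: open_nbhs_nbhs.
have d1E p : W p -> d1 (v \* d1 u) p = v p * d1 (d1 u) p + d1 u p * d1 v p.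
  by move=> Wp; apply: d1M; exact: smooth_on_differentiable Wp.
have d2E p : W p -> d2 (v \* d2 u) p = v p * d2 (d2 u) p + d2 u p * d2 v p.
  by move=> Wp; apply: d2M; exact: smooth_on_differentiable Wp.
have c1 p : W p -> {for p, continuous (v \* d1 u)}.
  by move=> Wp; apply: cvgM; exact: smooth_on_continuous Wp.
have c2 p : W p -> {for p, continuous (v \* d2 u)}.
  by move=> Wp; apply: cvgM; exact: smooth_on_continuous Wp.
(* Continuity of the derivative at [p] uses the product rule in a whole neighbourhood of [p], hence
   the open set [W] around the closed triangle. *)
have cd1 p : W p -> {for p, continuous (d1 (v \* d1 u))}.
  move=> Wp; apply: (@near_continuous _ (fun p => v p * d1 (d1 u) p + d1 u p * d1 v p)).
    by apply: filterS (nW _ Wp) => q; exact: d1E.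
  by apply: cvgD; apply: cvgM; exact: smooth_on_continuous Wp.
have cd2 p : W p -> {for p, continuous (d2 (v \* d2 u))}.
  move=> Wp; apply: (@near_continuous _ (fun p => v p * d2 (d2 u) p + d2 u p * d2 v p)).
    by apply: filterS (nW _ Wp) => q; exact: d2E.
  by apply: cvgD; apply: cvgM; exact: smooth_on_continuous Wp.
have dd p : W p -> differentiable (v \* d1 u) p.
  by move=> Wp; apply: differentiableM; exact: smooth_on_differentiable Wp.
have dd2 p : W p -> differentiable (v \* d2 u) p.
  by move=> Wp; apply: differentiableM; exact: smooth_on_differentiable Wp.
transitivity (\int[mu2]_(p in simplex a) d1 (v \* d1 u) p +
              \int[mu2]_(p in simplex a) d2 (v \* d2 u) p).
  rewrite -RintegralD//; last 2 first.
  - by apply: continuous_integrable_plane => // p /aW/cd1.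
  - by apply: continuous_integrable_plane => // p /aW/cd2.
  apply: eq_Rintegral => p; rewrite inE => /aW Wp.
  by rewrite d1E// d2E// /laplacian /dot /grad /=; ring.
have k1 p : simplex a p -> {for p, continuous (v \* d1 u)} by move=> /aW; exact: c1.
have k2 p : simplex a p -> derivable (v \* d1 u) p (1, 0).
  by move=> /aW/dd ?; apply: diff_derivable.
have k3 p : simplex a p -> {for p, continuous (d1 (v \* d1 u))}.
  by move=> /aW; exact: cd1.
have I1 := integral_simplex_d1 D0 k1 k2 k3.
have l1 p : simplex a p -> {for p, continuous (v \* d2 u)} by move=> /aW; exact: c2.
have l2 p : simplex a p -> derivable (v \* d2 u) p (0, 1).
  by move=> /aW/dd2 ?; apply: diff_derivable.
have l3 p : simplex a p -> {for p, continuous (d2 (v \* d2 u))}.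
  by move=> /aW; exact: cd2.
have I2 := integral_simplex_d2 D0 l1 l2 l3.
refine (etrans (congr2 +%R I1 I2) _) => {k1 k2 k3 l1 l2 l3 I1 I2}.
rewrite -mulrDr -big_split mulr_sumr; apply: eq_bigr => i _ /=.
have cedge F : (forall p, W p -> {for p, continuous F}) ->
    mu.-integrable `[0, 1] (EFin \o (F \o edge_pt a i)).
  move=> cF; apply: continuous_compact_integrable; first exact: segment_compact.
  apply: continuous_within => t t01; apply: continuous_comp.
    rewrite /edge_pt; apply: cvgD; first exact: cvg_cst.
    by apply: cvgZl; exact: cvg_id.
  by apply/cF/aW/(@edge_simplex _ a i); exists t.
have Z (c : R) F : (forall p, W p -> {for p, continuous F}) ->
    c * \int[mu]_(t in `[0, 1]) F (edge_pt a i t) =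
    \int[mu]_(t in `[0, 1]) (c * F (edge_pt a i t)).
  by move=> cF; rewrite RintegralZl//; exact: cedge.
have cZ (c : R) F p : {for p, continuous F} -> {for p, continuous (fun q => c * F q)}.
  by move=> cF; apply: cvgM; [exact: cvg_cst|exact: cF].
have k1 p : W p -> {for p, continuous (fun q => (rot_edge a i).1 * (v \* d1 u) q)}.
  by move=> Wp; apply/cZ/c1.
have k2 p : W p -> {for p, continuous (fun q => (rot_edge a i).2 * (v \* d2 u) q)}.
  by move=> Wp; apply/cZ/c2.
have k3 p : W p -> {for p, continuous (fun q => (rot_edge a i).1 * (v \* d1 u) q +
    (rot_edge a i).2 * (v \* d2 u) q)}.
  by move=> Wp; apply: cvgD; [exact: k1|exact: k2].
have k4 p : W p -> {for p, continuous (fun p => dot (grad u p) (edge_normal a i) * v p)}.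
  move=> Wp; apply: cvgM; last exact: smooth_on_continuous Wp.
  have kn : {for p, continuous (fun q =>
      d1 u q * (edge_normal a i).1 + d2 u q * (edge_normal a i).2)}.
    by apply: cvgD; (apply: cvgM; last exact: cvg_cst);
       [exact: smooth_on_continuous su1 Wp|exact: smooth_on_continuous su2 Wp].
  exact: kn.
refine (etrans (congr1 _ (congr2 +%R (Z (rot_edge a i).1 _ c1) (Z (rot_edge a i).2 _ c2))) _).
refine (etrans (congr1 _ (esym (RintegralD _ (cedge _ k1) (cedge _ k2)))) _) => //.
refine (etrans (Z _ _ k3) _); refine (etrans _ (esym (Z _ _ k4))).
apply: eq_Rintegral => t _; rewrite /edge_normal -(tri_detE a i) enorm_rot.
have := enorm_edge_gt0 i D0; move/gt_eqF/negbT => e0.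
by rewrite /dot /grad /= /GRing.scale /=; field.
Qed.

End GreenTriangle.

(** * Interior edges of the mesh and Green's formula on the surrogate domain *)

Section Edges.
Variable R : realType.
Implicit Types (a b : 'I_3 -> R * R) (p q : R * R) (i j : 'I_3).

Lemma dotDl p q r : dot (p + q) r = dot p r + dot q r :> R.
Proof. by rewrite /dot /=; ring. Qed.

Lemma dotZl (c : R) p q : dot (c *: p) q = c * dot p q.
Proof. by rewrite /dot /= /GRing.scale /=; ring. Qed.

Lemma dotNl p q : dot (- p) q = - dot p q.
Proof. by rewrite -scaleN1r dotZl mulN1r. Qed.

Lemma dotNr p q : dot p (- q) = - dot p q.
Proof. by rewrite /dot /=; ring. Qed.

Lemma dotZr (c : R) p q : dot p (c *: q) = c * dot p q.
Proof. by rewrite /dot /= /GRing.scale /=; ring. Qed.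

(** Each direction vector is a multiple of the other by a difference of two parameters in [0, 1].
    The two factors have modulus at most 1 and product 1, so they are both 1 or both -1, and the
    parameters can only be 0 and 1. *)
Lemma segment_eq (p q r s : R * R) : p != q ->
  (fun t : R => p + t *: (q - p)) @` `[0, 1]%classic =
  (fun t : R => r + t *: (s - r)) @` `[0, 1]%classic ->
  (p = r /\ q = s) \/ (p = s /\ q = r).
Proof.
move=> pq E.
have pin : ((fun t : R => p + t *: (q - p)) @` `[0, 1]%classic) p.
  by exists 0; rewrite /= ?in_itv /= ?lexx ?ler01// scale0r addr0.
have qin : ((fun t : R => p + t *: (q - p)) @` `[0, 1]%classic) q.
  by exists 1; rewrite /= ?in_itv /= ?lexx ?ler01// scale1r addrC subrK.
have rin : ((fun t : R => r + t *: (s - r)) @` `[0, 1]%classic) r.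
  by exists 0; rewrite /= ?in_itv /= ?lexx ?ler01// scale0r addr0.
have sin : ((fun t : R => r + t *: (s - r)) @` `[0, 1]%classic) s.
  by exists 1; rewrite /= ?in_itv /= ?lexx ?ler01// scale1r addrC subrK.
rewrite E in pin qin; rewrite -E in rin sin; move: pin qin rin sin.
move=> [t1 /=]; rewrite in_itv /= => /andP[t10 t11] e1.
move=> [t2 /=]; rewrite in_itv /= => /andP[t20 t21] e2.
move=> [u1 /=]; rewrite in_itv /= => /andP[u10 u11] e3.
move=> [u2 /=]; rewrite in_itv /= => /andP[u20 u21] e4.
have h1 : q - p = (t2 - t1) *: (s - r).
  by rewrite -{1}e1 -{1}e2 opprD addrACA subrr add0r scalerBl.
have h2 : s - r = (u2 - u1) *: (q - p).
  by rewrite -{1}e3 -{1}e4 opprD addrACA subrr add0r scalerBl.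
have h3 : (t2 - t1) * (u2 - u1) = 1.
  apply/eqP; rewrite -subr_eq0; have : ((t2 - t1) * (u2 - u1) - 1) *: (q - p) == 0.
    by rewrite scalerBl scale1r -scalerA -h2 -h1 subrr.
  by rewrite scaler_eq0 [q - p == 0]subr_eq0 [q == p]eq_sym (negPf pq) orbF.
have [d|d] : t2 - t1 = 1 \/ t2 - t1 = -1.
  have [d0|d0] := leP 0 (t2 - t1); [left|right].
    apply/eqP; rewrite eq_le; apply/andP; split; first lra.
    by rewrite -h3; nra.
  apply/eqP; rewrite eq_le; apply/andP; split; last lra.
  by nra.
- left; have t1E : t1 = 0 by lra.
  have t2E : t2 = 1 by lra.
  by rewrite -e1 -e2 t1E t2E scale0r addr0 scale1r addrC subrK.
- right; have t1E : t1 = 1 by lra.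
  have t2E : t2 = 0 by lra.
  by rewrite -e1 -e2 t1E t2E scale0r addr0 scale1r addrC subrK.
Qed.

Lemma edge_neq a i : tri_det a != 0 -> a i != a (i + 1).
Proof.
move=> D0; apply: contra_neq D0 => e.
by rewrite (tri_detE a i) /dot /rot_edge -e !subrr /=; ring.
Qed.

Lemma edge_eq a b i j : tri_det a != 0 -> edge a i = edge b j ->
  (a i = b j /\ a (i + 1) = b (j + 1)) \/ (a i = b (j + 1) /\ a (i + 1) = b j).
Proof. by move=> D0; apply: segment_eq; exact: edge_neq. Qed.

Lemma edge_normal_eq a b i j : tri_det a != 0 -> tri_det b != 0 ->
  edge a i = edge b j ->
  edge_normal b j = edge_normal a i \/ edge_normal b j = - edge_normal a i.
Proof.
move=> Da Db /(edge_eq Da) e.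
have [e1|e1] : rot_edge b j = rot_edge a i \/ rot_edge b j = - rot_edge a i.
  rewrite /rot_edge; case: e => -[-> ->]; [by left|right].
  by apply: injective_projections; rewrite /=; ring.
- rewrite /edge_normal -!tri_detE e1.
  have := Da; have := Db; rewrite !neq_lt.
  move=> /orP[Db'|Db'] /orP[Da'|Da']; rewrite ?(ltr0_sg Da') ?(gtr0_sg Da')
    ?(ltr0_sg Db') ?(gtr0_sg Db') -?scaleNr ?opprK; first [by left|right];
  by congr (_ *: _); rewrite ?mulNr ?opprK ?mul1r.
- rewrite /edge_normal -!tri_detE e1.
  have -> : enorm (- rot_edge a i) = enorm (rot_edge a i).
    by rewrite /enorm dotNl dotNr opprK.
  have := Da; have := Db; rewrite !neq_lt.
  move=> /orP[Db'|Db'] /orP[Da'|Da']; rewrite ?(ltr0_sg Da') ?(gtr0_sg Da')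
    ?(ltr0_sg Db') ?(gtr0_sg Db') scalerN -?scaleNr ?opprK; first [by right|left];
  by congr (_ *: _); rewrite ?mulNr ?opprK ?mul1r.
Qed.

(** Connects two descriptions of the sides of an edge, by the direction of the normal and by the
    sign of the coordinate of the opposite vertex; triangles sharing an edge are compared through
    it. *)
Lemma dot_edge_normal a i p : tri_det a != 0 ->
  dot (p - a i) (edge_normal a i) =
  - (`|tri_det a| / enorm (rot_edge a i)) * bary a (i + 2%:R) p.
Proof.
move=> D0; rewrite /edge_normal -tri_detE dotZr /bary !ord3D.
rewrite normrEsg !mulNr; congr (- _); field.
by rewrite D0 gt_eqF// enorm_rot enorm_edge_gt0.
Qed.

Lemma edge_normal_unit a i : tri_det a != 0 ->
  dot (edge_normal a i) (edge_normal a i) = 1.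
Proof.
move=> D0; have e0 := enorm_edge_gt0 i D0; rewrite -enorm_rot in e0.
have e2 : enorm (rot_edge a i) ^+ 2 = dot (rot_edge a i) (rot_edge a i).
  by rewrite sqr_sqrtr// addr_ge0// -expr2 sqr_ge0.
rewrite /edge_normal -tri_detE dotZl dotZr -e2.
have s2 : Num.sg (tri_det a) * Num.sg (tri_det a) = 1 by rewrite -expr2 sqr_sg D0.
rewrite -[RHS]s2; field; exact: lt0r_neq0.
Qed.

Lemma edge_normal_orth a i t : dot (edge_pt a i t - a i) (edge_normal a i) = 0.
Proof.
rewrite /edge_pt addrC addKr dotZl /edge_normal dotZr /rot_edge /dot /=; ring.
Qed.

End Edges.

(** * Triangles sharing an edge in a conforming mesh *)

Section MeshEdges.
Variables (R : realType) (T : mesh R).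
Implicit Types (K L : elt T) (i j : 'I_3).

Lemma mesh_det K : tri_det (vtx K) != 0.
Proof. exact: mesh_nondegenerate. Qed.

Definition opposite_sides (x y : elt T * 'I_3) : Prop :=
  [/\ y.1 \in active T, edge (vtx y.1) y.2 = edge (vtx x.1) x.2 &
      edge_normal (vtx y.1) y.2 = - edge_normal (vtx x.1) x.2].

Lemma edge_interior_unique (a : 'I_3 -> R * R) i j (t : R) : tri_det a != 0 ->
  0 < t < 1 -> edge a j (edge_pt a i t) -> j = i.
Proof.
move=> Da /andP[t0 t1] /(edgeP _ _ Da)[_]; rewrite bary_edge//.
have [e1 e2 e3] := edge_coefE i t.
by case: (ord3_cases i j) => -> //; rewrite ?ord3D ?e1 ?e2 => ?; exfalso; lra.
Qed.

(** If the two normals were equal, the shifted point would be at positive distance outside the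
    common edge for [b] as well, against its membership in [b]. *)
Lemma edge_outside_simplex (a b : 'I_3 -> R * R) i j (t s : R) :
  tri_det a != 0 -> tri_det b != 0 -> edge a i = edge b j ->
  0 <= t <= 1 -> 0 < s -> simplex b (edge_pt a i t + s *: edge_normal a i) ->
  edge_normal b j = - edge_normal a i.
Proof.
move=> Da Db e t01 s0 bp; have [E|//] := edge_normal_eq Da Db e.
have /= := dot_edge_normal j (edge_pt a i t + s *: edge_normal a i) Db.
have [u u01 eu] : edge b j (edge_pt a i t) by rewrite -e; exists t.
rewrite -eu addrAC dotDl edge_normal_orth add0r E dotZl edge_normal_unit// mulr1.
move=> sE; move: s0; rewrite sE mulNr oppr_gt0 ltNge mulr_ge0//.
  by rewrite divr_ge0// ltW// enorm_rot enorm_edge_gt0.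
by move: bp => /(simplexP _ Db); rewrite -eu; exact.
Qed.

(** At the midpoint two coordinates equal 1/2 and remain positive by continuity. The coordinate of
    the opposite vertex is zero there, and the inward shift makes it positive. *)
Lemma bary_inner (a : 'I_3 -> R * R) i : tri_det a != 0 ->
  \forall s \near (0 : R)^'+, forall j,
    0 < bary a j (edge_pt a i 2^-1 - s *: edge_normal a i).
Proof.
move=> Da.
pose q (s : R) := edge_pt a i 2^-1 - s *: edge_normal a i.
have cq j : {for 0, continuous (fun s : R => bary a j (q s))}.
  apply: continuous_comp; last exact: continuous_bary.
  apply: cvgB; first exact: cvg_cst.
  by apply: cvgZl; exact: cvg_id.
have q0 : q 0 = edge_pt a i 2^-1 by rewrite /q scale0r subr0.
have [e1 e2 e3] := edge_coefE i (2^-1 : R).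
have pos j : 0 < bary a j (q 0) -> \forall s \near (0 : R)^'+, 0 < bary a j (q s).
  move=> b0; have cj := cvg_at_right_filter (cq j).
  apply: (cj [set x : R | 0 < x]).
  by apply: open_nbhs_nbhs; split => //; exact: open_gt.
have h1 : \forall s \near (0 : R)^'+, 0 < bary a i (q s).
  by apply: pos; rewrite q0 bary_edge// e1; lra.
have h2 : \forall s \near (0 : R)^'+, 0 < bary a (i + 1) (q s).
  by apply: pos; rewrite q0 bary_edge// e2; lra.
have h3 : \forall s \near (0 : R)^'+, 0 < bary a (i + 2%:R) (q s).
  near=> s.
  have s0 : 0 < s by near: s; exact: nbhs_right_gt.
  have c0 : 0 < `|tri_det a| / enorm (rot_edge a i).
    by rewrite divr_gt0 ?normr_gt0// enorm_rot enorm_edge_gt0.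
  have := dot_edge_normal i (q s) Da; rewrite /q addrAC dotDl edge_normal_orth add0r.
  by rewrite dotNl dotZl edge_normal_unit// mulr1 mulNr => /oppr_inj; nra.
near=> s; apply: (@ord3_ind i); near: s; [exact: h1|exact: h2|exact: h3].
Unshelve. all: by end_near.
Qed.

(** Two triangles on the same side of an edge share its midpoint [m] and a point [q] slightly inside
    both. If they differ, conformity leaves a common vertex, which is a single point, or a common
    edge, which must be the edge through [m] and therefore misses [q]. *)
Lemma same_side_unique K L i j :
  edge (vtx K) i = edge (vtx L) j ->
  edge_normal (vtx K) i = edge_normal (vtx L) j -> (K, i) = (L, j).
Proof.
move=> e en; have [DK DL] := (mesh_det K, mesh_det L).
have emid : edge_pt (vtx K) i 2^-1 = edge_pt (vtx L) j 2^-1.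
  case: (edge_eq DK e) => -[e1 e2]; rewrite /edge_pt e1 e2 //.
  by apply: injective_projections; rewrite /= /GRing.scale /=; field.
have [s [s0 bK bL]] : exists s : R, [/\ 0 < s,
    forall k, 0 < bary (vtx K) k (edge_pt (vtx K) i 2^-1 - s *: edge_normal (vtx K) i) &
    forall k, 0 < bary (vtx L) k (edge_pt (vtx L) j 2^-1 - s *: edge_normal (vtx L) j)].
  apply: (@filter_ex _ (0 : R)^'+).
  near=> s; split; first by near: s; exact: nbhs_right_gt.
    by near: s; exact: bary_inner.
  by near: s; exact: bary_inner.
set m := edge_pt (vtx K) i 2^-1 in bK emid *.
set q := m - s *: edge_normal (vtx K) i in bK.
rewrite -emid -en -/q in bL.
have Kq : simplex (vtx K) q by apply/simplexP => // k; exact: ltW.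
have Lq : simplex (vtx L) q by apply/simplexP => // k; exact: ltW.
have half : (0 <= (2^-1 : R) <= 1) by lra.
have Km : simplex (vtx K) m by apply: (@edge_simplex _ _ i); exists 2^-1.
have Lm : simplex (vtx L) m.
  by rewrite emid; apply: (@edge_simplex _ _ j); exists 2^-1.
have [KL|KL] := eqVneq K L.
  subst L; congr pair; apply: esym; apply: (@edge_interior_unique _ _ _ 2^-1 DK); first lra.
  by rewrite -/m emid; exists 2^-1.
exfalso; case: (mesh_conforming KL) => [H|[i' [j' [_ H]]]|[i' [j' [_ H]]]].
- have : (simplex (vtx K) `&` simplex (vtx L)) m by [].
  by rewrite H.
- have : (simplex (vtx K) `&` simplex (vtx L)) m by [].
  have : (simplex (vtx K) `&` simplex (vtx L)) q by [].
  rewrite H => qE mE; have : dot (m - q) (edge_normal (vtx K) i) = 0.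
    by rewrite qE mE subrr /dot /=; ring.
  rewrite /q opprB addrCA subrr addr0 dotZl edge_normal_unit// mulr1 => sE.
  by rewrite sE ltxx in s0.
- have : (simplex (vtx K) `&` simplex (vtx L)) m by [].
  have : (simplex (vtx K) `&` simplex (vtx L)) q by [].
  rewrite H => qE mE.
  have ii : i' = i by apply: (@edge_interior_unique _ _ _ 2^-1 DK _ mE); lra.
  move: qE; rewrite ii => /(edgeP _ _ DK)[_] b0.
  by have := bK (i + 2%:R); rewrite b0 ltxx.
Unshelve. all: by end_near.
Qed.

End MeshEdges.

Section OppositeSides.
Variables (R : realType) (T : mesh R).
Notation mu := (@lebesgue_measure R).
Implicit Types (K L : elt T) (i j : 'I_3).

Lemma continuous_edge_pt (a : 'I_3 -> R * R) i : continuous (edge_pt a i).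
Proof.
move=> t; rewrite /edge_pt; apply: cvgD; first exact: cvg_cst.
by apply: cvgZl; exact: cvg_id.
Qed.

(* Points just outside [K] near an interior point of the surrogate domain lie
   in active triangles; by finiteness one of these contains the limit point,
   and conformity forces it to share the whole edge. *)
Lemma opposite_sides_exists K i : K \in active T -> ~~ bedge K i ->
  exists y, opposite_sides (K, i) y.
Proof.
move=> aK /asboolPn nb; have DK := mesh_det K.
have [t0 [t01 intt0]] : exists t0, 0 <= t0 <= 1 /\
    interior (surrogate T) (edge_pt (vtx K) i t0).
  apply: contrapT => H; apply: nb => p [t t01 pE]; split.
    apply: subset_closure; exists K => //; apply: (@edge_simplex _ _ i).
    by exists t.
  move=> ip; apply: H; exists t; split; last by rewrite pE.
  by move: t01; rewrite /= in_itv.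
(* The parameter is moved slightly towards 1/2, which excludes the vertices while staying in the
   open interior. *)
have [t [t01' intt]] : exists t, 0 < t < 1 /\
    interior (surrogate T) (edge_pt (vtx K) i t).
  pose c (r : R) := edge_pt (vtx K) i (t0 + r * (2^-1 - t0)).
  have cc : {for 0, continuous c}.
    apply: continuous_comp; last exact: continuous_edge_pt.
    apply: cvgD; first exact: cvg_cst.
    by apply: cvgMl; exact: cvg_id.
  have c0 : c 0 = edge_pt (vtx K) i t0 by rewrite /c mul0r addr0.
  have : \forall r \near (0 : R)^'+, interior (surrogate T) (c r).
    have cr := cvg_at_right_filter cc; apply: (cr (interior (surrogate T))).
    by apply: open_nbhs_nbhs; split; [exact: open_interior|rewrite c0].
  move=> near_c; have [r [r0 r1 cr]] : exists r : R,
      [/\ 0 < r, r < 1 & interior (surrogate T) (c r)].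
    apply: (@filter_ex _ (0 : R)^'+); near=> r; split; near: r => //.
      exact: nbhs_right_gt.
    exact: nbhs_right_lt.
  exists (t0 + r * (2^-1 - t0)); split=> //.
  by move: t01 => /andP[h1 h2]; apply/andP; split; nra.
set p := edge_pt (vtx K) i t in intt.
pose q (s : R) := p + s *: edge_normal (vtx K) i.
have cq : {for 0, continuous q}.
  apply: cvgD; first exact: cvg_cst.
  by apply: cvgZl; exact: cvg_id.
have q0 : q 0 = p by rewrite /q scale0r addr0.
have nearq (V : set (R * R)) : open V -> V p -> \forall s \near (0 : R)^'+, V (q s).
  move=> oV Vp; have cr := cvg_at_right_filter cq; apply: (cr V).
  by apply: open_nbhs_nbhs; split; rewrite ?q0.
(* Otherwise, by finiteness, [q s] would avoid every active triangle for small [s], although it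
   stays in the surrogate domain. The triangle found is met for arbitrarily small [s], so being
   closed it contains [p]. *)
have [L [aL HL]] : exists L, L \in active T /\
    ~ \forall s \near (0 : R)^'+, ~ simplex (vtx L) (q s).
  apply: contrapT => H.
  have {}H L : \forall s \near (0 : R)^'+, L \in active T -> ~ simplex (vtx L) (q s).
    have [aL|naL] := boolP (L \in active T); last exact: nearW.
    have : \forall s \near (0 : R)^'+, ~ simplex (vtx L) (q s).
      by apply: contrapT => HL; apply: H; exists L.
    by apply: filterS => s ? _.
  have [s [Ss Hs]] : exists s, surrogate T (q s) /\
      forall L, L \in active T -> ~ simplex (vtx L) (q s).
    apply: (@filter_ex _ (0 : R)^'+); apply: filterI.
      apply: filterS (nearq _ (@open_interior _ _) intt) => s; exact: interior_subset.
    exact: (@filter_forall _ (elt T)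
      (fun L s => L \in active T -> ~ simplex (vtx L) (q s)) (0 : R)^'+ _ H).
  by case: Ss => L aL Lq; exact: (Hs L).
have DL := mesh_det L.
have Lp : simplex (vtx L) p.
  apply: contrapT => nLp; apply: HL.
  apply: (nearq (~` simplex (vtx L))) => //.
  by apply: closed_openC; exact: simplex_closed.
have [s s0 Lq] : exists2 s, 0 < s & simplex (vtx L) (q s).
  apply: contrapT => H; apply: HL.
  by apply: filterS (nbhs_right_gt (0 : R)) => s s0 Lq; apply: H; exists s.
have tc : 0 <= t <= 1 by lra.
have Kp : simplex (vtx K) p by apply: (@edge_simplex _ _ i); exists t.
have KL : K != L.
  apply/eqP => KL; subst L.
  have := edge_outside_simplex DK DK (erefl _) tc s0 Lq.
  move=> e; have := edge_normal_unit i DK.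
  by rewrite {1}e dotNl edge_normal_unit// => h; lra.
case: (mesh_conforming KL) => [H|[i' [j' [_ H]]]|[i' [j' [e H]]]].
- by have : (simplex (vtx K) `&` simplex (vtx L)) p by []; rewrite H.
- have : (simplex (vtx K) `&` simplex (vtx L)) p by [].
  rewrite H => pE; exfalso.
  have := bary_edge i t i DK; have := bary_edge i t (i + 1) DK; rewrite -/p pE.
  have [-> -> _] := edge_coefE i t.
  have -> : vtx K i' = edge_pt (vtx K) i' 0 by rewrite /edge_pt scale0r addr0.
  rewrite !bary_edge//; have [f1 f2 f3] := edge_coefE i' (0 : R).
  case: (ord3_cases i' i) => ->; rewrite ?ord3D ?f1 ?f2 ?f3; lra.
- have : (simplex (vtx K) `&` simplex (vtx L)) p by [].
  rewrite H => pE; have ii : i' = i by exact: (@edge_interior_unique _ _ _ _ t DK).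
  exists (L, j'); split => //=; first by rewrite -e ii.
  by apply: (edge_outside_simplex DK DL _ tc s0 Lq); rewrite -e ii.
Unshelve. all: by end_near.
Qed.

End OppositeSides.

(** * Cancellation over interior edges *)

Section GreenMesh.
Variables (R : realType) (T : mesh R).
Notation mu := (@lebesgue_measure R).
Implicit Types (K L : elt T) (i j : 'I_3).

Definition inner_edge (x : elt T * 'I_3) := (x.1 \in active T) && ~~ bedge x.1 x.2.

Lemma opposite_sides_inner x y : inner_edge x -> opposite_sides x y -> inner_edge y.
Proof.
by move=> /andP[ax nbx] [ay e _]; rewrite /inner_edge ay /bedge e.
Qed.

Lemma opposite_sides_sym x y : inner_edge x -> opposite_sides x y -> opposite_sides y x.
Proof.
by move=> /andP[ax _] [ay e en]; split=> //; rewrite en opprK.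
Qed.

(* Every interior edge has exactly one partner, so the sum equals its own
   opposite after exchanging the roles of the two partners. *)
Lemma inner_edges_cancel (G : elt T * 'I_3 -> R) :
  (forall x y, inner_edge x -> opposite_sides x y -> G y = - G x) ->
  \sum_(x | inner_edge x) G x = 0.
Proof.
move=> GN; set S := (LHS).
have one x : inner_edge x -> exists y0, forall y,
    inner_edge y && `[< opposite_sides x y >] = (y == y0).
  move=> ix; move: (ix) => /andP[ax nbx].
  have [[L j] xy0] := opposite_sides_exists ax nbx.
  exists (L, j) => -[L' j']; apply/andP/eqP => [[_ /asboolP xy]|->]; last first.
    rewrite -surjective_pairing in xy0.
    by split; [exact: opposite_sides_inner xy0|apply/asboolP].
  case: xy xy0 => _ /= e en [_ /= e' en'].
  by apply: same_side_unique; rewrite ?e ?en.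
have S1 : S = \sum_(x | inner_edge x) \sum_(y | inner_edge y && `[< opposite_sides x y >]) G x.
  by apply: eq_bigr => x /one[y0 H]; rewrite (big_pred1 y0).
have S2 : S = \sum_(x | inner_edge x) \sum_(y | inner_edge y && `[< opposite_sides x y >]) - G y.
  rewrite S1; apply: eq_bigr => x ix; apply: eq_bigr => y /andP[_ /asboolP xy].
  by rewrite (GN _ _ ix xy) opprK.
have S3 : S = - S.
  rewrite {1}S2 {1}S1 -sumrN (exchange_big_dep inner_edge) /=; last by move=> x y _ /andP[].
  apply: eq_bigr => x ix; rewrite -sumrN; apply: eq_bigl => y.
  rewrite ix /=; case: (boolP (inner_edge y)) => //= iy.
  by apply/asboolP/asboolP; exact: opposite_sides_sym.
lra.
Qed.

Lemma continuous_edge_integrable (f : R -> R) :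
  (forall t, 0 <= t <= 1 -> {for t, continuous f}) ->
  mu.-integrable `[0, 1] (EFin \o f).
Proof.
move=> cf; apply: continuous_compact_integrable; first exact: segment_compact.
by apply: continuous_within => t; rewrite /= in_itv /= => /cf.
Qed.

(** The normals are opposite, [u] is global and the branches of [v] match on the common edge. Only
    the parametrizations may differ, by the reversal of [0, 1]. *)
Lemma edge_flux_opposite (u : R * R -> R) (v : broken T) (W : set (R * R))
    (x y : elt T * 'I_3) :
  (forall p, W p -> {for p, continuous (d1 u)}) ->
  (forall p, W p -> {for p, continuous (d2 u)}) ->
  surrogate T `<=` W ->
  (forall K p, K \in active T -> W p -> {for p, continuous (v K)}) ->
  (forall K L p, K \in active T -> L \in active T ->
    simplex (vtx K) p -> simplex (vtx L) p -> v K p = v L p) ->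
  inner_edge x -> opposite_sides x y ->
  let G (x : elt T * 'I_3) :=
    enorm (vtx x.1 (x.2 + 1) - vtx x.1 x.2) * \int[mu]_(t in `[0, 1])
     (dot (grad u (edge_pt (vtx x.1) x.2 t)) (edge_normal (vtx x.1) x.2) *
      v x.1 (edge_pt (vtx x.1) x.2 t)) in
  G y = - G x.
Proof.
case: x y => [K i] [L j] c1 c2 SW cv vE /andP[/= aK _] [/= aL e en] /=.
have DL := mesh_det L.
pose f (t : R) := dot (grad u (edge_pt (vtx K) i t)) (edge_normal (vtx K) i) *
   v K (edge_pt (vtx K) i t).
have inK (t : R) : 0 <= t <= 1 -> simplex (vtx K) (edge_pt (vtx K) i t).
  by move=> t01; apply: (@edge_simplex _ _ i); exists t.
have inW (t : R) : 0 <= t <= 1 -> W (edge_pt (vtx K) i t).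
  by move=> /inK Kt; apply: SW; exists K.
have cf (t : R) : 0 <= t <= 1 -> {for t, continuous f}.
  move=> /inW Wt; apply: cvgM; last first.
    by apply: continuous_comp; [exact: continuous_edge_pt|exact: cv].
  have cd (h : R * R -> R) : {for edge_pt (vtx K) i t, continuous h} ->
      {for t, continuous (h \o edge_pt (vtx K) i)}.
    by move=> ch; apply: continuous_comp => //; exact: continuous_edge_pt.
  have k : {for t, continuous (fun t => d1 u (edge_pt (vtx K) i t) * (edge_normal (vtx K) i).1 +
      d2 u (edge_pt (vtx K) i t) * (edge_normal (vtx K) i).2)}.
    by apply: cvgD; (apply: cvgM; last exact: cvg_cst); apply: cd; [exact: c1|exact: c2].
  exact: k.
have vKL (t : R) : 0 <= t <= 1 -> v L (edge_pt (vtx K) i t) = v K (edge_pt (vtx K) i t).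
  move=> t01; apply: vE => //; last exact: inK.
  by apply: (@edge_simplex _ _ j); rewrite e; exists t.
have fN : - (\int[mu]_(t in `[0, 1]) f t) = \int[mu]_(t in `[0, 1]) (-1 * f t).
  by rewrite RintegralZl ?mulN1r//; exact: continuous_edge_integrable.
rewrite en -mulrN fN.
case: (edge_eq DL e) => -[e1 e2].
  rewrite e1 e2; congr (_ * _); apply: eq_Rintegral => t; rewrite inE /= in_itv /= => t01.
  have -> : edge_pt (vtx L) j t = edge_pt (vtx K) i t by rewrite /edge_pt e1 e2.
  by rewrite vKL// dotNr /f; ring.
have -> : enorm (vtx L (j + 1) - vtx L j) = enorm (vtx K (i + 1) - vtx K i).
  by rewrite e1 e2 /enorm -opprB dotNl dotNr opprK.
congr (_ * _); transitivity (\int[mu]_(t in `[0, 1]) (-1 * f (1 + t * (0 - 1)))).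
  apply: eq_Rintegral => t; rewrite inE /= in_itv /= => /andP[t0 t1].
  have -> : edge_pt (vtx L) j t = edge_pt (vtx K) i (1 + t * (0 - 1)).
    by rewrite /edge_pt e1 e2; apply: injective_projections; rewrite /= /GRing.scale /=; ring.
  rewrite /f vKL; last by lra.
  by rewrite dotNr; ring.
rewrite -fN RintegralZl//; last first.
  apply: continuous_edge_integrable => t t01.
  apply: (@continuous_comp _ _ _ (fun t : R => 1 + t * (0 - 1)) f).
    by apply: cvgD; [exact: cvg_cst|apply: cvgMl; exact: cvg_id].
  by apply: cf; lra.
rewrite mulN1r; congr (- _).
have := @Rintegral_segment_param _ f 1 0.
rewrite (min_idPr ler01) (max_idPl ler01) => ->; last by move=> t; exact: cf.
by rewrite sub0r normrN1 mul1r.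
Qed.

Lemma green_mesh (W : set (R * R)) (u : R * R -> R) (v : broken T) :
  open W -> surrogate T `<=` W -> smooth_on W u ->
  (forall K, K \in active T -> smooth_on W (v K)) ->
  (forall K L p, K \in active T -> L \in active T ->
    simplex (vtx K) p -> simplex (vtx L) p -> v K p = v L p) ->
  intO (fun K p => laplacian u p * v K p + dot (grad u p) (grad (v K) p)) =
  flux (fun=> u) v.
Proof.
move=> oW SW su sv vE; rewrite /intO /flux /intG.
under eq_bigr => K aK.
  rewrite (green_simplex (mesh_det K) oW _ su (sv K aK)); last first.
    by move=> p Kp; apply: SW; exists K.
  over.
rewrite (eq_bigr _ (fun K _ => bigID (bedge K) _ _)) /= big_split /=.
rewrite -[RHS]addr0; congr (_ + _); rewrite pair_big_dep /=.
pose G (x : elt T * 'I_3) :=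
    enorm (vtx x.1 (x.2 + 1) - vtx x.1 x.2) * \int[mu]_(t in `[0, 1])
     (dot (grad u (edge_pt (vtx x.1) x.2 t)) (edge_normal (vtx x.1) x.2) *
      v x.1 (edge_pt (vtx x.1) x.2 t)).
apply: (@inner_edges_cancel G) => x y; apply: edge_flux_opposite SW _ vE.
- by move=> p Wp; apply: smooth_on_continuous (smooth_on_d1 su) Wp.
- by move=> p Wp; apply: smooth_on_continuous (smooth_on_d2 su) Wp.
- by move=> K p aK Wp; exact: smooth_on_continuous (sv K aK) Wp.
Qed.

End GreenMesh.

(** * Polynomials of two variables *)

Section Polynomials.
Variable R : realType.
Implicit Types (s : {poly {poly R}}) (g h : R * R -> R) (p q : R * R).

Lemma differentiable_fst p : differentiable (fun q : R * R => q.1) p.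
Proof. exact: (@linear_differentiable _ _ _ fst p (@continuous_fst_plane R)). Qed.

Lemma differentiable_snd p : differentiable (fun q : R * R => q.2) p.
Proof. exact: (@linear_differentiable _ _ _ snd p (@continuous_snd_plane R)). Qed.

Lemma d1_fst : d1 (fun q : R * R => q.1) = cst 1.
Proof.
apply/funext => p; rewrite /d1 deriveE; last exact: differentiable_fst.
by rewrite (@diff_lin _ _ _ fst p (@continuous_fst_plane R)).
Qed.

Lemma d2_fst : d2 (fun q : R * R => q.1) = cst 0.
Proof.
apply/funext => p; rewrite /d2 deriveE; last exact: differentiable_fst.
by rewrite (@diff_lin _ _ _ fst p (@continuous_fst_plane R)).
Qed.

Lemma d1_snd : d1 (fun q : R * R => q.2) = cst 0.
Proof.
apply/funext => p; rewrite /d1 deriveE; last exact: differentiable_snd.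
by rewrite (@diff_lin _ _ _ snd p (@continuous_snd_plane R)).
Qed.

Lemma d2_snd : d2 (fun q : R * R => q.2) = cst 1.
Proof.
apply/funext => p; rewrite /d2 deriveE; last exact: differentiable_snd.
by rewrite (@diff_lin _ _ _ snd p (@continuous_snd_plane R)).
Qed.

Lemma d1_cst (c : R) : d1 (cst c : R * R -> R) = cst 0.
Proof. by apply/funext => p; rewrite /d1 derive_cst. Qed.

Lemma d2_cst (c : R) : d2 (cst c : R * R -> R) = cst 0.
Proof. by apply/funext => p; rewrite /d2 derive_cst. Qed.

Lemma d1D g h p : differentiable g p -> differentiable h p ->
  d1 (g \+ h) p = d1 g p + d1 h p.
Proof. by move=> dg dh; rewrite /d1 deriveD //; exact: diff_derivable. Qed.

Lemma d2D g h p : differentiable g p -> differentiable h p ->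
  d2 (g \+ h) p = d2 g p + d2 h p.
Proof. by move=> dg dh; rewrite /d2 deriveD //; exact: diff_derivable. Qed.

Lemma pevalD s t p : peval (s + t) p = peval s p + peval t p.
Proof. by rewrite /peval !hornerD. Qed.

Lemma pevalM s t p : peval (s * t) p = peval s p * peval t p.
Proof. by rewrite /peval !hornerM. Qed.

Lemma peval_const (c : R) p : peval (c%:P)%:P p = c.
Proof. by rewrite /peval !hornerC. Qed.

Lemma peval_fst p : peval ('X)%:P p = p.1.
Proof. by rewrite /peval hornerC hornerX. Qed.

Lemma peval_snd p : peval 'X p = p.2.
Proof. by rewrite /peval hornerX hornerC. Qed.

(** Constants and the two coordinates generate all polynomials under sums and products. Stated for
    the functions [peval s], this spares analytic properties any computation with coefficients. *)
Lemma poly2_ind (Q : (R * R -> R) -> Prop) :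
  (forall c, Q (cst c)) -> Q (fun p => p.1) -> Q (fun p => p.2) ->
  (forall s t, Q (peval s) -> Q (peval t) -> Q (peval s \+ peval t)) ->
  (forall s t, Q (peval s) -> Q (peval t) -> Q (peval s \* peval t)) ->
  forall s, Q (peval s).
Proof.
move=> Qc Q1 Q2 QD QM.
have {}Q1 : Q (peval 'X%:P) by rewrite (_ : peval _ = fun p => p.1)//; apply/funext => p; exact: peval_fst.
have {}Q2 : Q (peval 'X) by rewrite (_ : peval _ = fun p => p.2)//; apply/funext => p; exact: peval_snd.
have {}Qc c : Q (peval (c%:P)%:P) by rewrite (_ : peval _ = cst c)//; apply/funext => p; exact: peval_const.
have {}QD s t : Q (peval s) -> Q (peval t) -> Q (peval (s + t)).
  by move=> Qs Qt; rewrite (_ : peval _ = peval s \+ peval t); [exact: QD|apply/funext => p; exact: pevalD].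
have {}QM s t : Q (peval s) -> Q (peval t) -> Q (peval (s * t)).
  by move=> Qs Qt; rewrite (_ : peval _ = peval s \* peval t); [exact: QM|apply/funext => p; exact: pevalM].
elim/poly_ind => [|s c Qs]; first by rewrite -polyC0 -polyC0.
apply: (QD); first exact: (QM).
elim/poly_ind: c => [|c k Qk]; first by rewrite -polyC0.
by rewrite polyCD polyCM; apply: QD => //; exact: QM.
Qed.

(** The derivatives are exhibited as polynomials again, which makes the induction on the order of
    smoothness possible. *)
Lemma peval_derivatives s :
  [/\ forall p, differentiable (peval s) p,
      exists t, d1 (peval s) = peval t & exists t, d2 (peval s) = peval t].
Proof.
pose C (c : R) := (c%:P)%:P : {poly {poly R}}.
have CE c : cst c = peval (C c) by apply/funext => p; rewrite peval_const.
apply: (@poly2_ind (fun h => [/\ forall p, differentiable h p,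
  exists t, d1 h = peval t & exists t, d2 h = peval t])) => {s}.
- move=> c; split; first by move=> p; exact: differentiable_cst.
    by exists (C 0); rewrite d1_cst CE.
  by exists (C 0); rewrite d2_cst CE.
- split; [exact: differentiable_fst|exists (C 1)|exists (C 0)].
    by rewrite d1_fst CE.
  by rewrite d2_fst CE.
- split; [exact: differentiable_snd|exists (C 0)|exists (C 1)].
    by rewrite d1_snd CE.
  by rewrite d2_snd CE.
- move=> s t [ds [s1 s1E] [s2 s2E]] [dt [t1 t1E] [t2 t2E]]; split.
  + by move=> p; apply: differentiableD.
  + by exists (s1 + t1); apply/funext => p; rewrite d1D// s1E t1E pevalD.
  + by exists (s2 + t2); apply/funext => p; rewrite d2D// s2E t2E pevalD.
- move=> s t [ds [s1 s1E] [s2 s2E]] [dt [t1 t1E] [t2 t2E]]; split.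
  + by move=> p; apply: differentiableM.
  + by exists (s * t1 + t * s1); apply/funext => p; rewrite d1M// s1E t1E pevalD !pevalM.
  + by exists (s * t2 + t * s2); apply/funext => p; rewrite d2M// s2E t2E pevalD !pevalM.
Qed.

Lemma peval_differentiable s p : differentiable (peval s) p.
Proof. by have [+ _ _] := peval_derivatives s; exact. Qed.

Lemma peval_continuous s : continuous (peval s).
Proof. by move=> p; apply: differentiable_continuous; exact: peval_differentiable. Qed.

Lemma peval_smooth s W : smooth_on W (peval s).
Proof.
move=> k; elim: k s => [|k IH] s; first by move=> p _; exact: peval_continuous.
have [ds [s1 s1E] [s2 s2E]] := peval_derivatives s.
by split; [move=> p _; exact: ds|rewrite s1E|rewrite s2E].
Qed.

End Polynomials.

(** * Discrete modes *)

Section FormalSeries.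
Variable R : realType.
Implicit Types (a b c D : nat -> R).

(* The two weights differ by a shift of one degree, which merges the two
   boundary series into the single series of defects. *)
Lemma fps_mul_shift c c' a b D : c' 0 = 0 -> (forall k, c' k.+1 = c k) ->
  D 0 = a 0 -> (forall m, D m.+1 = a m.+1 + b m) ->
  forall m, fps_mul c a m + fps_mul c' b m = \sum_(l < m.+1) c (m - l)%N * D l.
Proof.
move=> c0 cS D0 DS m.
have -> : \sum_(l < m.+1) c (m - l)%N * D l = \sum_(k < m.+1) c k * D (m - k)%N.
  rewrite (reindex_inj rev_ord_inj) /=; apply: eq_bigr => k _.
  by rewrite subSS subKn// -ltnS.
have -> : fps_mul c' b m = \sum_(k < m) c k * b (m - k.+1)%N.
  rewrite /fps_mul big_ord_recl c0 mul0r add0r.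
  by apply: eq_bigr => k _; rewrite /= /bump /= add1n cS.
rewrite /fps_mul !big_ord_recr /= subnn D0 addrAC; congr (_ + _).
rewrite -big_split; apply: eq_bigr => k _ /=.
by rewrite -mulrDr -(subnSK (ltn_ord k)) DS.
Qed.

Lemma fps_mul_linear (d0 d1 : R) c m :
  fps_mul (fun k => (d0%:P + d1 *: 'X)`_k) c m.+1 = d0 * c m.+1 + d1 * c m.
Proof.
rewrite /fps_mul !big_ord_recl big1 => [|k _]; rewrite !coefD !coefC !coefZ !coefX /=.
  by rewrite subn0 subSS subn0 !mulr0 !mulr1 addr0 add0r addr0.
by rewrite /bump /= mulr0 addr0 mul0r.
Qed.

Lemma fps_mul_linear0 (d0 d1 : R) c :
  fps_mul (fun k => (d0%:P + d1 *: 'X)`_k) c 0 = d0 * c 0.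
Proof.
by rewrite /fps_mul big_ord_recl big_ord0 coefD coefC coefZ coefX /= mulr0 !addr0.
Qed.

(** Equating coefficients after multiplication by the linear denominator gives the recurrence of a
    geometric sequence. *)
Lemma fps_quotient_const (n0 d0 d1 : R) c : d0 != 0 ->
  fps_quotient n0%:P (d0%:P + d1 *: 'X) c ->
  forall k, c k = n0 / d0 * (- d1 / d0) ^+ k.
Proof.
move=> d00 qc; elim=> [|k IH].
  have := qc 0; rewrite fps_mul_linear0 coefC /= expr0 mulr1 => <-.
  by rewrite mulrAC mulfV// mul1r.
have := qc k.+1; rewrite fps_mul_linear coefC /= IH => /eqP.
rewrite addr_eq0 => /eqP e; apply: (mulfI d00); rewrite e exprS; field.
by [].
Qed.

Lemma fps_quotient_X (n0 d0 d1 : R) c : d0 != 0 ->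
  fps_quotient (n0 *: 'X) (d0%:P + d1 *: 'X) c ->
  c 0 = 0 /\ forall k, c k.+1 = n0 / d0 * (- d1 / d0) ^+ k.
Proof.
move=> d00 qc; have c0 : c 0 = 0.
  have := qc 0; rewrite fps_mul_linear0 coefZ coefX /= mulr0 => /eqP.
  by rewrite mulf_eq0 (negPf d00) => /eqP.
split=> //; elim=> [|k IH].
  have := qc 1; rewrite fps_mul_linear coefZ coefX /= c0 mulr0 addr0 mulr1.
  by rewrite expr0 mulr1 => <-; rewrite mulrAC mulfV// mul1r.
have := qc k.+2; rewrite fps_mul_linear coefZ coefX /= mulr0 IH => /eqP.
rewrite addr_eq0 => /eqP e; apply: (mulfI d00); rewrite e exprS; field.
by [].
Qed.

End FormalSeries.

(** * Measurability and boundedness after composition with the boundary map *)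

Section BoundaryData.
Variable R : realType.
Notation mu := (@lebesgue_measure R).
Implicit Types (A Omega : set (R * R)) (p q : R * R).

Lemma frontier_measurable A : measurable (frontier A).
Proof.
apply: measurableD; first by apply: closed_measurable_plane; exact: closed_closure.
by apply: open_measurable_plane; exact: open_interior.
Qed.

Lemma frontier_bounded A : bounded_set A ->
  exists m : R, forall p, frontier A p -> `|p.1| <= m /\ `|p.2| <= m.
Proof.
move=> [m [_ Am]]; exists (m + 1) => p [clp _].
have m1 : m < m + 1 by rewrite ltrDl.
set C := [set q : R * R | `|q.1| <= m + 1] `&` [set q | `|q.2| <= m + 1].
have cC : closed C.
  apply: closedI.
    apply: (@preimage_closed _ _ (fun q : R * R => `|q.1|) [set x : R | x <= m + 1]); last exact: closed_le.
    move=> q _; apply: continuous_comp; first exact: continuous_fst_plane.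
    exact: norm_continuous.
  apply: (@preimage_closed _ _ (fun q : R * R => `|q.2|) [set x : R | x <= m + 1]); last exact: closed_le.
  move=> q _; apply: continuous_comp; first exact: continuous_snd_plane.
  exact: norm_continuous.
have : closure A `<=` C.
  rewrite (proj1 (closure_id C) cC); apply: closure_subset.
  by move=> q /(Am _ m1) /=; rewrite prod_normE ge_max => /andP[].
by move=> /(_ _ clp).
Qed.

Lemma enorm_continuous : continuous (@enorm R).
Proof.
move=> p; rewrite /enorm; apply: continuous_comp; last exact: sqrt_continuous.
by apply: cvgD; apply: cvgM; first [exact: continuous_fst_plane|exact: continuous_snd_plane].
Qed.

Lemma enorm_eq0 p : (enorm p == 0) = (p == 0).
Proof.
rewrite /enorm sqrtr_eq0 /dot -!expr2; apply/idP/eqP => [h|->].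
  have : p.1 ^+ 2 + p.2 ^+ 2 == 0 by rewrite eq_le h addr_ge0// sqr_ge0.
  rewrite paddr_eq0 ?sqr_ge0// !sqrf_eq0 => /andP[/eqP p1 /eqP p2].
  by apply: injective_projections.
by rewrite /= expr0n addr0.
Qed.

(** Near each frontier point the normal agrees on the frontier with the normalized gradient of a
    defining function, which is continuous there; the defining function changes from point to point,
    hence the local criterion. *)
Lemma normal_measurable Omega n : smooth_bounded_domain Omega n ->
  measurable_fun (frontier Omega) (fun p => (n p).1) /\
  measurable_fun (frontier Omega) (fun p => (n p).2).
Proof.
move=> [_ _ loc].
have main (pr : R * R -> R) : (forall c p, pr (c *: p) = c * pr p) -> continuous pr ->
    measurable_fun (frontier Omega) (fun p => pr (n p)).
  move=> prZ prC; apply: locally_continuous_measurable; first exact: frontier_measurable.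
  move=> p Fp; have [U [rho [oU Up srho [rho0 _] nE]]] := loc _ Fp.
  exists (fun q => (enorm (grad rho q))^-1 * pr (grad rho q)); last first.
    have : \forall q \near p, U q by exact: open_nbhs_nbhs.
    by apply: filterS => q Uq Fq; rewrite nE// prZ.
  have cg : {for p, continuous (grad rho)}.
    apply: continuous_pair.
      by apply: smooth_on_continuous (smooth_on_d1 srho) Up.
    by apply: smooth_on_continuous (smooth_on_d2 srho) Up.
  apply: cvgM; last by apply: continuous_comp => //; exact: prC.
  apply: (@continuous_comp _ _ _ (fun q => enorm (grad rho q)) (@GRing.inv R)).
    by apply: continuous_comp => //; exact: enorm_continuous.
  by apply: inv_continuous; rewrite enorm_eq0; case: (rho0 p Up).
split; apply: main => //; [exact: continuous_fst_plane|exact: continuous_snd_plane].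
Qed.

Lemma normal_bounded Omega n : smooth_bounded_domain Omega n ->
  forall p, frontier Omega p -> `|(n p).1| <= 1 /\ `|(n p).2| <= 1.
Proof.
move=> [_ _ loc] p Fp; have [U [rho [oU Up srho [rho0 _] nE]]] := loc _ Fp.
rewrite nE//=; set g := grad rho p.
have e0 : 0 < enorm g by rewrite lt_neqAle eq_sym enorm_eq0 rho0 ?sqrtr_ge0.
have e2 : enorm g ^+ 2 = g.1 ^+ 2 + g.2 ^+ 2.
  by rewrite sqr_sqrtr /dot ?addr_ge0// -?expr2// sqr_ge0.
have B (x : R) : x ^+ 2 <= enorm g ^+ 2 -> `|(enorm g)^-1 * x| <= 1.
  move=> x2; rewrite normrM gtr0_norm ?invr_gt0// mulrC ler_pdivrMr// mul1r.
  by rewrite -(ler_pXn2r (ltn0Sn 1)) ?nnegrE ?(ltW e0)// -normrX ger0_norm// sqr_ge0.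
by split; apply: B; rewrite e2 ?lerDl ?lerDr sqr_ge0.
Qed.

(** Factors that keep integrable data integrable on a boundary edge. Polynomials and components of
    the normal, evaluated at [M], belong to this class, which is stable under sums and products. *)
Definition bounded_measurable (f : R -> R) : Prop :=
  @measurable_fun _ _ R R `[0, 1]%classic f /\
  exists m, forall t, 0 <= t <= 1 -> `|f t| <= m.

Lemma bounded_measurableD f g : bounded_measurable f -> bounded_measurable g ->
  bounded_measurable (f \+ g).
Proof.
move=> [mf [m fm]] [mg [k gk]]; split; first exact: measurable_funD.
exists (m + k) => t t01; apply: le_trans (ler_normD _ _) _.
by rewrite lerD ?fm ?gk.
Qed.

Lemma bounded_measurableM f g : bounded_measurable f -> bounded_measurable g ->
  bounded_measurable (f \* g).
Proof.
move=> [mf [m fm]] [mg [k gk]]; split; first exact: measurable_funM.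
by exists (m * k) => t t01; rewrite normrM ler_pM ?fm ?gk.
Qed.

Lemma bounded_measurable_cst (c : R) : bounded_measurable (cst c).
Proof. by split; [exact: measurable_cst|exists `|c|]. Qed.

Lemma bounded_measurable_integrable f : bounded_measurable f ->
  mu.-integrable `[0, 1] (EFin \o f).
Proof.
move=> [mf [m fm]]; apply: measurable_bounded_integrable => //.
  by rewrite /= lebesgue_measure_itv /= lte_fin ltr01 -EFinB ltry.
exists m; split; first by rewrite num_real.
move=> x mx t /=; rewrite in_itv /= => t01; apply: le_trans (ltW mx).
exact: fm.
Qed.

Lemma bounded_measurable_mul f g : bounded_measurable f ->
  mu.-integrable `[0, 1] (EFin \o g) ->
  mu.-integrable `[0, 1] (EFin \o (f \* g)).
Proof.
move=> [mf [m fm]] ig.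
rewrite (_ : EFin \o _ = ((EFin \o f) \* (EFin \o g))%E); last by [].
apply: integrableMr => //; exists m; split; first by rewrite num_real.
move=> x mx t /=; rewrite in_itv /= => t01; apply: le_trans (ltW mx).
exact: fm.
Qed.

Variables (T : mesh R) (Omega : set (R * R)) (n M : R * R -> R * R).
Hypotheses (smO : smooth_bounded_domain Omega n)
  (MO : forall p, Gbar T p -> frontier Omega (M p))
  (mM : measurable_fun (Gbar T) M).

Lemma bedge_Gbar (K : elt T) (i : 'I_3) (t : R) : bedge K i -> 0 <= t <= 1 ->
  Gbar T (edge_pt (vtx K) i t).
Proof. by move=> /asboolP eG t01; apply: eG; exists t. Qed.

Lemma edge_pt_measurable (a : 'I_3 -> R * R) (i : 'I_3) :
  measurable_fun setT (edge_pt a i).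
Proof.
rewrite (_ : edge_pt a i = fun t => ((edge_pt a i t).1, (edge_pt a i t).2)); last first.
  by apply/funext => t; rewrite -surjective_pairing.
apply: measurable_fun_pair; apply: continuous_measurable_fun => t;
  apply: continuous_comp; try exact: continuous_edge_pt.
  exact: continuous_fst_plane.
exact: continuous_snd_plane.
Qed.

Lemma frontier_comp_measurable (h : R * R -> R) (K : elt T) (i : 'I_3) :
  bedge K i -> measurable_fun (frontier Omega) h ->
  @measurable_fun _ _ R R `[0, 1]%classic (fun t => h (M (edge_pt (vtx K) i t))).
Proof.
move=> bK mh.
apply: (measurable_comp (F := frontier Omega) (f := h)
  (g := fun t => M (edge_pt (vtx K) i t))) => //.
- exact: frontier_measurable.
- move=> _ [t + <-]; rewrite /= in_itv /= => t01.
  by apply: MO; exact: bedge_Gbar.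
- apply: (measurable_comp (F := Gbar T) (f := M)) => //.
  + exact: frontier_measurable.
  + by move=> _ [t + <-]; rewrite /= in_itv /= => t01; exact: bedge_Gbar.
  + by apply: measurable_funS (edge_pt_measurable _ _).
Qed.

(** [M] may be discontinuous. Boundedness holds because its values lie in the frontier of a bounded
    set, inside a compact box on which [h] is bounded. *)
Lemma bounded_measurable_continuous (h : R * R -> R) (K : elt T) (i : 'I_3) :
  bedge K i -> continuous h ->
  bounded_measurable (fun t => h (M (edge_pt (vtx K) i t))).
Proof.
move=> bK ch; split.
  apply: frontier_comp_measurable => //; apply: continuous_measurable_plane.
    exact: frontier_measurable.
  by move=> p _; exact: ch.
have [_ bO _] := smO; have [m Fm] := frontier_bounded bO.
have : compact (h @` (`[- m, m]%classic `*` `[- m, m]%classic)).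
  apply: continuous_compact; first by apply: continuous_subspaceT.
  by apply: compact_setX; exact: segment_compact.
move=> /compact_bounded[k [_ hk]]; exists (k + 1) => t t01.
apply: hk; first by rewrite ltrDl.
exists (M (edge_pt (vtx K) i t)) => //.
have [] := Fm _ (MO (bedge_Gbar bK t01)); rewrite !ler_norml => h1 h2.
by split; rewrite /= in_itv.
Qed.

Lemma bounded_measurable_normal (K : elt T) (i : 'I_3) : bedge K i ->
  bounded_measurable (fun t => (n (M (edge_pt (vtx K) i t))).1) /\
  bounded_measurable (fun t => (n (M (edge_pt (vtx K) i t))).2).
Proof.
move=> bK; have [n1 n2] := normal_measurable smO.
split; split.
- exact: (frontier_comp_measurable bK n1).
- by exists 1 => t t01; have [] := normal_bounded smO (MO (bedge_Gbar bK t01)).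
- exact: (frontier_comp_measurable bK n2).
- by exists 1 => t t01; have [] := normal_bounded smO (MO (bedge_Gbar bK t01)).
Qed.

End BoundaryData.

(** * Variational problems of the discrete modes *)

Section FormalModes.
Variables (R : realType) (T : mesh R) (P : nat).
Variables (Omega : set (R * R)) (n M : R * R -> R * R) (alpha gamma : R).
Variables (f uRD qRN : R * R -> R).
Notation mu := (@lebesgue_measure R).
Hypotheses (smO : smooth_bounded_domain Omega n)
  (MO : forall p, Gbar T p -> frontier Omega (M p))
  (mM : measurable_fun (Gbar T) M) (gamma0 : 0 < gamma)
  (iRD : bdry_integrable T (uRD \o M)) (iRN : bdry_integrable T (qRN \o M)).

Definition broken_bdry_integrable (w : broken T) : Prop :=
  forall K i, K \in active T -> bedge K i ->
    mu.-integrable `[0, 1] (EFin \o (fun t => w K (edge_pt (vtx K) i t))).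

Lemma inV_peval (w : broken T) : inV P w ->
  forall K, K \in active T -> exists s, w K = peval s.
Proof. by move=> [wP _] K /wP[s _ ->]; exists s. Qed.

Lemma opA_integrable (w v : broken T) (K : elt T) (i : 'I_3) :
  broken_bdry_integrable w -> inV P v -> K \in active T -> bedge K i ->
  mu.-integrable `[0, 1] (EFin \o (fun t => w K (edge_pt (vtx K) i t) *
     (v K (M (edge_pt (vtx K) i t)) / gamma))).
Proof.
move=> iw /inV_peval vP aK bK; have [s vK] := vP K aK.
have bv : bounded_measurable (fun t => v K (M (edge_pt (vtx K) i t)) / gamma).
  apply: (@bounded_measurableM _ (fun t => v K (M (edge_pt (vtx K) i t))) (cst gamma^-1)).
    by rewrite vK; exact: (bounded_measurable_continuous smO MO mM bK (@peval_continuous _ s)).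
  exact: bounded_measurable_cst.
rewrite (_ : (fun t => _) = (fun t => v K (M (edge_pt (vtx K) i t)) / gamma) \*
    (fun t => w K (edge_pt (vtx K) i t))).
  by apply: bounded_measurable_mul => //; exact: iw.
by apply/funext => t /=; rewrite mulrC.
Qed.

Lemma opAD (w1 w2 v : broken T) : inV P v ->
  broken_bdry_integrable w1 -> broken_bdry_integrable w2 ->
  opA gamma M (fun K p => w1 K p + w2 K p) v = opA gamma M w1 v + opA gamma M w2 v.
Proof.
move=> Vv i1 i2; rewrite /opA /intG -big_split; apply: eq_bigr => K aK.
rewrite -big_split; apply: eq_bigr => i bK /=; rewrite -mulrDr; congr (_ * _).
rewrite -RintegralD//; [|exact: opA_integrable|exact: opA_integrable].
by apply: eq_Rintegral => t _; rewrite mulrDl.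
Qed.

Lemma opAZ (c : R) (w v : broken T) : inV P v -> broken_bdry_integrable w ->
  opA gamma M (fun K p => c * w K p) v = c * opA gamma M w v.
Proof.
move=> Vv iw; rewrite /opA /intG mulr_sumr; apply: eq_bigr => K aK.
rewrite mulr_sumr; apply: eq_bigr => i bK /=; rewrite mulrCA; congr (_ * _).
rewrite -RintegralZl//; last exact: opA_integrable.
by apply: eq_Rintegral => t _; rewrite -[LHS]mulrA.
Qed.

(** [A] and [B] are the coefficients of order [k] of the two boundary residuals of the method, for
    the value and for the normal derivative. *)
Let A (u : nat -> broken T) k : broken T :=
  eval_at M (fun K x => u k K x - const_series uRD k x).
Let B (u : nat -> broken T) k : broken T :=
  eval_at M (fun K x => normal_deriv n (u k K) x - const_series qRN k x).

Lemma const_series_integrable (h : R * R -> R) k : bdry_integrable T (h \o M) ->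
  broken_bdry_integrable (fun=> fun p => const_series h k (M p)).
Proof.
move=> ih K i aK bK; case: k => [|k] /=; first exact: (ih K i).
by apply: bounded_measurable_integrable; exact: (bounded_measurable_cst 0).
Qed.

Lemma mode_trace_integrable (u : nat -> broken T) k : inV P (u k) ->
  broken_bdry_integrable (A u k).
Proof.
move=> Vu K i aK bK; have [s uK] := inV_peval Vu aK.
rewrite (_ : EFin \o _ = ((EFin \o (fun t => u k K (M (edge_pt (vtx K) i t)))) \-
  (EFin \o (fun t => const_series uRD k (M (edge_pt (vtx K) i t)))))%E); last by [].
apply: integrableB => //; last exact: (const_series_integrable k iRD).
apply: bounded_measurable_integrable; rewrite uK.
exact: (bounded_measurable_continuous smO MO mM bK (@peval_continuous _ s)).
Qed.

Lemma mode_normal_integrable (u : nat -> broken T) k : inV P (u k) ->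
  broken_bdry_integrable (B u k).
Proof.
move=> Vu K i aK bK; have [s uK] := inV_peval Vu aK.
rewrite (_ : EFin \o _ = ((EFin \o (fun t => normal_deriv n (u k K) (M (edge_pt (vtx K) i t)))) \-
  (EFin \o (fun t => const_series qRN k (M (edge_pt (vtx K) i t)))))%E); last by [].
apply: integrableB => //; last exact: (const_series_integrable k iRN).
apply: bounded_measurable_integrable; rewrite uK /normal_deriv /dot /grad /=.
have [_ [s1 ->] [s2 ->]] := peval_derivatives s.
have [n1 n2] := bounded_measurable_normal smO MO mM bK.
apply: (@bounded_measurableD _
  (fun t => peval s1 (M (edge_pt (vtx K) i t)) * (n (M (edge_pt (vtx K) i t))).1)
  (fun t => peval s2 (M (edge_pt (vtx K) i t)) * (n (M (edge_pt (vtx K) i t))).2)).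
  apply: (@bounded_measurableM _ (fun t => peval s1 (M (edge_pt (vtx K) i t)))) => //.
  exact: (bounded_measurable_continuous smO MO mM bK (@peval_continuous _ s1)).
apply: (@bounded_measurableM _ (fun t => peval s2 (M (edge_pt (vtx K) i t)))) => //.
exact: (bounded_measurable_continuous smO MO mM bK (@peval_continuous _ s2)).
Qed.

(** The datum [uD] of order m + 1 is minus the derivative residual of order m; the case m = 0
    differs only by the presence of [qRN]. This offset of one order matches the offset between the
    two weights. *)
Lemma dirichlet_defectS u m : dirichlet_defect n M uRD qRN u m.+1 =
  fun K p => A u m.+1 K p + B u m K p.
Proof.
apply/funext => K; apply/funext => p; rewrite /dirichlet_defect /A /B /eval_at.
by case: m => [|m] /=; ring.
Qed.

Lemma neumann_defect0 u : neumann_defect n M uRD qRN u 0 = B u 0.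
Proof. by []. Qed.

Lemma neumann_defectS u m : neumann_defect n M uRD qRN u m.+1 =
  fun K p => B u m.+1 K p + A u m K p.
Proof.
apply/funext => K; apply/funext => p; rewrite /neumann_defect /A /B /eval_at.
by case: m => [|m] /=; ring.
Qed.

Lemma dirichlet_modes_problem (u : nat -> broken T) :
  dirichlet_modes P n M alpha gamma f uRD qRN u ->
  forall m v, inV P v -> dirichlet_mode_problem n M alpha gamma f uRD qRN u m v.
Proof.
move=> [Vu [c1 [c2 [q1 q2 Hm]]]] m v Vv.
have g0 : gamma != 0 by rewrite gt_eqF.
have denE : gamma%:P + 'X = gamma%:P + 1 *: 'X :> {poly R} by rewrite scale1r.
rewrite denE in q1 q2.
have c1E := fps_quotient_const g0 q1; have [c20 c2E] := fps_quotient_X g0 q2.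
have := Hm v Vv m; rewrite /method_coef -addrA.
rewrite (@fps_mul_shift _ c1 c2 _ _
  (fun l => opA gamma M (dirichlet_defect n M uRD qRN u l) v))//; first last.
- move=> k; rewrite dirichlet_defectS opAD//; [exact: mode_trace_integrable|].
  exact: mode_normal_integrable.
- by move=> k; rewrite c2E c1E.
(* The leading weight is 1, so the defect of order [m] stays on the left and those of lower order
   form the right-hand side. *)
rewrite big_ord_recr /= subnn c1E expr0 mulr1 divff// mul1r => /eqP.
rewrite [X in _ + X]addrC addrA addr_eq0 => /eqP e.
rewrite /dirichlet_mode_problem e; congr (- _); apply: eq_bigr => l _.
by rewrite c1E divff// mul1r -exprVn invrN mulN1r.
Qed.

Lemma neumann_modes_problem (u : nat -> broken T) :
  neumann_modes P n M alpha gamma f uRD qRN u ->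
  forall m v, inV P v -> neumann_mode_problem n M alpha gamma f uRD qRN u m v.
Proof.
move=> [Vu [c1 [c2 [q1 q2 Hm]]]] m v Vv.
have denE : 1 + gamma *: 'X = 1%:P + gamma *: 'X :> {poly R} by [].
rewrite denE in q1 q2.
have [c10 c1E] := fps_quotient_X (oner_neq0 R) q1.
have c2E := fps_quotient_const (oner_neq0 R) q2.
have iB k : broken_bdry_integrable (neumann_defect n M uRD qRN u k).
  case: k => [|k]; first by rewrite neumann_defect0; exact: mode_normal_integrable.
  rewrite neumann_defectS => K i aK bK.
  rewrite (_ : EFin \o _ = ((EFin \o (fun t => B u k.+1 K (edge_pt (vtx K) i t))) \+
    (EFin \o (fun t => A u k K (edge_pt (vtx K) i t))))%E); last by [].
  by apply: integrableD => //; [exact: mode_normal_integrable|exact: mode_trace_integrable].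
have := Hm v Vv m; rewrite /method_coef -addrA [X in _ + X]addrC.
rewrite (@fps_mul_shift _ c2 c1 _ _
  (fun l => opA gamma M (neumann_defect n M uRD qRN u l) v))//; first last.
- move=> k; rewrite neumann_defectS opAD//; last exact: mode_trace_integrable.
  exact: mode_normal_integrable.
- by move=> k; rewrite c2E c1E.
(* The weights have exchanged roles and the leading one is [gamma], the factor inside the penalty
   term. Multiplied by the minus sign of the right-hand side it supplies one more power of
   [- gamma]. *)
rewrite big_ord_recr /= subnn c2E expr0 mulr1 divr1 => /eqP.
rewrite [X in _ + X]addrC addrA addr_eq0 => /eqP e.
rewrite /neumann_mode_problem opAZ// e -sumrN; apply: eq_bigr => l _.
rewrite c2E !divr1 subSn; last exact: ltnW.
by rewrite exprS; ring.
Qed.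

End FormalModes.

(** * Exact modes *)

Section SimplexIntegral.
Variable R : realType.
Notation mu2 := (@lebesgue_measure R \x @lebesgue_measure R)%E.
Implicit Types (a : 'I_3 -> R * R) (g h : R * R -> R).

Definition simplex_int a h : R := \int[mu2]_(p in simplex a) h p.

Lemma simplex_int_ext a g h : (forall p, simplex a p -> g p = h p) ->
  simplex_int a g = simplex_int a h.
Proof. by move=> gh; apply: eq_Rintegral => p; rewrite inE => /gh. Qed.

Lemma simplex_integrable a h : tri_det a != 0 ->
  (forall p, simplex a p -> {for p, continuous h}) ->
  mu2.-integrable (simplex a) (EFin \o h).
Proof.
by move=> D0 ch; apply: continuous_integrable_plane => //; exact: simplex_compact.
Qed.

Lemma simplex_intZ a (c : R) h : tri_det a != 0 ->
  (forall p, simplex a p -> {for p, continuous h}) ->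
  simplex_int a (fun p => c * h p) = c * simplex_int a h.
Proof.
move=> D0 ch; rewrite /simplex_int RintegralZl//; first exact: simplex_measurable.
exact: simplex_integrable.
Qed.

Lemma simplex_intD a g h : tri_det a != 0 ->
  (forall p, simplex a p -> {for p, continuous g}) ->
  (forall p, simplex a p -> {for p, continuous h}) ->
  simplex_int a (fun p => g p + h p) = simplex_int a g + simplex_int a h.
Proof.
move=> D0 cg ch; rewrite /simplex_int RintegralD//; first exact: simplex_measurable.
  exact: simplex_integrable.
exact: simplex_integrable.
Qed.

Lemma continuous_scale (c : R) h p : {for p, continuous h} ->
  {for p, continuous (fun q => c * h q)}.
Proof. by move=> ch; apply: cvgM; [exact: cvg_cst|exact: ch]. Qed.

Lemma simplex_int_lin a (c d : R) g h : tri_det a != 0 ->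
  (forall p, simplex a p -> {for p, continuous g}) ->
  (forall p, simplex a p -> {for p, continuous h}) ->
  simplex_int a (fun p => c * g p + d * h p) =
  c * simplex_int a g + d * simplex_int a h.
Proof.
move=> D0 cg ch; rewrite simplex_intD//.
- by rewrite !simplex_intZ.
- by move=> p /cg; exact: continuous_scale.
- by move=> p /ch; exact: continuous_scale.
Qed.

Lemma intOE (T : mesh R) (g : broken T) :
  intO g = \sum_(K in active T) simplex_int (vtx K) (g K).
Proof. by []. Qed.

End SimplexIntegral.

Section AsymptoticPreserving.
Variables (R : realType) (T : mesh R) (P : nat).
Variables (Omega : set (R * R)) (n M : R * R -> R * R) (alpha gamma : R).
Variables (f uRD qRN : R * R -> R).
Notation mu := (@lebesgue_measure R).
Hypothesis MO : forall p, Gbar T p -> frontier Omega (M p).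

Lemma inV_match (v : broken T) : inV P v ->
  forall K L p, K \in active T -> L \in active T ->
    simplex (vtx K) p -> simplex (vtx L) p -> v K p = v L p.
Proof. by move=> [_ [h _ hv]] K L p aK aL Kp Lp; rewrite -(hv K)// -(hv L). Qed.

(** Green's formula replaces the flux by volume integrals, and what remains under the integral is
    the residual of the differential equation times [v]. *)
Lemma opI_flux_smooth (W : set (R * R)) (u g : R * R -> R) (v : broken T) :
  open W -> surrogate T `<=` W -> smooth_on W u ->
  (forall p, surrogate T p -> - laplacian u p + alpha * u p = g p) ->
  inV P v ->
  opI alpha (fun=> u) v - flux (fun=> u) v - ipO (fun=> g) v = 0.
Proof.
move=> oW SW su pde Vv.
have sv K : K \in active T -> smooth_on W (v K).
  by move=> aK; have [s ->] := inV_peval Vv aK; exact: peval_smooth.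
rewrite -(green_mesh oW SW su sv (inV_match Vv)) /opI /ip_grad /ipO !intOE.
rewrite mulr_sumr -big_split -!sumrB /= big1 // => K aK.
have DK := mesh_det K.
have KS : simplex (vtx K) `<=` surrogate T by move=> p Kp; exists K.
have KW : simplex (vtx K) `<=` W by move=> p /KS/SW.
have su1 := smooth_on_d1 su; have su2 := smooth_on_d2 su.
have [sv1 sv2] := (smooth_on_d1 (sv K aK), smooth_on_d2 (sv K aK)).
have cuv p : simplex (vtx K) p -> {for p, continuous (fun p => u p * v K p)}.
  move=> /KW Wp.
  by apply: cvgM; [exact: smooth_on_continuous Wp|exact: smooth_on_continuous (sv K aK) Wp].
have clv p : simplex (vtx K) p -> {for p, continuous (fun p => laplacian u p * v K p)}.
  move=> /KW Wp; apply: cvgM; last exact: smooth_on_continuous (sv K aK) Wp.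
  have cl : {for p, continuous (fun p => d1 (d1 u) p + d2 (d2 u) p)}.
    by apply: cvgD; [exact: smooth_on_continuous (smooth_on_d1 su1) Wp|
                     exact: smooth_on_continuous (smooth_on_d2 su2) Wp].
  exact: cl.
have cdg p : simplex (vtx K) p ->
    {for p, continuous (fun p => dot (grad u p) (grad (v K) p))}.
  move=> /KW Wp.
  have cd : {for p, continuous (fun p => d1 u p * d1 (v K) p + d2 u p * d2 (v K) p)}.
    apply: cvgD; apply: cvgM.
    - exact: smooth_on_continuous su1 Wp.
    - exact: smooth_on_continuous sv1 Wp.
    - exact: smooth_on_continuous su2 Wp.
    - exact: smooth_on_continuous sv2 Wp.
  exact: cd.
(* No continuity of [g] is assumed: on the triangle it is replaced by the other side of its
   equation, whose terms are continuous and can be integrated separately. *)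
have -> : simplex_int (vtx K) (fun p => g p * v K p) =
    -1 * simplex_int (vtx K) (fun p => laplacian u p * v K p) +
    alpha * simplex_int (vtx K) (fun p => u p * v K p).
  rewrite -simplex_int_lin//; apply: simplex_int_ext => p /KS Sp.
  by rewrite -(pde _ Sp); ring.
have -> : simplex_int (vtx K)
      (fun p => laplacian u p * v K p + dot (grad u p) (grad (v K) p)) =
    1 * simplex_int (vtx K) (fun p => laplacian u p * v K p) +
    1 * simplex_int (vtx K) (fun p => dot (grad u p) (grad (v K) p)).
  by rewrite -simplex_int_lin//; apply: simplex_int_ext => p _; rewrite !mul1r.
ring.
Qed.

Lemma opA_bdry0 (w v : broken T) :
  (forall K i p, K \in active T -> bedge K i -> Gbar T p -> w K p = 0) ->
  opA gamma M w v = 0.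
Proof.
move=> w0; rewrite /opA /intG big1// => K aK; rewrite big1// => i bK.
rewrite (_ : Rintegral _ _ _ = 0) ?mulr0//.
rewrite -[RHS](mul0r (fine (mu `[(0 : R), 1]))) -(Rintegral_cst mu) //.
apply: eq_Rintegral => t; rewrite inE /= in_itv /= => t01.
by rewrite (w0 K i) ?mul0r//; exact: bedge_Gbar.
Qed.

Lemma dirichlet_asymptotic_preserving :
  asymptotic_preserving_dirichlet T P Omega n M alpha gamma f uRD qRN.
Proof.
move=> u [[[W [oW SW su]] pde] bc] m v Vv; rewrite /dirichlet_mode_problem.
have d0 l : opA gamma M (dirichlet_defect (T := T) n M uRD qRN (fun k _ => u k) l) v = 0.
  apply: opA_bdry0 => K i p aK bK Gp; rewrite /dirichlet_defect /eval_at.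
  by rewrite [X in X - _](bc l)//; [rewrite subrr|exact: MO].
rewrite d0 addr0 big1 ?oppr0 => [|l _]; last by rewrite d0 mulr0.
apply: opI_flux_smooth oW _ (su m) _ Vv.
  by move=> p Sp; apply: SW; right.
by move=> p Sp; apply: pde; right.
Qed.

Lemma neumann_asymptotic_preserving :
  asymptotic_preserving_neumann T P Omega n M alpha gamma f uRD qRN.
Proof.
move=> u [[[W [oW SW su]] pde] bc] m v Vv; rewrite /neumann_mode_problem.
have d0 l p : Gbar T p -> forall K : elt T,
    neumann_defect (T := T) n M uRD qRN (fun k _ => u k) l K p = 0.
  move=> Gp K; rewrite /neumann_defect /eval_at.
  by rewrite [X in X - _](bc l)//; [rewrite subrr|exact: MO].
rewrite (opA_bdry0 (w := fun K p => gamma * _ K p)); last first.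
  by move=> K i p aK bK Gp; rewrite d0// mulr0.
rewrite addr0 big1 => [|l _]; last first.
  by rewrite opA_bdry0 ?mulr0// => K i p aK bK Gp; rewrite d0.
apply: opI_flux_smooth oW _ (su m) _ Vv.
  by move=> p Sp; apply: SW; right.
by move=> p Sp; apply: pde; right.
Qed.

End AsymptoticPreserving.

(** * Coercivity *)

Section Vanishing.
Variable R : realType.
Notation mu := (@lebesgue_measure R).
Notation mu2 := (mu \x mu)%E.

Lemma Rintegral_eq0_ae (d : measure_display) (X : measurableType d)
    (m : {measure set X -> \bar R}) (D : set X) (k : X -> R) :
  measurable D -> m.-integrable D (EFin \o k) ->
  (forall x, D x -> 0 <= k x) -> \int[m]_(x in D) k x = 0 ->
  ae_eq m D (EFin \o k) (cst 0%E).
Proof.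
move=> mD ik k0 Ik; apply/ae_eq_integral_abs => //; first exact: measurable_int ik.
rewrite (@eq_integral _ _ _ m D (EFin \o k)); last first.
  by move=> x; rewrite inE => Dx /=; rewrite ger0_norm// k0.
by rewrite -(fineK (integrable_fin_num mD ik)) [fine _]Ik.
Qed.

(** Takes the place of Cauchy-Schwarz: the points where [h] is nonzero lie in the null set where [k]
    is nonzero, so no inequality between the two integrands is needed. *)
Lemma Rintegral_vanishing (d : measure_display) (X : measurableType d)
    (m : {measure set X -> \bar R}) (D : set X) (k h : X -> R) :
  measurable D -> m.-integrable D (EFin \o k) -> m.-integrable D (EFin \o h) ->
  (forall x, D x -> 0 <= k x) -> \int[m]_(x in D) k x = 0 ->
  (forall x, D x -> k x = 0 -> h x = 0) -> \int[m]_(x in D) h x = 0.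
Proof.
move=> mD ik ih k0 Ik kh; have aek := Rintegral_eq0_ae mD ik k0 Ik.
rewrite /Rintegral (@ae_eq_integral _ _ _ m D (cst 0%E))//.
- by rewrite integral0.
- exact: measurable_int ih.
- have [N [mN N0 DN]] := aek; exists N; split => //.
  move=> x /= H; apply: DN => /= kx; apply: H => Dx /=.
  by rewrite (kh x Dx)//; have /= [] := kx Dx.
Qed.

Lemma negligible_no_interior (A U : set (R * R)) (p : R * R) :
  mu2.-negligible A -> open U -> U `<=` A -> ~ U p.
Proof.
move=> [N [mN N0 AN]] oU UA Up.
have /nbhs_ballP[e /= e0 eU] : nbhs p U by exact: open_nbhs_nbhs.
pose B : set (R * R) := `[p.1, p.1 + e / 2]%classic `*` `[p.2, p.2 + e / 2]%classic.
have BN : B `<=` N.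
  move=> q [] /=; rewrite !in_itv /= => /andP[q1 q1'] /andP[q2 q2'].
  apply/AN/UA/eU; split; rewrite /ball /= ltr_norml; lra.
have : (mu2 B <= mu2 N)%E by apply: le_measure; rewrite ?inE //; exact: measurableX.
rewrite N0 product_measure1E//= !lebesgue_measure_itv /= !lte_fin.
have e2 : 0 < e / 2 by lra.
rewrite !ltrDl e2 -!EFinD -EFinM lee_fin leNgt => /negP; apply.
by rewrite mulr_gt0//; lra.
Qed.

Lemma simplex_square_eq0 (a : 'I_3 -> R * R) (f : R * R -> R) : tri_det a != 0 ->
  continuous f -> simplex_int a (fun p => f p * f p) = 0 ->
  forall p, (forall i, 0 < bary a i p) -> f p = 0.
Proof.
move=> D0 cf I0 p bp; apply: contrapT => /eqP fp.
have cff : continuous (fun p => f p * f p) by move=> q; apply: cvgM; exact: cf.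
have iff_ : mu2.-integrable (simplex a) (EFin \o (fun p => f p * f p)).
  by apply: simplex_integrable => // q _; exact: cff.
have aek : ae_eq mu2 (simplex a) (EFin \o (fun p => f p * f p)) (cst 0%E).
  apply: Rintegral_eq0_ae => //; first exact: simplex_measurable.
  by move=> q _; rewrite -expr2 sqr_ge0.
pose U : set (R * R) := ([set q | 0 < bary a 0 q] `&` [set q | 0 < bary a 1 q]) `&`
  [set q | 0 < bary a 2%:R q] `&` [set q | f q != 0].
have oB i : open [set q | 0 < bary a i q].
  apply: (@open_comp _ _ (bary a i) [set x : R | 0 < x]); last exact: open_gt.
  by move=> q _; exact: continuous_bary.
apply: (@negligible_no_interior _ U p aek).
- apply: openI; first by apply: openI; first exact: openI.
  apply: (@open_comp _ _ f [set x : R | x != 0]); last exact: open_neq.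
  by move=> q _; exact: cf.
- move=> q [[[b0 b1] b2] /= fq] /= H.
  have Sq : simplex a q.
    apply/simplexP => //; apply: (@ord3_ind 0); rewrite ?add0r; exact: ltW.
  by have [/eqP] := H Sq; rewrite mulf_eq0 orbb (negPf fq).
- split; last exact: fp.
  by split; [split; exact: bp|exact: (bp 2%:R)].
Qed.

Lemma poly_vanishing (s : {poly R}) (x0 e : R) : 0 < e ->
  (forall x, x0 < x < x0 + e -> s.[x] = 0) -> s = 0.
Proof.
move=> e0 s0; apply: contrapT => /eqP sn0.
(* As many distinct roots as the size of [s], which is one more than its degree; the offset 2 keeps
   them strictly inside the interval. *)
pose rs := [seq x0 + e / (k.+2)%:R | k <- iota 0 (size s)].
have : (size rs < size s)%N.
  apply: max_poly_roots => //.
    apply/allP => _ /mapP[k _ ->]; rewrite /root s0//.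
    rewrite ltrDl divr_gt0// ?ltr0n// ltrD2l ltr_pdivrMr ?ltr0n//.
    by rewrite ltr_pMr// ltr1n.
  rewrite map_inj_in_uniq ?iota_uniq// => j k _ _ /addrI.
  move/(mulfI (lt0r_neq0 e0))/invr_inj/eqP; rewrite eqr_nat => /eqP [].
  by [].
by rewrite size_map size_iota ltnn.
Qed.

End Vanishing.

(** * Bounds for polynomials and integrals of finite sums *)

Section PolynomialBounds.
Variable R : realType.

Lemma poly2_vanishing (s : {poly {poly R}}) (U : set (R * R)) (p : R * R) :
  open U -> U p -> (forall q, U q -> peval s q = 0) -> s = 0.
Proof.
move=> oU Up s0; have /nbhs_ballP[e /= e0 eU] : nbhs p U by exact: open_nbhs_nbhs.
have inU x y : p.1 < x < p.1 + e -> p.2 < y < p.2 + e -> U (x, y).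
  by move=> /andP[x1 x2] /andP[y1 y2]; apply: eU; split; rewrite /ball /= ltr_norml; lra.
have sy y : p.2 < y < p.2 + e -> s.[y%:P] = 0.
  move=> hy; apply: (@poly_vanishing _ _ p.1 e e0) => x hx.
  exact: (s0 (x, y) (inU _ _ hx hy)).
apply/polyP => i; apply/polyP => j; rewrite !coef0.
(* For fixed [j], the coefficients of x^j form a polynomial in y, which also vanishes on an
   interval. *)
have : \poly_(i < size s) (s`_i)`_j = 0.
  apply: (@poly_vanishing _ _ p.2 e e0) => y /sy; rewrite horner_coef => h0.
  have := congr1 (fun q : {poly R} => q`_j) h0.
  rewrite coef0 coef_sum => h; rewrite horner_poly -[RHS]h.
  by apply: eq_bigr => k _; rewrite -polyC_exp coefMC.
move=> h0; have := congr1 (fun q : {poly R} => q`_i) h0; rewrite coef_poly coef0.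
by case: ltnP => // le _; rewrite [s`_i]nth_default// coef0.
Qed.

(** The bound and the Lipschitz estimate are proved together, with one constant, because the
    estimate for a product uses the bounds of both factors. *)
Lemma peval_lipschitz (s : {poly {poly R}}) (m : R) : exists2 C : R, 0 <= C &
  forall p q : R * R, `|p.1| <= m -> `|p.2| <= m -> `|q.1| <= m -> `|q.2| <= m ->
    `|peval s p| <= C /\ `|peval s q - peval s p| <= C * (`|q.1 - p.1| + `|q.2 - p.2|).
Proof.
apply: (@poly2_ind _ (fun h => exists2 C : R, 0 <= C &
  forall p q : R * R, `|p.1| <= m -> `|p.2| <= m -> `|q.1| <= m -> `|q.2| <= m ->
    `|h p| <= C /\ `|h q - h p| <= C * (`|q.1 - p.1| + `|q.2 - p.2|))) => {s}.
- move=> c; exists `|c| => // p q _ _ _ _ /=; split=> //.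
  by rewrite subrr normr0 mulr_ge0// addr_ge0.
(* This constant bounds the coordinate by its first term and its Lipschitz constant by its
   second. *)
- exists (`|m| + 1); first by rewrite addr_ge0.
  move=> p q p1 _ _ _; split; first by rewrite (le_trans p1)// (le_trans (ler_norm m))// lerDl.
  by have h1 := normr_ge0 (q.1 - p.1); have h2 := normr_ge0 (q.2 - p.2);
     have h3 := normr_ge0 m; nra.
- exists (`|m| + 1); first by rewrite addr_ge0.
  move=> p q _ p2 _ _; split; first by rewrite (le_trans p2)// (le_trans (ler_norm m))// lerDl.
  by have h1 := normr_ge0 (q.1 - p.1); have h2 := normr_ge0 (q.2 - p.2);
     have h3 := normr_ge0 m; nra.
- move=> s t [C C0 sC] [D D0 tD]; exists (C + D); first exact: addr_ge0.
  move=> p q p1 p2 q1 q2; have [s1 s2] := sC p q p1 p2 q1 q2.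
  have [t1 t2] := tD p q p1 p2 q1 q2; split => /=.
    by apply: le_trans (ler_normD _ _) _; rewrite lerD.
  by rewrite opprD addrACA mulrDl; apply: le_trans (ler_normD _ _) _; rewrite lerD.
- move=> s t [C C0 sC] [D D0 tD]; exists (C * D + C * D + C * D); first by rewrite !addr_ge0 ?mulr_ge0.
  move=> p q p1 p2 q1 q2; have [s1 s2] := sC p q p1 p2 q1 q2.
  have [t1 t2] := tD p q p1 p2 q1 q2; have [s3 _] := sC q p q1 q2 p1 p2.
  have CD := mulr_ge0 C0 D0.
  split => /=.
    by rewrite normrM (le_trans (ler_pM _ _ s1 t1))//; lra.
  set L := `|q.1 - p.1| + `|q.2 - p.2| in s2 t2 *.
  have -> : peval s q * peval t q - peval s p * peval t p =
    peval s q * (peval t q - peval t p) + (peval s q - peval s p) * peval t p by ring.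
  apply: le_trans (ler_normD _ _) _; rewrite !normrM.
  have L0 : 0 <= L by rewrite addr_ge0.
  have h1 := ler_pM (normr_ge0 _) (normr_ge0 _) s3 t2.
  have h2 := ler_pM (normr_ge0 _) (normr_ge0 _) s2 t1.
  have h3 := mulr_ge0 CD L0.
  by apply: le_trans (lerD h1 h2) _; lra.
Qed.

Lemma d12_sum (I : finType) (c : I -> R) (g : I -> R * R -> R) p :
  (forall x, differentiable (g x) p) ->
  [/\ differentiable (fun q => \sum_x c x * g x q) p,
      d1 (fun q => \sum_x c x * g x q) p = \sum_x c x * d1 (g x) p &
      d2 (fun q => \sum_x c x * g x q) p = \sum_x c x * d2 (g x) p].
Proof.
move=> dg; elim: (index_enum I) => [|x r [dr r1 r2]].
  have -> : (fun q => \sum_(x <- [::]) c x * g x q) = cst 0.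
    by apply/funext => q; rewrite big_nil.
  by rewrite d1_cst d2_cst !big_nil; split=> //; exact: differentiable_cst.
have dc y : differentiable (cst (c y) : R * R -> R) p by exact: differentiable_cst.
have dx : differentiable (cst (c x) \* g x) p by apply: differentiableM.
have -> : (fun q => \sum_(x <- x :: r) c x * g x q) =
    (cst (c x) \* g x) \+ (fun q => \sum_(x <- r) c x * g x q).
  by apply/funext => q; rewrite big_cons.
rewrite !big_cons; split; first exact: differentiableD.
- by rewrite (d1D dx dr) r1 (d1M (dc x) (dg x)) d1_cst mulr0 addr0.
- by rewrite (d2D dx dr) r2 (d2M (dc x) (dg x)) d2_cst mulr0 addr0.
Qed.

Lemma continuous_finsum (V : topologicalType) (I : finType) (g : I -> V -> R) (v : V) :
  (forall x, {for v, continuous (g x)}) -> {for v, continuous (fun w => \sum_x g x w)}.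
Proof.
move=> cg; elim: (index_enum I) => [|x r IH].
  rewrite (_ : (fun w => _) = cst 0); first exact: cvg_cst.
  by apply/funext => w; rewrite big_nil.
rewrite (_ : (fun w => _) = (fun w => g x w + \sum_(x <- r) g x w)).
  by apply: cvgD; [exact: cg|exact: IH].
by apply/funext => w; rewrite big_cons.
Qed.

Variable T : mesh R.
Notation mu := (@lebesgue_measure R).

Lemma simplex_int_sum (a : 'I_3 -> R * R) (I : finType) (d : I -> R)
    (g : I -> R * R -> R) : tri_det a != 0 -> (forall x, continuous (g x)) ->
  simplex_int a (fun p => \sum_x d x * g x p) = \sum_x d x * simplex_int a (g x).
Proof.
move=> D0 cg.
(* Continuity of the partial sums is carried through the induction, since additivity of the integral
   requires integrable terms. *)
suff [_ //] : continuous (fun p => \sum_x d x * g x p) /\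
  simplex_int a (fun p => \sum_x d x * g x p) = \sum_x d x * simplex_int a (g x).
elim: (index_enum I) => [|x r [cr IH]].
  split.
    move=> p; rewrite (_ : (fun w => _) = cst 0); first exact: cvg_cst.
    by apply/funext => w; rewrite big_nil.
  rewrite big_nil (_ : (fun p => _) = (fun p : R * R => 0 * 0)); last first.
    by apply/funext => p; rewrite big_nil mul0r.
  rewrite (@simplex_intZ _ a 0 (cst 0) D0) ?mul0r// => p _; exact: cvg_cst.
have cx : continuous (fun p => d x * g x p).
  by move=> p; apply: continuous_scale; exact: cg.
have -> : (fun p => \sum_(x <- x :: r) d x * g x p) =
    (fun p => d x * g x p + \sum_(x <- r) d x * g x p).
  by apply/funext => p; rewrite big_cons.
split; first by move=> p; apply: cvgD; [exact: cx|exact: cr].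
rewrite big_cons simplex_intD// ?IH => [|p _|p _]; [|exact: cx|exact: cr].
by rewrite simplex_intZ// => p _; exact: cg.
Qed.

Lemma intO_sum (I : finType) (d : I -> R) (g : I -> broken T) :
  (forall x K, continuous (g x K)) ->
  intO (fun K p => \sum_x d x * g x K p) = \sum_x d x * intO (g x).
Proof.
move=> cg; rewrite intOE.
under eq_bigr => K aK do rewrite simplex_int_sum ?mesh_det//.
rewrite exchange_big /=; apply: eq_bigr => x _.
by rewrite intOE mulr_sumr.
Qed.

Definition edge_int (a : 'I_3 -> R * R) (i : 'I_3) (h : R * R -> R) : R :=
  \int[mu]_(t in `[0, 1]) h (edge_pt a i t).

Lemma edge_integrable (a : 'I_3 -> R * R) i (h : R * R -> R) : continuous h ->
  mu.-integrable `[0, 1] (EFin \o (fun t => h (edge_pt a i t))).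
Proof.
move=> ch; apply: continuous_edge_integrable => t _.
by apply: continuous_comp; [exact: continuous_edge_pt|exact: ch].
Qed.

Lemma edge_intZ (a : 'I_3 -> R * R) i (c : R) h : continuous h ->
  edge_int a i (fun p => c * h p) = c * edge_int a i h.
Proof. by move=> ch; rewrite /edge_int RintegralZl//; exact: edge_integrable. Qed.

Lemma edge_intD (a : 'I_3 -> R * R) i g h : continuous g -> continuous h ->
  edge_int a i (fun p => g p + h p) = edge_int a i g + edge_int a i h.
Proof.
by move=> cg ch; rewrite /edge_int RintegralD//; exact: edge_integrable.
Qed.

Lemma edge_int_sum (a : 'I_3 -> R * R) (i : 'I_3) (I : finType) (d : I -> R)
    (g : I -> R * R -> R) : (forall x, continuous (g x)) ->
  edge_int a i (fun p => \sum_x d x * g x p) = \sum_x d x * edge_int a i (g x).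
Proof.
move=> cg.
suff [_ //] : continuous (fun p => \sum_x d x * g x p) /\
  edge_int a i (fun p => \sum_x d x * g x p) = \sum_x d x * edge_int a i (g x).
elim: (index_enum I) => [|x r [cr IH]].
  split.
    move=> p; rewrite (_ : (fun w => _) = cst 0); first exact: cvg_cst.
    by apply/funext => w; rewrite big_nil.
  rewrite big_nil (_ : (fun p => _) = (fun p : R * R => 0 * 0)); last first.
    by apply/funext => p; rewrite big_nil mul0r.
  rewrite (@edge_intZ a i 0 (cst 0)) ?mul0r// => p; exact: cvg_cst.
have cx : continuous (fun p => d x * g x p).
  by move=> p; apply: continuous_scale; exact: cg.
have -> : (fun p => \sum_(x <- x :: r) d x * g x p) =
    (fun p => d x * g x p + \sum_(x <- r) d x * g x p).
  by apply/funext => p; rewrite big_cons.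
split; first by move=> p; apply: cvgD; [exact: cx|exact: cr].
rewrite big_cons edge_intD// ?IH; congr (_ + _).
by rewrite edge_intZ//; exact: cg.
Qed.

Lemma intGE (g : elt T -> 'I_3 -> R * R -> R) :
  intG g = \sum_(K in active T) \sum_(i < 3 | bedge K i)
    enorm (vtx K (i + 1) - vtx K i) * edge_int (vtx K) i (g K i).
Proof. by []. Qed.

Lemma intG_sum (I : finType) (d : I -> R) (g : I -> elt T -> 'I_3 -> R * R -> R) :
  (forall x K i, continuous (g x K i)) ->
  intG (fun K i p => \sum_x d x * g x K i p) = \sum_x d x * intG (g x).
Proof.
move=> cg; rewrite intGE.
transitivity (\sum_(K in active T) \sum_(i < 3 | bedge K i) \sum_x
    d x * (enorm (vtx K (i + 1) - vtx K i) * edge_int (vtx K) i (g x K i))).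
  apply: eq_bigr => K _; apply: eq_bigr => i _; rewrite edge_int_sum// mulr_sumr.
  by apply: eq_bigr => x _; rewrite mulrCA.
under eq_bigr do rewrite exchange_big /=.
rewrite exchange_big /=; apply: eq_bigr => x _; rewrite intGE mulr_sumr.
by apply: eq_bigr => K _; rewrite mulr_sumr.
Qed.

End PolynomialBounds.

(** * Quadratic forms in the coefficients of broken polynomials *)

Section Coefficients.
Variables (R : realType) (T : mesh R) (P : nat).

(** A triangle, an exponent of the second coordinate and an exponent of the first. The square of
    exponents contains all monomials of total degree at most [P] and is easier to index; inactive
    triangles carry coefficients too. *)
Definition coef_idx : finType := (elt T * 'I_P.+1 * 'I_P.+1)%type.
Implicit Types (x y : coef_idx) (c : 'rV[R]_#|coef_idx|) (z : coef_idx * coef_idx).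

Definition coef c x : R := c 0 (enum_rank x).

Definition basis x : broken T :=
  fun K p => if x.1.1 == K then p.1 ^+ x.2 * p.2 ^+ x.1.2 else 0.

Definition of_coef c : broken T := fun K p => \sum_x coef c x * basis x K p.

Definition coef_poly2 c K : {poly {poly R}} :=
  \poly_(i < P.+1) \poly_(j < P.+1) coef c (K, inord i, inord j).

Lemma basis_peval x K : exists s, basis x K = peval s.
Proof.
have [->|xK] := eqVneq K x.1.1; last first.
  exists 0; apply/funext => p; rewrite /basis eq_sym (negPf xK).
  by rewrite /peval !horner0.
exists (('X ^+ x.2)%:P * 'X ^+ x.1.2); apply/funext => p.
by rewrite /basis eqxx pevalM /peval !hornerE.
Qed.

Lemma of_coef_peval c K : of_coef c K = peval (coef_poly2 c K).
Proof.
apply/funext => p; rewrite /peval /coef_poly2 horner_poly horner_sum /of_coef.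
transitivity (\sum_k \sum_i \sum_j coef c (k, i, j) * basis (k, i, j) K p).
  by rewrite pair_bigA pair_bigA; apply: eq_bigr => -[[k i] j] _.
rewrite (bigD1 K)//= [X in _ + X]big1 ?addr0 => [|k kK]; last first.
  apply: big1 => i _; apply: big1 => j _.
  by rewrite /basis /= (negPf kK) mulr0.
apply: eq_bigr => i _; rewrite hornerM horner_poly -polyC_exp hornerC mulr_suml.
apply: eq_bigr => j _; rewrite /basis /= eqxx mulrA !inord_val.
by [].
Qed.

Lemma of_coef0 c K : coef_poly2 c K = 0 -> forall i j, coef c (K, i, j) = 0.
Proof.
move=> c0 i j; have := congr1 (fun s : {poly {poly R}} => (s`_i)`_j) c0.
by rewrite /coef_poly2 coef_poly ltn_ord coef_poly ltn_ord !coef0 !inord_val.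
Qed.

Lemma inV_of_coef (w : broken T) : inV P w -> exists c,
  (forall K, K \in active T -> of_coef c K = w K) /\
  (forall x, x.1.1 \notin active T -> coef c x = 0).
Proof.
move=> [wP _].
have /choice[s sP] : forall K, exists s : {poly {poly R}},
    K \in active T -> degree_le P s /\ w K = peval s.
  by move=> K; have [/wP[s ds ws]|_] := boolP (K \in active T); [exists s|exists 0].
pose cf x : R := if x.1.1 \in active T then ((s x.1.1)`_x.1.2)`_x.2 else 0.
pose c : 'rV[R]_#|coef_idx| := \row_k cf (enum_val k).
have cE x : coef c x = cf x by rewrite /coef mxE enum_rankK.
exists c; split=> [K aK|x xa]; last by rewrite cE /cf (negPf xa).
have [dK ->] := sP K aK; rewrite of_coef_peval; congr peval.
apply/polyP => i; apply/polyP => j; rewrite /coef_poly2 coef_poly.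
case: ltnP => iP; last first.
  rewrite coef0; apply/esym/eqP; apply: contraTT (iP) => /dK.
  by rewrite -ltnNge ltnS; apply: leq_trans; exact: leq_addr.
rewrite coef_poly; case: ltnP => jP; last first.
  apply/esym/eqP; apply: contraTT (jP) => /dK.
  by rewrite -ltnNge ltnS; apply: leq_trans; exact: leq_addl.
by rewrite cE /cf /= aK !inordK.
Qed.

Definition qform (q : coef_idx * coef_idx -> R) c : R :=
  \sum_z coef c z.1 * coef c z.2 * q z.

Lemma sum_mul_pair (f g : coef_idx -> R) :
  (\sum_x f x) * (\sum_x g x) = \sum_z f z.1 * g z.2.
Proof. by rewrite big_distrlr pair_bigA. Qed.

Lemma basis_differentiable x K p : differentiable (basis x K) p.
Proof. by have [s ->] := basis_peval x K; exact: peval_differentiable. Qed.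

Lemma basis_continuous x K : continuous (basis x K).
Proof. by have [s ->] := basis_peval x K; exact: peval_continuous. Qed.

Lemma basis_d1_continuous x K : continuous (d1 (basis x K)).
Proof.
have [s ->] := basis_peval x K; have [_ [t ->] _] := peval_derivatives s.
exact: peval_continuous.
Qed.

Lemma basis_d2_continuous x K : continuous (d2 (basis x K)).
Proof.
have [s ->] := basis_peval x K; have [_ _ [t ->]] := peval_derivatives s.
exact: peval_continuous.
Qed.

Lemma of_coef_d1 c K p : d1 (of_coef c K) p = \sum_x coef c x * d1 (basis x K) p.
Proof.
by have [_ + _] := @d12_sum R coef_idx (coef c) (basis^~ K) p (fun x => basis_differentiable x K p).
Qed.

Lemma of_coef_d2 c K p : d2 (of_coef c K) p = \sum_x coef c x * d2 (basis x K) p.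
Proof.
by have [_ _ +] := @d12_sum R coef_idx (coef c) (basis^~ K) p (fun x => basis_differentiable x K p).
Qed.

Definition mass_form z := ipO (basis z.1) (basis z.2).
Definition grad_form z := ip_grad (basis z.1) (basis z.2).
Definition flux_form z := flux (basis z.1) (basis z.2).
Definition bdry_form z := intG (fun K _ p => basis z.1 K p * basis z.2 K p).

Lemma mass_formE c : ipO (of_coef c) (of_coef c) = qform mass_form c.
Proof.
rewrite /qform /mass_form /ipO -intO_sum; last first.
  by move=> z K p; apply: cvgM; exact: basis_continuous.
congr intO; apply/funext => K; apply/funext => p.
by rewrite /of_coef sum_mul_pair; apply: eq_bigr => z _; rewrite mulrACA.
Qed.

Lemma grad_formE c : ip_grad (of_coef c) (of_coef c) = qform grad_form c.
Proof.
rewrite /qform /grad_form /ip_grad -intO_sum; last first.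
  move=> z K p; have k : {for p, continuous (fun p =>
      d1 (basis z.1 K) p * d1 (basis z.2 K) p + d2 (basis z.1 K) p * d2 (basis z.2 K) p)}.
    apply: cvgD; apply: cvgM.
    - exact: (@basis_d1_continuous z.1 K p).
    - exact: (@basis_d1_continuous z.2 K p).
    - exact: (@basis_d2_continuous z.1 K p).
    - exact: (@basis_d2_continuous z.2 K p).
  exact: k.
congr intO; apply/funext => K; apply/funext => p.
rewrite /dot /grad /= !of_coef_d1 !of_coef_d2 !sum_mul_pair -big_split.
by apply: eq_bigr => z _ /=; ring.
Qed.

Lemma flux_formE c : flux (of_coef c) (of_coef c) = qform flux_form c.
Proof.
rewrite /qform /flux_form /flux -intG_sum; last first.
  move=> z K i p; have k : {for p, continuous (fun p =>
      (d1 (basis z.1 K) p * (edge_normal (vtx K) i).1 +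
       d2 (basis z.1 K) p * (edge_normal (vtx K) i).2) * basis z.2 K p)}.
    apply: cvgM; last exact: (@basis_continuous z.2 K p).
    apply: cvgD; (apply: cvgM; last exact: cvg_cst).
      exact: (@basis_d1_continuous z.1 K p).
    exact: (@basis_d2_continuous z.1 K p).
  exact: k.
congr intG; apply/funext => K; apply/funext => i; apply/funext => p.
rewrite /dot /grad /= of_coef_d1 of_coef_d2 !mulr_suml -big_split /=.
rewrite /of_coef sum_mul_pair.
by apply: eq_bigr => z _ /=; ring.
Qed.

Lemma bdry_formE c :
  intG (fun K _ p => of_coef c K p * of_coef c K p) = qform bdry_form c.
Proof.
rewrite /qform /bdry_form -intG_sum; last first.
  by move=> z K _ p; apply: cvgM; exact: basis_continuous.
congr intG; apply/funext => K; apply/funext => i; apply/funext => p.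
by rewrite /of_coef sum_mul_pair; apply: eq_bigr => z _; rewrite mulrACA.
Qed.

Lemma coef_continuous x : continuous (coef^~ x).
Proof. by move=> c; exact: coord_continuous. Qed.

Lemma qform_continuous q : continuous (qform q).
Proof.
move=> c; apply: (@continuous_finsum R 'rV[R]_#|coef_idx| _
  (fun z c => coef c z.1 * coef c z.2 * q z)) => z.
apply: continuousM; last exact: cst_continuous.
by apply: continuousM; exact: coef_continuous.
Qed.

Lemma coef_le_norm c x : `|coef c x| <= `|c|.
Proof.
rewrite [leRHS]mx_normrE.
exact: (le_bigmax _ (fun ij : 'I_1 * 'I_#|coef_idx| => `|c ij.1 ij.2|) (0, enum_rank x)).
Qed.

Lemma qform_bound q c : `|qform q c| <= (\sum_z `|q z|) * `|c| ^+ 2.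
Proof.
apply: le_trans (ler_norm_sum _ _ _) _; rewrite mulr_suml; apply: ler_sum => z _.
rewrite normrM mulrC ler_wpM2l// normrM expr2 ler_pM ?coef_le_norm//.
Qed.

Lemma coefZ k c x : coef (k *: c) x = k * coef c x.
Proof. by rewrite /coef mxE. Qed.

Lemma qformZ q k c : qform q (k *: c) = k ^+ 2 * qform q c.
Proof.
by rewrite /qform mulr_sumr; apply: eq_bigr => z _; rewrite !coefZ; ring.
Qed.

Lemma of_coefZ k c K p : of_coef (k *: c) K p = k * of_coef c K p.
Proof.
by rewrite /of_coef mulr_sumr; apply: eq_bigr => x _; rewrite coefZ mulrA.
Qed.

End Coefficients.

(** * Definiteness of the gradient and boundary forms *)

Section Definite.
Variables (R : realType) (T : mesh R) (P : nat).
Notation coef_idx := (coef_idx T P).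
Implicit Types (c : 'rV[R]_#|coef_idx|).

(** Both clauses survive scaling and limits, as the compactness argument requires. The total degree
    is not restricted to [P], so the space is larger than that of the method. The second clause
    removes coefficients that no integral over active triangles sees and that would spoil
    definiteness. *)
Definition conforming c : Prop :=
  (forall K L p, K \in active T -> L \in active T ->
    simplex (vtx K) p -> simplex (vtx L) p -> of_coef c K p = of_coef c L p) /\
  (forall x, x.1.1 \notin active T -> coef c x = 0).

Lemma edge_int_ge0 (a : 'I_3 -> R * R) i (h : R * R -> R) :
  (forall p, 0 <= h p) -> 0 <= edge_int a i h.
Proof. by move=> h0; apply: Rintegral_ge0 => t _. Qed.

Lemma simplex_int_ge0 (a : 'I_3 -> R * R) (h : R * R -> R) :
  (forall p, 0 <= h p) -> 0 <= simplex_int a h.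
Proof. by move=> h0; apply: Rintegral_ge0 => t _. Qed.

Lemma intO_eq0 (g : broken T) : (forall K p, 0 <= g K p) -> intO g = 0 ->
  forall K, K \in active T -> simplex_int (vtx K) (g K) = 0.
Proof.
move=> g0; rewrite intOE => /eqP; rewrite psumr_eq0 => [/allP H K aK|K aK]; last first.
  exact: simplex_int_ge0.
by apply/eqP; have := H K (mem_index_enum K); rewrite aK.
Qed.

Lemma intG_eq0 (g : broken T) : (forall K p, 0 <= g K p) ->
  intG (fun K _ => g K) = 0 ->
  forall K i, K \in active T -> bedge K i -> edge_int (vtx K) i (g K) = 0.
Proof.
move=> g0; rewrite intGE => /eqP.
have e0 K i : 0 <= enorm (vtx K (i + 1) - vtx K i) * edge_int (vtx K) i (g K).
  by rewrite mulr_ge0 ?sqrtr_ge0// edge_int_ge0.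
rewrite psumr_eq0 => [/allP H K i aK bK|K aK]; last by apply: sumr_ge0.
have := H K (mem_index_enum K); rewrite aK /= psumr_eq0// => /allP /(_ i (mem_index_enum i)).
rewrite bK /= mulf_eq0 => /orP[/eqP E|/eqP//].
by have := enorm_edge_gt0 i (mesh_det K); rewrite E ltxx.
Qed.

Lemma edge_int_vanishing (a : 'I_3 -> R * R) i (k h : R * R -> R) :
  continuous k -> continuous h -> (forall p, 0 <= k p) -> edge_int a i k = 0 ->
  (forall p, k p = 0 -> h p = 0) -> edge_int a i h = 0.
Proof.
move=> ck ch k0 Ik kh.
refine (Rintegral_vanishing _ (edge_integrable a i ck) (edge_integrable a i ch) _ Ik _) => //.
by move=> t _; exact: kh.
Qed.

Lemma simplex_int_vanishing (a : 'I_3 -> R * R) (k h : R * R -> R) :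
  tri_det a != 0 ->
  continuous k -> continuous h -> (forall p, 0 <= k p) -> simplex_int a k = 0 ->
  (forall p, k p = 0 -> h p = 0) -> simplex_int a h = 0.
Proof.
move=> D0 ck ch k0 Ik kh.
refine (Rintegral_vanishing _
  (simplex_integrable D0 (fun p _ => ck p)) (simplex_integrable D0 (fun p _ => ch p)) _ Ik _) => //.
  exact: simplex_measurable.
by move=> p _; exact: kh.
Qed.

Lemma half_square_derivatives :
  let u : R * R -> R := cst 2^-1 \* ((fun p => p.1) \* (fun p => p.1)) in
  [/\ smooth_on setT u, d1 u = (fun p => p.1) & d2 u = cst 0].
Proof.
move=> u.
have df p := @differentiable_fst R p.
have dff p : differentiable ((fun p : R * R => p.1) \* (fun p => p.1)) p.
  by apply: differentiableM.
have dc p : differentiable (cst 2^-1 : R * R -> R) p by exact: differentiable_cst.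
split.
- have -> : u = peval ((2^-1)%:P%:P * ('X%:P * 'X%:P)).
    by apply/funext => p; rewrite !pevalM peval_const !peval_fst.
  exact: peval_smooth.
- apply/funext => p; rewrite (d1M (dc p) (dff p)) (d1M (df p) (df p)) d1_fst d1_cst /=.
  by field.
- apply/funext => p; rewrite (d2M (dc p) (dff p)) (d2M (df p) (df p)) d2_fst d2_cst /=.
  by ring.
Qed.

(* Green's formula for [u = x^2 / 2] and [v = w^2] gives
   [int w^2 = - int 2 x w (d w / d x) + boundary terms], and everything on the
   right vanishes when [grad w = 0] and [w = 0] on the boundary. *)
Lemma conforming_definite c : conforming c -> qform (@bdry_form R T P) c = 0 ->
  qform (@grad_form R T P) c <= qform (@flux_form R T P) c -> c = 0.
Proof.
move=> [match_c c0]; rewrite -bdry_formE -grad_formE -flux_formE => B0 GF.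
pose w := of_coef c.
have wP K : exists s, w K = peval s by exists (coef_poly2 c K); exact: of_coef_peval.
have cw K : continuous (w K) by have [s ->] := wP K; exact: peval_continuous.
have cw1 K : continuous (d1 (w K)).
  by have [s ->] := wP K; have [_ [t ->] _] := peval_derivatives s; exact: peval_continuous.
have cw2 K : continuous (d2 (w K)).
  by have [s ->] := wP K; have [_ _ [t ->]] := peval_derivatives s; exact: peval_continuous.
have cM (g h : R * R -> R) : continuous g -> continuous h -> continuous (fun p => g p * h p).
  by move=> cg ch p; apply: continuousM; [exact: cg|exact: ch].
have cD (g h : R * R -> R) : continuous g -> continuous h -> continuous (fun p => g p + h p).
  by move=> cg ch p; apply: continuousD; [exact: cg|exact: ch].
have cC (k : R) : continuous (fun _ : R * R => k) by move=> p; exact: cvg_cst.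
have sq0 (g : R * R -> R) p : 0 <= g p * g p by rewrite -expr2 sqr_ge0.
have w0 p K : w K p * w K p = 0 -> w K p = 0.
  by move=> /eqP; rewrite mulf_eq0 orbb => /eqP.
have eB := intG_eq0 (fun K p => sq0 (w K) p) B0.
(* The integrand contains the factor [w], which vanishes almost everywhere on the boundary edges. *)
have F0 : flux w w = 0.
  rewrite /flux intGE big1// => K aK; rewrite big1// => i bK.
  rewrite (edge_int_vanishing (cM _ _ (cw K) (cw K)) _ (sq0 (w K)) (eB K i aK bK)) ?mulr0//.
    exact: (cM _ _ (cD _ _ (cM _ _ (cw1 K) (cC (edge_normal (vtx K) i).1))
      (cM _ _ (cw2 K) (cC (edge_normal (vtx K) i).2))) (cw K)).
  by move=> p /w0 ->; rewrite mulr0.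
have dot0 K p : 0 <= dot (grad (w K) p) (grad (w K) p) by apply: addr_ge0; exact: (sq0 (fun=> _)).
have G0 : ip_grad w w = 0.
  apply/eqP; rewrite eq_le; apply/andP; split; first by rewrite -F0.
  by rewrite /ip_grad intOE; apply: sumr_ge0 => K _; exact: simplex_int_ge0.
have eG := intO_eq0 dot0 G0.
have grad0 K p : dot (grad (w K) p) (grad (w K) p) = 0 -> d1 (w K) p = 0.
  rewrite /dot /grad /= => /eqP; rewrite paddr_eq0 -?expr2 ?sqr_ge0//.
  by rewrite sqrf_eq0 => /andP[/eqP].
have [su u1 u2] := half_square_derivatives; set u := _ \* _ in su u1 u2.
pose v : broken T := fun K => w K \* w K.
have sv K : K \in active T -> smooth_on setT (v K).
  move=> _; have [s ws] := wP K; have -> : v K = peval (s * s).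
    by apply/funext => p; rewrite pevalM /v ws.
  exact: peval_smooth.
have green := @green_mesh R T setT u v openT (@subsetT _ _) su sv.
have {green} : intO (fun K p => laplacian u p * v K p + dot (grad u p) (grad (v K) p)) = 0.
  rewrite green => [|K L p aK aL Kp Lp]; last by rewrite /v /= /w (match_c K L).
  rewrite /flux intGE big1// => K aK; rewrite big1// => i bK.
  rewrite (edge_int_vanishing (cM _ _ (cw K) (cw K)) _ (sq0 (w K)) (eB K i aK bK)) ?mulr0//.
    rewrite /grad u1 u2.
    exact: (cM _ _ (cD _ _ (cM _ _ (@continuous_fst_plane R) (cC (edge_normal (vtx K) i).1))
      (cM _ _ (cC 0) (cC (edge_normal (vtx K) i).2))) (cM _ _ (cw K) (cw K))).
  by move=> p /w0 E; rewrite /v /= E !mulr0.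
have lapu p : laplacian u p = 1 by rewrite /laplacian u1 u2 d1_fst d2_cst addr0.
rewrite intOE (eq_bigr (fun K => simplex_int (vtx K) (fun p => w K p * w K p))); last first.
  move=> K aK; have DK := mesh_det K.
  transitivity (simplex_int (vtx K) (fun p => w K p * w K p + p.1 * (2 * (w K p * d1 (w K) p)))).
    apply: simplex_int_ext => p _; rewrite lapu /dot /grad u1 u2 /=.
    have dw : differentiable (w K) p by have [s ->] := wP K; exact: peval_differentiable.
    by rewrite (d1M dw dw) /v /=; ring.
  have ch : continuous (fun p : R * R => p.1 * (2 * (w K p * d1 (w K) p))).
    exact: (cM _ _ (@continuous_fst_plane R) (cM _ _ (cC 2) (cM _ _ (cw K) (cw1 K)))).
  have cdd : continuous (fun p : R * R => dot (grad (w K) p) (grad (w K) p)).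
    exact: (cD _ _ (cM _ _ (cw1 K) (cw1 K)) (cM _ _ (cw2 K) (cw2 K))).
  rewrite (simplex_intD DK (fun p _ => cM _ _ (cw K) (cw K) p) (fun p _ => ch p)).
  rewrite (simplex_int_vanishing DK cdd ch (dot0 K) (eG K aK)) ?addr0//.
  by move=> p /grad0 ->; rewrite !mulr0.
rewrite -(intOE (fun K p => w K p * w K p)) => /(intO_eq0 (fun K p => sq0 (w K) p)) eW.
(* The polynomial vanishes on the open interior of the triangle, which is nonempty since it contains
   the centroid [m]. *)
have cK0 K : K \in active T -> coef_poly2 c K = 0.
  move=> aK; have DK := mesh_det K.
  pose U : set (R * R) := ([set q | 0 < bary (vtx K) 0 q] `&` [set q | 0 < bary (vtx K) 1 q]) `&`
    [set q | 0 < bary (vtx K) 2%:R q].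
  have oB i : open [set q | 0 < bary (vtx K) i q].
    apply: (@open_comp _ _ (bary (vtx K) i) [set x : R | 0 < x]); last exact: open_gt.
    by move=> q _; exact: continuous_bary.
  pose m := \sum_(i < 3) 3^-1 *: vtx K i.
  have bm i : 0 < bary (vtx K) i m.
    rewrite /m bary_comb// ?invr_gt0// sumr_const card_ord.
    by rewrite -[_ *+ 3]mulr_natr mulVf.
  apply: (@poly2_vanishing R _ U m).
  - by apply: openI; first exact: openI.
  - by split; [split; exact: bm|exact: (bm 2%:R)].
  - move=> q [[b0 b1] b2]; rewrite -of_coef_peval.
    apply: (simplex_square_eq0 DK (cw K) (eW K aK)).
    by apply: (@ord3_ind 0); rewrite ?add0r.
apply/rowP => k; rewrite mxE -(enum_valK k).
have [aK|naK] := boolP ((enum_val k).1.1 \in active T); last exact: (c0 _ naK).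
have := of_coef0 (cK0 _ aK) (enum_val k).1.2 (enum_val k).2.
by rewrite -!surjective_pairing.
Qed.

End Definite.

(** * Compactness of the unit sphere of coefficients *)

Section CoefficientGap.
Variables (R : realType) (T : mesh R) (P : nat).
Notation mu := (@lebesgue_measure R).
Notation coef_idx := (coef_idx T P).
Implicit Types (c : 'rV[R]_#|coef_idx|).

Notation Gf := (qform (@grad_form R T P)).
Notation Ff := (qform (@flux_form R T P)).
Notation Bf := (qform (@bdry_form R T P)).
Notation Mf := (qform (@mass_form R T P)).

Lemma cluster_le (V : topologicalType) (F : set_system V) (v : V) (h : V -> R) :
  cluster F v -> continuous h -> F [set w | h w <= 0] -> h v <= 0.
Proof.
move=> clv ch Fh; rewrite leNgt; apply/negP => hv.
have nv : nbhs v [set w | 0 < h w].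
  apply: (ch v [set x : R | 0 < x]).
  by apply: open_nbhs_nbhs; split => //; exact: open_gt.
by have [w [/= w1 w2]] := clv _ _ Fh nv; move: w1; rewrite leNgt w2.
Qed.

Lemma continuous_add (V : topologicalType) (g h : V -> R) :
  continuous g -> continuous h -> continuous (fun v => g v + h v).
Proof. by move=> cg ch v; apply: continuousD; [exact: cg|exact: ch]. Qed.

Lemma continuous_opp (V : topologicalType) (g : V -> R) :
  continuous g -> continuous (fun v => - g v).
Proof. by move=> cg v; apply: continuousN; exact: cg. Qed.

Lemma continuous_mull (V : topologicalType) (a : R) (g : V -> R) :
  continuous g -> continuous (fun v => a * g v).
Proof. by move=> cg v; apply: continuousM; [exact: cst_continuous|exact: cg]. Qed.

Lemma bdry_form_ge0 c : 0 <= Bf c.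
Proof.
rewrite -bdry_formE intGE; apply: sumr_ge0 => K _; apply: sumr_ge0 => i _.
by rewrite mulr_ge0 ?sqrtr_ge0// edge_int_ge0// => p; rewrite -expr2 sqr_ge0.
Qed.

Lemma mass_form_ge0 c : 0 <= Mf c.
Proof.
rewrite -mass_formE /ipO intOE; apply: sumr_ge0 => K _.
by apply: simplex_int_ge0 => p; rewrite -expr2 sqr_ge0.
Qed.

Lemma of_coef_continuous K p : continuous (fun c => of_coef c K p).
Proof.
move=> c; apply: (@continuous_finsum R 'rV[R]_#|coef_idx| _
  (fun x c => coef c x * basis x K p)) => x.
apply: continuousM; last exact: cst_continuous.
exact: coef_continuous.
Qed.

(* Otherwise unit vectors violating the bound for each [k] have a cluster
   point, at which [B = 0] and [G <= F], so that it vanishes. *)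
Lemma conforming_gap : exists k : nat, forall c, conforming c -> `|c| = 1 ->
  k.+1%:R^-1 < Gf c - Ff c + k.+1%:R * Bf c.
Proof.
apply: contrapT => H.
have /choice[s sP] : forall k : nat, exists c, [/\ conforming c, `|c| = 1 &
    Gf c - Ff c + k.+1%:R * Bf c <= k.+1%:R^-1].
  move=> k; apply: contrapT => Hk; apply: H; exists k => c Vc c1.
  by rewrite ltNge; apply/negP => Qc; apply: Hk; exists c.
pose F : set_system 'rV[R]_#|coef_idx| := s @ \oo.
pose Sph : set 'rV[R]_#|coef_idx| := [set c : 'rV[R]_#|coef_idx| | `|c| = 1].
have cS : compact Sph.
  apply: bounded_closed_compact.
    by exists 1; split=> // x x1 c /= ->; exact: ltW.
  apply: (@preimage_closed _ _ (fun c : 'rV[R]_#|coef_idx| => `|c|) [set 1 : R]); last exact: closed_eq.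
  by move=> c _; exact: norm_continuous.
have FS : F Sph by exists 0 => // k _; rewrite /Sph /=; case: (sP k).
have [c [/= c1 clc]] := cS F (fmap_proper_filter _ _) FS.
have cQ k : continuous (fun c => Gf c - Ff c + k.+1%:R * Bf c - k.+1%:R^-1).
  have cG := @qform_continuous R T P (@grad_form R T P).
  have cF := continuous_opp (@qform_continuous R T P (@flux_form R T P)).
  have cB := @continuous_mull _ k.+1%:R _ (@qform_continuous R T P (@bdry_form R T P)).
  have cK : continuous (fun _ : 'rV[R]_#|coef_idx| => - k.+1%:R^-1 : R).
    by move=> d; exact: cst_continuous.
  exact: (continuous_add (continuous_add (continuous_add cG cF) cB) cK).
(* For [j] at least [k], the inequality satisfied by [s j] implies the one with [k]: the right-hand
   side decreases with the index, and [B] being nonnegative its weight may be lowered. Being closed,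
   the inequality passes to the cluster point. *)
have Qc k : Gf c - Ff c + k.+1%:R * Bf c <= k.+1%:R^-1.
  rewrite -subr_le0; apply: (cluster_le clc (cQ k)).
  exists k => // j /= kj; have [_ _ Qj] := sP j.
  rewrite subr_le0; apply: (@le_trans _ _ j.+1%:R^-1); last first.
    by rewrite lef_pV2 ?posrE ?ltr0n// ler_nat ltnS.
  apply: le_trans Qj; rewrite lerD2l ler_wpM2r ?bdry_form_ge0//.
  by rewrite ler_nat ltnS.
have Vc : conforming c.
  split=> [K L p aK aL Kp Lp|x xa].
    have e1 : of_coef c K p - of_coef c L p <= 0.
      apply: (cluster_le clc (h := fun c => of_coef c K p - of_coef c L p)).
        exact: (continuous_add (@of_coef_continuous K p) (continuous_opp (@of_coef_continuous L p))).
      by exists 0 => // k _; have [[Vk _] _ _] := sP k; rewrite /= (Vk K L) ?subrr.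
    have e2 : of_coef c L p - of_coef c K p <= 0.
      apply: (cluster_le clc (h := fun c => of_coef c L p - of_coef c K p)).
        exact: (continuous_add (@of_coef_continuous L p) (continuous_opp (@of_coef_continuous K p))).
      by exists 0 => // k _; have [[Vk _] _ _] := sP k; rewrite /= (Vk K L) ?subrr.
    by apply/eqP; rewrite eq_le -subr_le0 e1 -subr_le0 e2.
  have e1 : coef c x <= 0.
    apply: (cluster_le clc (@coef_continuous R T P x)).
    by exists 0 => // k _; have [[_ Vk] _ _] := sP k; rewrite /= Vk.
  have e2 : - coef c x <= 0.
    apply: (cluster_le clc (h := fun c => - coef c x)).
      exact: (continuous_opp (@coef_continuous R T P x)).
    by exists 0 => // k _; have [[_ Vk] _ _] := sP k; rewrite /= Vk ?oppr0.
  by apply/eqP; rewrite eq_le e1 -oppr_le0.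
have inv_le1 k : k.+1%:R^-1 <= 1 :> R by rewrite invf_le1 ?ltr0n// ler1n.
(* An index beyond (1 + F - G) / B would contradict [Qc], whose right-hand side is at most 1. *)
have B0 : Bf c = 0.
  apply/eqP; rewrite eq_le bdry_form_ge0 andbT leNgt; apply/negP => B0.
  pose r := (1 + Ff c - Gf c) / Bf c.
  have rk : (1 + Ff c - Gf c) / Bf c < (Num.truncn r).+1%:R by exact: truncnS_gt.
  rewrite ltr_pdivrMr// in rk.
  have := Qc (Num.truncn r); have := inv_le1 (Num.truncn r).
  move: rk; set t := _.+1%:R; set t' := t^-1; set b := t * _; lra.
have GF : Gf c <= Ff c.
  rewrite -subr_le0 leNgt; apply/negP => G0.
  pose r := (Gf c - Ff c)^-1.
  have rk := truncnS_gt r.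
  have := Qc (Num.truncn r); rewrite B0 mulr0 addr0 leNgt => /negP; apply.
  by rewrite invf_plt ?posrE ?ltr0n.
have := conforming_definite Vc B0 GF => c0.
by move: c1; rewrite /Sph /= c0 normr0 => /eqP; rewrite eq_sym oner_eq0.
Qed.

(** The gap on the unit sphere extends by homogeneity of degree two. One integer gives both the
    penalty weight and the inverse of the gap. *)
Lemma conforming_bound : exists k : nat, forall c, conforming c ->
  k.+1%:R^-1 * `|c| ^+ 2 <= Gf c - Ff c + k.+1%:R * Bf c.
Proof.
have [k Hk] := conforming_gap; exists k => c [V1 V2].
have [->|c0] := eqVneq c 0.
  have q0 q : qform q (0 : 'rV[R]_#|coef_idx|) = 0.
    by have := qformZ q 0 0; rewrite scale0r expr0n mul0r.
  by rewrite normr0 expr0n !q0 !mulr0 subrr addr0.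
have nc : 0 < `|c| by rewrite normr_gt0.
have Vc' : conforming (`|c|^-1 *: c).
  split=> [K L p aK aL Kp Lp|x xa]; first by rewrite !of_coefZ (V1 K L).
  by rewrite coefZ V2 ?mulr0.
have n1 : `| `|c|^-1 *: c | = 1.
  by rewrite normrZ normfV normr_id mulVf// gt_eqF.
have := ltW (Hk _ Vc' n1); rewrite !qformZ.
set x := `|c|^-1 ^+ 2; have x0 : 0 < x by rewrite exprn_gt0 ?invr_gt0.
have -> : x * Gf c - x * Ff c + k.+1%:R * (x * Bf c) =
  (Gf c - Ff c + k.+1%:R * Bf c) * x by ring.
by rewrite /x exprVn ler_pdivlMr// exprn_gt0.
Qed.

End CoefficientGap.

(** * Perturbation by the boundary shift and choice of the constants *)

Section Coercivity.
Variables (R : realType) (T : mesh R) (P : nat).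
Notation mu := (@lebesgue_measure R).
Notation coef_idx := (coef_idx T P).
Implicit Types (c : 'rV[R]_#|coef_idx|).

Lemma abs_le_enorm (p : R * R) : `|p.1| <= enorm p /\ `|p.2| <= enorm p.
Proof.
by split; rewrite -sqrtr_sqr; apply: ler_wsqrtr; rewrite /dot -!expr2 ?lerDl ?lerDr sqr_ge0.
Qed.

(** The square of [of_coef c] is a combination of products of basis functions, each Lipschitz on a
    fixed box, with coefficients at most the square of the norm of [c]. *)
Lemma shift_bound : exists2 C : R, 0 <= C &
  forall c K (p q : R * R) (delta : R), simplex (vtx K) p -> 0 <= delta <= 1 ->
    enorm (q - p) <= delta ->
    of_coef c K p * of_coef c K p - C * delta * `|c| ^+ 2 <=
    of_coef c K q * of_coef c K q.
Proof.
have /choice[mb mbP] : forall K : elt T, exists m : R, 0 < m /\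
    forall p, simplex (vtx K) p -> `|p.1| <= m /\ `|p.2| <= m.
  move=> K; have [m m0 Km] := compact_plane_finite (simplex_compact (mesh_det K)).
  by exists m.
(* A box of this size contains every triangle enlarged by 1, the largest shift allowed. *)
pose m := 1 + \sum_K mb K.
have mK K : mb K + 1 <= m.
  rewrite /m (bigD1 K)//= [1 + _]addrC -addrA lerD2l lerDr sumr_ge0// => L _.
  by have [/ltW] := mbP L.
pose J : finType := (coef_idx * coef_idx * elt T)%type.
have /choice[C CP] : forall z : J, exists C : R, 0 <= C /\
    forall p q : R * R, `|p.1| <= m -> `|p.2| <= m -> `|q.1| <= m -> `|q.2| <= m ->
      `|basis z.1.1 z.2 q * basis z.1.2 z.2 q - basis z.1.1 z.2 p * basis z.1.2 z.2 p| <=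
      C * (`|q.1 - p.1| + `|q.2 - p.2|).
  move=> z; have [s sE] := basis_peval z.1.1 z.2; have [t tE] := basis_peval z.1.2 z.2.
  have [C C0 CP] := peval_lipschitz (s * t) m; exists C; split=> // p q p1 p2 q1 q2.
  by rewrite sE tE -!pevalM; have [] := CP p q p1 p2 q1 q2.
have C0 z : 0 <= C z by have [] := CP z.
(* The factor 2 accounts for the two coordinates of the shift, and summing over all triangles makes
   the constant independent of [K]. *)
exists (2 * \sum_z C z); first by rewrite mulr_ge0// sumr_ge0.
move=> c K p q delta Kp /andP[d0 d1] qp.
have [e1 e2] := abs_le_enorm (q - p).
have {}e1 : `|q.1 - p.1| <= delta by exact: le_trans e1 qp.
have {}e2 : `|q.2 - p.2| <= delta by exact: le_trans e2 qp.
have [_ /(_ p Kp)[p1 p2]] := mbP K; have mKK := mK K.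
have q1 : `|q.1| <= m.
  rewrite -(subrK p.1 q.1); apply: le_trans (ler_normD _ _) _; lra.
have q2 : `|q.2| <= m.
  rewrite -(subrK p.2 q.2); apply: le_trans (ler_normD _ _) _; lra.
have p1m : `|p.1| <= m by lra.
have p2m : `|p.2| <= m by lra.
suff : `|of_coef c K q * of_coef c K q - of_coef c K p * of_coef c K p| <=
    2 * (\sum_z C z) * delta * `|c| ^+ 2.
  rewrite ler_norml => /andP[+ _]; set a1 := _ * _ * `|c| ^+ 2; lra.
have sq r : of_coef c K r * of_coef c K r =
    \sum_(z : coef_idx * coef_idx) coef c z.1 * coef c z.2 * (basis z.1 K r * basis z.2 K r).
  by rewrite /of_coef sum_mul_pair; apply: eq_bigr => z _; rewrite mulrACA.
rewrite !sq -sumrB; apply: le_trans (ler_norm_sum _ _ _) _.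
apply: (@le_trans _ _ (\sum_(z : coef_idx * coef_idx) `|c| ^+ 2 * (C (z, K) * (2 * delta)))).
  apply: ler_sum => z _; rewrite -mulrBr normrM; apply: ler_pM => //.
    by rewrite normrM expr2; apply: ler_pM => //; exact: coef_le_norm.
  have [_ /(_ p q p1m p2m q1 q2) h] := CP (z, K); apply: le_trans h _.
  by apply: ler_wpM2l; [exact: C0|lra].
rewrite -mulr_sumr -mulr_suml mulrC ler_wpM2r ?exprn_ge0//.
rewrite [leRHS](_ : _ = (\sum_z C z) * (2 * delta)); last by ring.
rewrite ler_wpM2r//; first by rewrite mulr_ge0.
have -> : \sum_z C z = \sum_z \sum_K C (z, K).
  by rewrite pair_bigA; apply: eq_bigr => -[].
apply: ler_sum => z _.
by rewrite (bigD1 K)//= lerDl sumr_ge0.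
Qed.

(** The pointwise hypothesis is first multiplied by the weight k + 1; this weight is then raised to
    1 / gamma, which is harmless because the square at the shifted point is nonnegative. Integration
    turns [eps] into [eps] times the boundary length. *)
Lemma opA_lower (M : R * R -> R * R) (Omega : set (R * R)) n (gamma eps : R) (k : nat) c :
  smooth_bounded_domain Omega n ->
  (forall p, Gbar T p -> frontier Omega (M p)) -> measurable_fun (Gbar T) M ->
  0 < gamma -> gamma <= k.+1%:R^-1 -> 
  (forall K i t, K \in active T -> bedge K i -> 0 <= t <= 1 ->
    let p := edge_pt (vtx K) i t in
    of_coef c K p * of_coef c K p - eps <= of_coef c K (M p) * of_coef c K (M p)) ->
  k.+1%:R * (qform (@bdry_form R T P) c - eps *
     \sum_(K in active T) \sum_(i < 3 | bedge K i) enorm (vtx K (i + 1) - vtx K i)) <=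
  opA gamma M (eval_at M (of_coef c)) (of_coef c).
Proof.
move=> smO MO mM g0 gk shift.
have k0 : 0 < k.+1%:R :> R by rewrite ltr0n.
have kg : k.+1%:R <= gamma^-1 by rewrite -[k.+1%:R]invrK lef_pV2 ?posrE ?invr_gt0.
rewrite -bdry_formE intGE mulr_sumr -sumrB mulr_sumr; apply: ler_sum => K aK.
rewrite mulr_sumr -sumrB mulr_sumr; apply: ler_sum => i bK.
rewrite [eps * _]mulrC -mulrBr mulrCA ler_wpM2l ?sqrtr_ge0//.
pose w := of_coef c K.
have cw : continuous w by rewrite /w of_coef_peval; exact: peval_continuous.
have cww : continuous (fun p => w p * w p) by move=> p; apply: continuousM; exact: cw.
have bm : bounded_measurable (fun t => w (M (edge_pt (vtx K) i t)) *
    (w (M (edge_pt (vtx K) i t)) / gamma)).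
  apply: (@bounded_measurableM _ (fun t => w (M (edge_pt (vtx K) i t)))
    (fun t => w (M (edge_pt (vtx K) i t)) / gamma)).
    exact: (bounded_measurable_continuous smO MO mM bK cw).
  apply: (@bounded_measurableM _ (fun t => w (M (edge_pt (vtx K) i t))) (cst gamma^-1)).
    exact: (bounded_measurable_continuous smO MO mM bK cw).
  exact: bounded_measurable_cst.
have cl : continuous (fun p => k.+1%:R * (w p * w p) + k.+1%:R * (- eps)).
  apply: continuous_add; first exact: continuous_mull.
  by move=> p; exact: cst_continuous.
have -> : k.+1%:R * (edge_int (vtx K) i (fun p => w p * w p) - eps) =
    edge_int (vtx K) i (fun p => k.+1%:R * (w p * w p) + k.+1%:R * (- eps)).
  rewrite edge_intD; [|exact: continuous_mull|by move=> p; exact: cst_continuous].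
  rewrite edge_intZ// mulrDr; congr (_ + _).
  rewrite /edge_int Rintegral_cst// /= lebesgue_measure_itv /= lte_fin ltr01.
  by rewrite -EFinB /= subr0 mulr1.
apply: le_Rintegral => //; [exact: (edge_integrable _ _ cl)|exact: (bounded_measurable_integrable bm)|].
move=> t; rewrite /= in_itv /= => t01; have := shift K i t aK bK t01; rewrite /= -/w.
set x := w _ * w _; set y := w (M _) * w (M _) => xy.
have y0 : 0 <= y by rewrite /y -expr2 sqr_ge0.
rewrite [leRHS]mulrA -/y -mulrDr; apply: (@le_trans _ _ (k.+1%:R * y)).
  by rewrite ler_pM2l.
by rewrite mulrC ler_wpM2l.
Qed.

Lemma coercive_ext (alpha gamma : R) M (w w' : broken T) :
  (forall K, K \in active T -> w K = w' K) ->
  [/\ H1normsq w = H1normsq w', opI alpha w w = opI alpha w' w', flux w w = flux w' w' &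
      opA gamma M (eval_at M w) w = opA gamma M (eval_at M w') w'].
Proof.
move=> E.
have e1 : ipO w w = ipO w' w' by apply: eq_bigr => K aK; rewrite E.
have e2 : ip_grad w w = ip_grad w' w' by apply: eq_bigr => K aK; rewrite E.
split.
- by rewrite /H1normsq e1 e2.
- by rewrite /opI e1 e2.
- by rewrite /flux !intGE; apply: eq_bigr => K aK; rewrite E.
- by rewrite /opA !intGE; apply: eq_bigr => K aK; rewrite /eval_at E.
Qed.

(** The gap [m] of [conforming_bound] is split into halves: one absorbs the error due to the shift,
    the other controls the H1 norm, itself at most a multiple of the norm of the coefficients. The
    term in [alpha] is nonnegative and is dropped. *)
Lemma shifted_form_coercive : exists delta0 gamma0 : R, [/\ 0 < delta0, 0 < gamma0 &
  forall (Omega : set (R * R)) (n M : R * R -> R * R) (alpha gamma : R),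
  smooth_bounded_domain Omega n ->
  (forall p, Gbar T p -> frontier Omega (M p)) ->
  measurable_fun (Gbar T) M ->
  0 <= alpha -> 0 < gamma -> gamma <= gamma0 ->
  (forall p, Gbar T p -> enorm (M p - p) <= delta0) ->
  coercive_form T P alpha gamma M].
Proof.
have [k Hk] := conforming_bound T P.
have [C C0 HC] := shift_bound.
pose L := \sum_(K in active T) \sum_(i < 3 | bedge K i) enorm (vtx K (i + 1) - vtx K i).
have L0 : 0 <= L by apply: sumr_ge0 => K _; apply: sumr_ge0 => i _; exact: sqrtr_ge0.
pose m : R := k.+1%:R^-1.
have m0 : 0 < m by rewrite invr_gt0 ltr0n.
pose A : R := k.+1%:R * C * L.
have A0 : 0 <= A by rewrite !mulr_ge0.
(* Chosen so that the shift error [A * d1] is at most half the gap; adding 1 avoids a division by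
   zero. *)
pose d1 : R := m / 2 / (A + 1).
have d10 : 0 < d1 by rewrite !divr_gt0//; lra.
have Ad1 : A * d1 <= m / 2.
  rewrite /d1 mulrA ler_pdivrMr; last lra.
  by rewrite mulrC mulrDr mulr1 lerDl; lra.
(* The shift is also capped at 1, the range in which [shift_bound] applies. *)
exists (Num.min 1 d1), m; split => //; first by rewrite lt_min ltr01.
move=> Omega n M alpha gamma smO MO mM al0 g0 gm Md.
set delta := Num.min 1 d1 in Md.
have dl : 0 <= delta <= 1.
  by rewrite /delta ge_min lexx andbT le_min ler01 ltW.
have dd1 : delta <= d1 by rewrite /delta ge_min lexx orbT.
pose h z := @mass_form R T P z + grad_form z.
pose H : R := \sum_z `|h z|.
have H0 : 0 <= H by apply: sumr_ge0.
(* [H] bounds the H1 form by the squared norm of the coefficients, so this constant uses up the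
   other half of the gap. *)
exists (m / 2 / (H + 1)); first by rewrite !divr_gt0//; lra.
move=> w Vw; have [c [cw c0]] := inV_of_coef Vw.
have [<- <- <- <-] := coercive_ext alpha gamma M cw.
have Vc : conforming c.
  by split=> // K L' p aK aL Kp Lp; rewrite !cw//; exact: (inV_match Vw).
set N2 := `|c| ^+ 2; have N20 : 0 <= N2 by rewrite exprn_ge0.
have low := @opA_lower M Omega n gamma (C * delta * N2) k c smO MO mM g0 gm.
have {}low : k.+1%:R * (qform (@bdry_form R T P) c - C * delta * N2 * L) <=
    opA gamma M (eval_at M (of_coef c)) (of_coef c).
  apply: low => K i t aK bK t01 /=; apply: HC => //.
    by apply: (@edge_simplex _ _ i); exists t.
  by apply: Md; exact: bedge_Gbar.
have hE : H1normsq (of_coef c) = qform h c.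
  rewrite /H1normsq mass_formE grad_formE /qform -big_split.
  by apply: eq_bigr => z _; rewrite /= mulrDr.
have hb := qform_bound h c; rewrite -/H -/N2 in hb.
have hN : m / 2 / (H + 1) * qform h c <= m / 2 * N2.
  apply: (@le_trans _ _ (m / 2 / (H + 1) * (H * N2))).
    rewrite ler_wpM2l ?divr_ge0//; [lra|lra|].
    exact: le_trans (ler_norm _) hb.
  rewrite mulrA ler_wpM2r// -mulrA ler_piMr; [|lra|].
    by [].
  by rewrite mulrC ler_pdivrMr; lra.
rewrite hE; apply: le_trans hN _.
rewrite /opI mass_formE grad_formE flux_formE.
have Mp := mass_form_ge0 c; have aM := mulr_ge0 al0 Mp.
have Hc := Hk c Vc; rewrite -/m -/N2 in Hc.
have small : A * delta * N2 <= m / 2 * N2.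
  rewrite ler_wpM2r//; apply: le_trans Ad1; exact: ler_wpM2l.
have lowE : k.+1%:R * (qform (@bdry_form R T P) c - C * delta * N2 * L) =
  k.+1%:R * qform (@bdry_form R T P) c - A * delta * N2 by rewrite /A; ring.
rewrite lowE in low; move: low Hc small.
set a1 := A * delta * N2; set a2 := k.+1%:R * _; set a3 := alpha * _ in aM *.
lra.
Qed.

End Coercivity.

Theorem proposition6p3 (R : realType) (T : mesh R) (P : nat) :
  exists delta0 gamma0 : R, [/\ 0 < delta0, 0 < gamma0 &
  forall (Omega : set (R * R)) (n M : R * R -> R * R) (alpha gamma : R)
    (f uRD qRN : R * R -> R),
  smooth_bounded_domain Omega n ->
  (forall p, Gbar T p -> frontier Omega (M p)) ->
  measurable_fun (Gbar T) M ->
  0 <= alpha -> 0 < gamma ->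
  domain_integrable T f ->
  bdry_integrable T (uRD \o M) ->
  bdry_integrable T (qRN \o M) ->
  [/\ asymptotic_preserving_dirichlet T P Omega n M alpha gamma f uRD qRN,
      asymptotic_preserving_neumann T P Omega n M alpha gamma f uRD qRN,
      (forall u : nat -> broken T,
         dirichlet_modes P n M alpha gamma f uRD qRN u ->
         forall m v, inV P v ->
           dirichlet_mode_problem n M alpha gamma f uRD qRN u m v),
      (gamma <= gamma0 ->
         (forall p, Gbar T p -> enorm (M p - p) <= delta0) ->
         coercive_form T P alpha gamma M) &
      (forall u : nat -> broken T,
         neumann_modes P n M alpha gamma f uRD qRN u ->
         forall m v, inV P v ->
           neumann_mode_problem n M alpha gamma f uRD qRN u m v)]].
Proof.
have [delta0 [gamma0 [d0 g0 coer]]] := shifted_form_coercive T P.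
exists delta0, gamma0; split=> // Omega n M alpha gamma f uRD qRN smO MO mM.
move=> al0 ga0 _ iRD iRN; split.
- exact: dirichlet_asymptotic_preserving.
- exact: neumann_asymptotic_preserving.
- exact: (dirichlet_modes_problem smO MO mM ga0 iRD iRN).
- by move=> gag MD; exact: (coer Omega n).
- exact: (neumann_modes_problem smO MO mM iRD iRN).
Qed.
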